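(* Let $n\ge 1$, let $a,b\in\mathbb{B}^n$, and let $M_a,M_b$ be automorphisms of $\mathbb{B}^n$ with $M_a(0)=a$ and $M_b(0)=b$. Then every geodesic-preserving mapping $f\in GP(\mathfrak{G}^{\mathbb{B}^n}_a,\mathfrak{G}^{\mathbb{B}^n}_b)$ is of the form $$f=M_b\circ g\circ M_a^{-1},$$ where $g:\mathbb{B}^n\to\mathbb{B}^n$ is a homogeneous polynomial mapping of some degree $m$ ($m$ a nonnegative integer).
   Context: $\mathbb{B}^n$ is the open Euclidean unit ball of $\mathbb{C}^n$; automorphism means biholomorphic self-map. A geodesic in a domain $\Omega$ is a curve that is length-minimizing for the Kobayashi metric $k_\Omega$ between any two of its points; a geodesic line is a geodesic defined on all of $\mathbb{R}$ whose limits at $\pm\infty$ lie on $\partial\Omega$. Geodesics are identified with their images. For $a\in\overline{\Omega}$, $\mathfrak{G}^{\Omega}_a$ is the family of all images $\gamma$ of geodesic lines in $\Omega$ with $a\in\overline{\gamma}$. Given families $\mathfrak{F}_1,\mathfrak{F}_2$ of geodesics in $\Omega_1,\Omega_2$, a holomorphic map $f:\Omega_1\to\Omega_2$ is geodesic-preserving, written $f\in GP(\mathfrak{F}_1,\mathfrak{F}_2)$, if for every $\gamma_1\in\mathfrak{F}_1$ there is $\gamma_2\in\mathfrak{F}_2$ with $f(\gamma_1)\subset\gamma_2$. A homogeneous polynomial mapping of degree $m$ is a map all of whose components are homogeneous polynomials of degree $m$ (or zero); degree $0$ means constant. *)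

(* Defs.v *)
From HB Require Import structures.
From mathcomp Require Import all_boot all_order all_algebra.
From mathcomp Require Import all_classical all_reals all_analysis.
From mathcomp Require Import complex.
From mathcomp Require mpoly.
Import (canonicals, coercions) mpoly.

Set Implicit Arguments.
Unset Strict Implicit.
Unset Printing Implicit Defensive.

Import Order.TTheory GRing.Theory Num.Theory.
Import numFieldNormedType.Exports.

Local Open Scope classical_set_scope.
Local Open Scope ring_scope.

(* C^n is the type 'rV[R[i]]_n of row vectors. Its library norm is the sup norm,
   which induces the usual topology; the Euclidean norm enters only through
   [unit_ball]. This instance gives R[i] the topology of its modulus. *)
HB.instance Definition _ (R : realType) := NormedModule.copy R[i] R[i]^o.

Definition unit_disc (R : realType) : set R[i] := [set z | `|z| < 1].

Definition unit_ball (R : realType) (n : nat) : set 'rV[R[i]]_n :=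
  [set z | \sum_(j < n) `|z 0 j| ^+ 2 < 1].
Arguments unit_ball : clear implicits.

Definition boundary (T : topologicalType) (A : set T) : set T :=
  closure A `\` A°.

(* Maps between subsets of C^n are total functions of which only the values on
   the source set matter. [differentiable] is Frechet differentiability over
   the scalar field R[i], so on an open set this is holomorphy. *)
Definition holomorphic_on (R : realType) (V W : normedModType R[i])
    (A : set V) (f : V -> W) : Prop :=
  forall z, A z -> differentiable f z.

Definition holomorphic_map (R : realType) (V W : normedModType R[i])
    (A : set V) (B : set W) (f : V -> W) : Prop :=
  set_fun A B f /\ holomorphic_on A f.

Definition automorphism (R : realType) (n : nat) (Omega : set 'rV[R[i]]_n)
    (M : 'rV[R[i]]_n -> 'rV[R[i]]_n) : Prop :=
  [/\ set_bij Omega Omega M, holomorphic_on Omega M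
    & holomorphic_on Omega (pinv Omega M)].

Definition artanh (R : realType) (r : R) : R := ln ((1 + r) / (1 - r)) / 2.

Definition poincare (R : realType) (z w : R[i]) : R :=
  artanh (complex.Re `|(z - w) / (1 - w^* * z)|).

Definition lempert (R : realType) (n : nat) (Omega : set 'rV[R[i]]_n)
    (p q : 'rV[R[i]]_n) : \bar R :=
  ereal_inf [set d | exists (phi : R[i] -> 'rV[R[i]]_n) (z w : R[i]),
    [/\ holomorphic_map (@unit_disc R) Omega phi,
        unit_disc z /\ unit_disc w, phi z = p, phi w = q
      & d = (poincare z w)%:E]].

(* d(x, s_0) + d(s_0, s_1) + ... along the chain x :: s *)
Definition chain_sum (R : realType) (T : Type) (d : T -> T -> \bar R)
    (x : T) (s : seq T) : \bar R :=
  (\sum_(pq <- zip (x :: s) s) d pq.1 pq.2)%E.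

(* The Kobayashi (pseudo)distance: the infimum over chains of analytic discs,
   i.e. the largest pseudodistance bounded above by the Lempert function. *)
Definition kobayashi (R : realType) (n : nat) (Omega : set 'rV[R[i]]_n)
    (p q : 'rV[R[i]]_n) : \bar R :=
  ereal_inf [set chain_sum (lempert Omega) p s | s in [set s | last p s = q]].

Definition curve_length (R : realType) (T : Type) (d : T -> T -> \bar R)
    (gamma : R -> T) (s t : R) : \bar R :=
  ereal_sup [set chain_sum d (gamma s) (map gamma l) | l in itv_partition s t].

Definition curve_in (R : realType) (n : nat) (Omega : set 'rV[R[i]]_n)
    (I : interval R) (gamma : R -> 'rV[R[i]]_n) : Prop :=
  {within [set` I], continuous gamma} /\ set_fun [set` I] Omega gamma.

Definition geodesic (R : realType) (n : nat) (Omega : set 'rV[R[i]]_n)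
    (I : interval R) (gamma : R -> 'rV[R[i]]_n) : Prop :=
  curve_in Omega I gamma /\
  forall s t : R, s \in I -> t \in I -> s <= t ->
  forall (u v : R) (sigma : R -> 'rV[R[i]]_n), u <= v ->
    curve_in Omega `[u, v] sigma -> sigma u = gamma s -> sigma v = gamma t ->
    (curve_length (kobayashi Omega) gamma s t
       <= curve_length (kobayashi Omega) sigma u v)%E.

Definition geodesic_line (R : realType) (n : nat) (Omega : set 'rV[R[i]]_n)
    (gamma : R -> 'rV[R[i]]_n) : Prop :=
  geodesic Omega `]-oo, +oo[ gamma /\
  exists p q : 'rV[R[i]]_n, [/\ boundary Omega p, boundary Omega q,
    gamma t @[t --> -oo] --> p & gamma t @[t --> +oo] --> q].

Definition geodesics_through (R : realType) (n : nat)
    (Omega : set 'rV[R[i]]_n) (a : 'rV[R[i]]_n) : set (set 'rV[R[i]]_n) :=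
  [set range gamma | gamma in
    [set gamma | geodesic_line Omega gamma /\ closure (range gamma) a]].

Definition geodesic_preserving (R : realType) (n1 n2 : nat)
    (Omega1 : set 'rV[R[i]]_n1) (Omega2 : set 'rV[R[i]]_n2)
    (F1 : set (set 'rV[R[i]]_n1)) (F2 : set (set 'rV[R[i]]_n2))
    (f : 'rV[R[i]]_n1 -> 'rV[R[i]]_n2) : Prop :=
  holomorphic_map Omega1 Omega2 f /\
  forall gamma1, F1 gamma1 ->
    exists2 gamma2, F2 gamma2 & f @` gamma1 `<=` gamma2.

(* The zero polynomial is in [ishomog1 m mdeg] for every m. *)
Definition homogeneous_map (R : realType) (n k m : nat)
    (g : 'rV[R[i]]_n -> 'rV[R[i]]_k) : Prop :=
  exists P : 'I_k -> mpoly.mpoly n R[i],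
    (forall j, P j \is mpoly.ishomog1 m mpoly.mdeg) /\
    forall z j, g z 0 j = mpoly.meval (fun i => z 0 i) (P j).

(* Main.v *)
From HB Require Import structures.
From mathcomp Require Import all_boot all_order all_algebra.
From mathcomp Require Import all_classical all_reals all_analysis.
From mathcomp Require Import complex ring lra zify.
From mathcomp Require mpoly.
Import (canonicals, coercions) mpoly.
Require Import Defs.
Set Implicit Arguments.
Unset Strict Implicit.
Unset Printing Implicit Defensive.
Import Order.TTheory GRing.Theory Num.Theory.
Import numFieldNormedType.Exports.
Local Open Scope classical_set_scope.
Local Open Scope ring_scope.

(** Put [g := Mb^-1 \o f \o Ma], a holomorphic map of the ball to itself. Three facts
    together say that [g] is a homogeneous polynomial map on the ball.

    Real diameters go into real lines through [0]. The Kobayashi distance is bounded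
    above by discs and below by holomorphic functions to the disc ([kobayashi_ge], from
    Harnack's inequality), so a disc with a holomorphic left inverse carries the
    diameters of the unit disc to geodesics ([disc_line_geodesic]). Conversely, two
    points of a geodesic on either side of the centre [b] become opposite after
    [Mb^-1], since otherwise the image of a segment under an explicit involution of
    the ball would be a shorter connection ([geodesic_opposite]). The same fact, used
    with the involution that exchanges [0] and [a], shows that [Ma] maps a diameter to
    a curve with limits on the sphere ([diameter_geodesic_line]). Hence for every unit
    vector [zeta] the points [g (t *: zeta)], with [t] real, are real multiples of one
    vector ([geodesic_line_real]).

    Such a map is homogeneous. On a complex line through [0] write
    [g (l *: z) = l ^+ m *: v l] with [v 0 <> 0]. Along each radius [v] stays in one
    real line, which is that of [v 0] by continuity at [0]; a holomorphic function with
    values in a real line is constant, so [g (l *: z) = l ^+ m *: g z]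
    ([radially_real_monomial]). The degree [m] does not depend on [z], by analytic
    continuation along complex lines ([degree_unique]).

    A homogeneous holomorphic map is polynomial. Its homogeneous extension to the whole
    space is an entire function of polynomial growth of each coordinate, hence given by
    Lagrange interpolation in each coordinate, and so it is a polynomial
    ([polynomial_of_lines]), of which only the part of degree [m] remains
    ([homogeneous_component]).

    The function theory rests on the maximum principle, which is proved from
    differentiability alone and without integrals: finite midpoint sums over the
    boundary of a square replace the contour integrals, and the argument of Goursat
    shows that they tend to [0] ([goursat]). Comparison with the sums of
    [1 / (w - z)] bounds [|h z|] by twice the maximum of [|h|] around [z], and the same
    bound for the powers of [h] removes the factor ([local_bound]). Removable
    singularities, Schwarz's lemma and Liouville's theorem follow from the maximum
    principle applied to difference quotients. *)

(** * The modulus and complex differentiability *)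

Section Modulus.
Variable R : realType.
Local Notation C := R[i].
Implicit Types z w : C.

(** The library norm of [R[i]] has its values in [R[i]]; estimates are made with this
    real-valued modulus. *)
Definition cmod (z : C) : R := Normc.normc z.

Lemma normE z : `|z| = (cmod z)%:C%C. Proof. by []. Qed.

Lemma cmod_ge0 z : 0 <= cmod z.
Proof. by case: z => x y; exact: sqrtr_ge0. Qed.

Lemma cmod0 : cmod 0 = 0. Proof. exact: Normc.normc0. Qed.

Lemma cmod1 : cmod 1 = 1. Proof. exact: Normc.normc1. Qed.

Lemma cmod_eq0 z : (cmod z == 0) = (z == 0).
Proof.
by apply/eqP/eqP => [/Normc.eq0_normc//|->]; exact: cmod0.
Qed.

Lemma cmod_gt0 z : (0 < cmod z) = (z != 0).
Proof. by rewrite lt0r cmod_eq0 cmod_ge0 andbT. Qed.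

Lemma cmodM z w : cmod (z * w) = cmod z * cmod w.
Proof. exact: Normc.normcM. Qed.

Lemma cmodV z : cmod z^-1 = (cmod z)^-1.
Proof. exact: Normc.normcV. Qed.

Lemma cmodX z n : cmod (z ^+ n) = cmod z ^+ n.
Proof. by elim: n => [|n IH]; rewrite ?cmod1// !exprS cmodM IH. Qed.

Lemma cmodN z : cmod (- z) = cmod z.
Proof. exact: normcN. Qed.

Lemma cmodB_sym z w : cmod (z - w) = cmod (w - z).
Proof. by rewrite -cmodN opprB. Qed.

Lemma cmodD z w : cmod (z + w) <= cmod z + cmod w.
Proof. exact: le_normcD. Qed.

Lemma cmodB z w : cmod (z - w) <= cmod z + cmod w.
Proof. by rewrite -(cmodN w) cmodD. Qed.

Lemma cmod_real (x : R) : cmod x%:C%C = `|x|.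
Proof. by rewrite /cmod /= expr0n addr0 sqrtr_sqr. Qed.

Lemma cmodi : cmod 'i%C = 1.
Proof. by rewrite /cmod /= expr0n expr1n add0r sqrtr1. Qed.

Lemma cmod_sqr z : cmod z ^+ 2 = complex.Re z ^+ 2 + complex.Im z ^+ 2.
Proof.
by case: z => x y; rewrite /cmod /= sqr_sqrtr// addr_ge0// sqr_ge0.
Qed.

Lemma normr_Re_le z : `|complex.Re z| <= cmod z.
Proof.
rewrite -(@ler_pXn2r _ 2)// ?nnegrE ?cmod_ge0//.
by rewrite real_normK ?num_real// cmod_sqr lerDl sqr_ge0.
Qed.

Lemma normr_Im_le z : `|complex.Im z| <= cmod z.
Proof.
rewrite -(@ler_pXn2r _ 2)// ?nnegrE ?cmod_ge0//.
by rewrite real_normK ?num_real// cmod_sqr lerDr sqr_ge0.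
Qed.

Lemma cmod_conj z : cmod z^*%C = cmod z.
Proof. by case: z => x y; rewrite /cmod /= sqrrN. Qed.

Lemma mul_conj_cmod z : z * z^*%C = ((cmod z) ^+ 2)%:C%C.
Proof. by rewrite -sqr_normc normE -rmorphXn. Qed.

Lemma unit_discE z : unit_disc z <-> cmod z < 1.
Proof. by rewrite /unit_disc /= normE (ltcR _ 1). Qed.

Lemma cvgC_P (T : Type) (F : set_system T) (FF : Filter F) (f : T -> C) (l : C) :
  (f x @[x --> F] --> l) <->
  (forall e : R, 0 < e -> \forall x \near F, cmod (f x - l) < e).
Proof.
split=> [/cvgrPdist_lt h e e0|h].
  have e0' : (0 : C) < e%:C%C by rewrite ltcR.
  by apply: filterS (h _ e0') => x; rewrite normE ltcR cmodB_sym.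
apply/cvgrPdist_lt => e e0.
have eE : e = (complex.Re e)%:C%C by rewrite (RRe_real (gtr0_real e0)).
have e0' : 0 < complex.Re e by rewrite -ltcR -eE.
by apply: filterS (h _ e0') => x; rewrite cmodB_sym normE eE ltcR.
Qed.

Lemma nbhsC_P z (P : set C) :
  nbhs z P <-> exists2 d : R, 0 < d & forall w, cmod (w - z) < d -> P w.
Proof.
split=> [/nbhs_ballP[e /= e0 h]|[d d0 h]].
  have eE : e = (complex.Re e)%:C%C by rewrite (RRe_real (gtr0_real e0)).
  exists (complex.Re e); first by rewrite -ltcR -eE.
  by move=> w wz; apply: h; rewrite -ball_normE /ball_ /= normE eE ltcR cmodB_sym.
apply/nbhs_ballP; exists d%:C%C => /=; first by rewrite ltcR.
by move=> w; rewrite -ball_normE /ball_ /= normE ltcR cmodB_sym => /h.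
Qed.

Lemma continuousC_P (f : C -> C) z : {for z, continuous f} <->
  forall e : R, 0 < e -> exists2 d : R, 0 < d &
    forall w, cmod (w - z) < d -> cmod (f w - f z) < e.
Proof.
have H := @cvgC_P _ (nbhs z) _ f (f z).
split=> [/H h e e0|h]; first by move: (h e e0) => /nbhsC_P.
by apply/H => e e0; apply/nbhsC_P; exact: h.
Qed.

(** Caratheodory's form of complex differentiability: the difference quotient
    extends continuously to the base point. *)
Lemma diff_caratheodory (f : C -> C) z : differentiable f z ->
  exists2 q : C -> C, {for z, continuous q} & forall w, f w = f z + (w - z) * q w.
Proof.
move=> /derivable1_diffP; rewrite /derivable => /cvg_ex[/= l /cvgC_P h].
exists (fun w => if w == z then l else (f w - f z) / (w - z)); last first.
  move=> w; case: eqVneq => [->|wz]; first by rewrite subrr mul0r addr0.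
  by rewrite mulrCA divff ?subr_eq0// mulr1 addrC subrK.
apply/continuousC_P => e e0; rewrite eqxx.
have := h e e0; rewrite near_withinE => /nbhsC_P[d d0 hd].
exists d => // w wz; case: eqVneq => [_|wnz]; first by rewrite subrr cmod0.
have wz0 : w - z != 0 by rewrite subr_eq0.
have := hd (w - z); rewrite subr0 => /(_ wz wz0).
rewrite [_%:A](_ : _ = w - z); last by rewrite -[LHS]/((w - z) * 1) mulr1.
by rewrite subrK mulrC.
Qed.

Lemma caratheodory_diff (f q : C -> C) z : {for z, continuous q} ->
  (forall w, f w = f z + (w - z) * q w) -> differentiable f z.
Proof.
move=> /continuousC_P h fq; apply/derivable1_diffP; apply/cvg_ex; exists (q z).
apply/cvgC_P => e e0; rewrite near_withinE; apply/nbhsC_P.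
have [d d0 hd] := h e e0; exists d => // w; rewrite subr0 => wd w0.
rewrite /= (_ : w *: 1 + z = w + z); last by rewrite -[w *: 1]/(w * 1) mulr1.
rewrite (fq (w + z)) [f z + _]addrC !addrK -[_ *: _]/(_ * _) mulKf//.
by apply: hd; rewrite addrK.
Qed.

End Modulus.

(** * Goursat's theorem for boundary sums *)

Section Goursat.
Variable R : realType.
Local Notation C := R[i].
Implicit Types (F G : C -> C) (p d z : C).

(** Midpoint sums along a segment, halved recursively: they stand in for line
    integrals, and their additivity is an identity between finite sums. *)
Fixpoint midsum F n p d : C :=
  if n is n'.+1 then midsum F n' p (d / 2) + midsum F n' (p + d / 2) (d / 2)
  else F (p + d / 2) * d.

Lemma midsumD F G n p d :
  midsum (fun z => F z + G z) n p d = midsum F n p d + midsum G n p d.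
Proof. by elim: n p d => [|n IH] p d /=; rewrite ?IH; ring. Qed.

Lemma midsumZ c F n p d : midsum (fun z => c * F z) n p d = c * midsum F n p d.
Proof. by elim: n p d => [|n IH] p d /=; rewrite ?IH; ring. Qed.

Lemma midsum_affine (a b : C) n p d :
  midsum (fun z => a * z + b) n p d = a * (p * d + d ^+ 2 / 2) + b * d.
Proof. by elim: n p d => [|n IH] p d /=; rewrite ?IH; field. Qed.

Lemma half_segment (t : R) p d :
  p + t%:C%C * (d / 2) = p + (t / 2)%:C%C * d.
Proof. by rewrite rmorphM fmorphV rmorph_nat; congr (_ + _); ring. Qed.

Lemma half_segment2 (t : R) p d :
  p + d / 2 + t%:C%C * (d / 2) = p + ((t + 1) / 2)%:C%C * d.
Proof. by rewrite rmorphM fmorphV rmorph_nat rmorphD rmorph1; field. Qed.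

Lemma mid_segment p d : p + d / 2 = p + (2^-1)%:C%C * d.
Proof. by rewrite fmorphV rmorph_nat; congr (_ + _); ring. Qed.

Lemma cmod_half d : cmod (d / 2) = cmod d / 2.
Proof. by rewrite cmodM cmodV -[2]/(2%:R) -(rmorph_nat (real_complex R)) cmod_real normr_nat. Qed.

Lemma cmod_midsum_le F n p d (B : R) :
  (forall t : R, 0 <= t <= 1 -> cmod (F (p + t%:C%C * d)) <= B) ->
  cmod (midsum F n p d) <= B * cmod d.
Proof.
elim: n p d => [|n IH] p d FB /=.
  rewrite cmodM ler_wpM2r ?cmod_ge0// mid_segment FB//; lra.
rewrite (le_trans (cmodD _ _))//.
have -> : B * cmod d = B * cmod (d / 2) + B * cmod (d / 2).
  by rewrite cmod_half; field.
rewrite lerD// IH// => t t01; first by rewrite half_segment FB//; lra.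
by rewrite half_segment2 FB//; lra.
Qed.

Lemma Im_midsum_ge F n p d (m : R) :
  (forall t : R, 0 <= t <= 1 -> m <= complex.Im (F (p + t%:C%C * d) * d)) ->
  m <= complex.Im (midsum F n p d).
Proof.
elim: n p d m => [|n IH] p d m Fm /=; first by rewrite mid_segment Fm//; lra.
have ImD (a b : C) : complex.Im (a + b) = complex.Im a + complex.Im b.
  by case: a b => ? ? [].
have half (a : C) : complex.Im (a * (d / 2)) = complex.Im (a * d) / 2.
  rewrite mulrA [_ / 2](_ : _ = (2^-1)%:C%C * (a * d)); last first.
    by rewrite fmorphV rmorph_nat; ring.
  by case: (a * d) => x y /=; ring.
rewrite ImD; have -> : m = m / 2 + m / 2 by field.
rewrite lerD// IH// => t t01; rewrite half ler_pM2r ?invr_gt0//.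
  by rewrite half_segment Fm//; lra.
by rewrite half_segment2 Fm//; lra.
Qed.

Lemma eq_midsum F G n p d :
  (forall t : R, 0 <= t <= 1 -> F (p + t%:C%C * d) = G (p + t%:C%C * d)) ->
  midsum F n p d = midsum G n p d.
Proof.
elim: n p d => [|n IH] p d FG /=; first by rewrite mid_segment FG//; lra.
congr (_ + _); apply: IH => t t01; first by rewrite half_segment FG//; lra.
by rewrite half_segment2 FG//; lra.
Qed.

(** The sum over the positively oriented boundary of a square. Letting the side [d] be
    complex covers at once the four squares that meet at a point. *)
Definition boxsum F n p d : C :=
  midsum F n p d + midsum F n (p + d) ('i%C * d)
  - midsum F n (p + 'i%C * d) d - midsum F n p ('i%C * d).

Definition boxpt p d (x y : R) : C := p + (x%:C%C + 'i%C * y%:C%C) * d.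

Lemma boxsumS F n p d :
  boxsum F n.+1 p d =
    boxsum F n p (d / 2) + boxsum F n (p + d / 2) (d / 2)
  + (boxsum F n (p + 'i%C * d / 2) (d / 2)
     + boxsum F n (p + d / 2 + 'i%C * d / 2) (d / 2)).
Proof.
rewrite /boxsum /=.
have -> : p + d / 2 + d / 2 = p + d by field.
have -> : p + 'i%C * d / 2 + 'i%C * (d / 2) = p + 'i%C * d by field.
have -> : p + d / 2 + 'i%C * d / 2 + 'i%C * (d / 2) = p + 'i%C * d + d / 2.
  by field.
have -> : p + d / 2 + 'i%C * d / 2 + d / 2 = p + d + 'i%C * d / 2 by field.
have -> : p + d / 2 + 'i%C * (d / 2) = p + 'i%C * d / 2 + d / 2 by field.
have -> : p + d / 2 + 'i%C * d / 2 = p + 'i%C * d / 2 + d / 2 by field.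
rewrite !mulrA; ring.
Qed.

Lemma boxsumD F G n p d :
  boxsum (fun z => F z + G z) n p d = boxsum F n p d + boxsum G n p d.
Proof. by rewrite /boxsum !midsumD; ring. Qed.

Lemma boxsum_affine (a b : C) n p d : boxsum (fun z => a * z + b) n p d = 0.
Proof. by rewrite /boxsum !midsum_affine; field. Qed.

Lemma boxpt_side0 p d (t : R) : p + t%:C%C * d = boxpt p d t 0.
Proof. by rewrite /boxpt rmorph0; ring. Qed.

Lemma boxpt_side1 p d (t : R) : p + d + t%:C%C * ('i%C * d) = boxpt p d 1 t.
Proof. by rewrite /boxpt rmorph1; ring. Qed.

Lemma boxpt_side2 p d (t : R) : p + 'i%C * d + t%:C%C * d = boxpt p d t 1.
Proof. by rewrite /boxpt rmorph1; ring. Qed.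

Lemma boxpt_side3 p d (t : R) : p + t%:C%C * ('i%C * d) = boxpt p d 0 t.
Proof. by rewrite /boxpt rmorph0; ring. Qed.

Lemma cmod_boxsum_le F n p d (B : R) :
  (forall x y : R, 0 <= x <= 1 -> 0 <= y <= 1 -> cmod (F (boxpt p d x y)) <= B) ->
  cmod (boxsum F n p d) <= 4 * B * cmod d.
Proof.
move=> FB; have i01 : 0 <= (0 : R) <= 1 by rewrite lexx ler01.
have i11 : 0 <= (1 : R) <= 1 by rewrite lexx ler01.
have di : cmod ('i%C * d) = cmod d by rewrite cmodM cmodi mul1r.
have H q e : cmod e = cmod d ->
    (forall t : R, 0 <= t <= 1 -> cmod (F (q + t%:C%C * e)) <= B) ->
  cmod (midsum F n q e) <= B * cmod d by move=> <-; exact: cmod_midsum_le.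
have h0 : cmod (midsum F n p d) <= B * cmod d.
  by apply: H => // t t01; rewrite boxpt_side0 FB.
have h1 : cmod (midsum F n (p + d) ('i%C * d)) <= B * cmod d.
  by apply: H => // t t01; rewrite boxpt_side1 FB.
have h2 : cmod (midsum F n (p + 'i%C * d) d) <= B * cmod d.
  by apply: H => // t t01; rewrite boxpt_side2 FB.
have h3 : cmod (midsum F n p ('i%C * d)) <= B * cmod d.
  by apply: H => // t t01; rewrite boxpt_side3 FB.
rewrite /boxsum (le_trans (cmodB _ _))//.
have := cmodB (midsum F n p d + midsum F n (p + d) ('i%C * d))
  (midsum F n (p + 'i%C * d) d).
have := cmodD (midsum F n p d) (midsum F n (p + d) ('i%C * d)).
lra.
Qed.

(** Measuring the sums against the area makes smallness pass from the four half-size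
    squares to the whole, with the same [e]. *)
Definition box_small F p d (e : R) := exists N : nat, forall n, (N <= n)%N ->
  cmod (boxsum F n p d) <= e * cmod d ^+ 2.

Lemma box_small_children F p d e :
  (forall a b : bool,
    box_small F (p + (a%:R + 'i%C * b%:R) * (d / 2)) (d / 2) e) ->
  box_small F p d e.
Proof.
move=> H; have [N0 h0] := H false false; have [N1 h1] := H true false.
have [N2 h2] := H false true; have [N3 h3] := H true true.
exists (maxn (maxn N0 N1) (maxn N2 N3)).+1 => -[//|n] hn.
have /h0 {}h0 : (N0 <= n)%N by move: hn; rewrite !gtn_max; lia.
have /h1 {}h1 : (N1 <= n)%N by move: hn; rewrite !gtn_max; lia.
have /h2 {}h2 : (N2 <= n)%N by move: hn; rewrite !gtn_max; lia.
have /h3 {}h3 : (N3 <= n)%N by move: hn; rewrite !gtn_max; lia.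
have E (a b : bool) : p + (a%:R + 'i%C * b%:R) * (d / 2) =
    (p + a%:R * (d / 2)) + b%:R * ('i%C * d / 2) by ring.
move: h0 h1 h2 h3; rewrite boxsumS !E /= ?mul0r ?mul1r ?addr0 cmod_half.
move: (boxsum F n p (d / 2)) (boxsum F n (p + d / 2) (d / 2)).
move: (boxsum F n (p + 'i%C * d / 2) (d / 2)).
move: (boxsum F n (p + d / 2 + 'i%C * d / 2) (d / 2)) => v u s t h0 h1 h2 h3.
have := cmodD (s + t) (u + v); have := cmodD s t; have := cmodD u v.
move: h0 h1 h2 h3; rewrite expr_div_n; lra.
Qed.

Lemma nested_dyadic (x : nat -> R) :
  (forall j, x j <= x j.+1 /\ x j.+1 + 2^-1 ^+ j.+1 <= x j + 2^-1 ^+ j) ->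
  exists X, forall j, x j <= X <= x j + 2^-1 ^+ j.
Proof.
move=> H.
have le_x j k : x j <= x (j + k)%N.
  elim: k => [|k IH]; rewrite ?addn0// addnS.
  by rewrite (le_trans IH)//; case: (H (j + k)%N).
have ge_x j k : x (j + k)%N + 2^-1 ^+ (j + k) <= x j + 2^-1 ^+ j.
  elim: k => [|k IH]; rewrite ?addn0// addnS.
  by rewrite (le_trans _ IH)//; case: (H (j + k)%N).
have pos j : 0 <= (2^-1 : R) ^+ j by rewrite exprn_ge0// invr_ge0.
have ub j : ubound (range x) (x j + 2^-1 ^+ j).
  move=> _ [k _ <-]; case: (leqP j k) => [/subnKC jk|/ltnW/subnKC kj].
    by have := ge_x j (k - j)%N; have := pos k; rewrite jk; lra.
  by have := le_x k (j - k)%N; have := pos j; rewrite kj; lra.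
have hs : has_sup (range x).
  by split; [exists (x 0%N), 0%N|exists (x 0%N + 2^-1 ^+ 0)].
exists (sup (range x)) => j; apply/andP; split.
  by apply: sup_upper_bound => //; exists j.
by apply: ge_sup => //; exists (x 0%N), 0%N.
Qed.

End Goursat.

Section GoursatTheorem.
Variable R : realType.
Local Notation C := R[i].
Implicit Types (F G : C -> C) (p d z : C).

Lemma geom_small (K r e : R) : 0 <= r < 1 -> 0 < e ->
  exists N : nat, forall n, (N <= n)%N -> K * r ^+ n < e.
Proof.
move=> /andP[r0 r1] e0.
have h : (geometric K r) x @[x --> \oo] --> (0 : R).
  by apply: cvg_geometric; rewrite ger0_norm.
have /cvgrPdist_lt/(_ e e0)[N _ hN] := h.
exists N => n /hN /=; rewrite sub0r normrN => /(le_lt_trans _); apply.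
exact: ler_norm.
Qed.

Lemma boxptB p d (x y X Y : R) :
  boxpt p d x y - boxpt p d X Y = ((x - X)%:C%C + 'i%C * (y - Y)%:C%C) * d.
Proof. by rewrite /boxpt !rmorphB; ring. Qed.

Lemma cmod_boxpt (x y e : R) d : `|x| <= e -> `|y| <= e ->
  cmod ((x%:C%C + 'i%C * y%:C%C) * d) <= 2 * e * cmod d.
Proof.
move=> xe ye; rewrite cmodM ler_wpM2r ?cmod_ge0//.
by have := cmodD x%:C%C ('i%C * y%:C%C); rewrite cmodM cmodi !cmod_real; lra.
Qed.

Lemma boxpt_sub p d (X Y x y h : R) :
  boxpt (boxpt p d X Y) (h%:C%C * d) x y = boxpt p d (X + h * x) (Y + h * y).
Proof. by rewrite /boxpt !rmorphD !rmorphM; ring. Qed.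

(** Linear approximation beats the side length: a square close enough to a point
    of differentiability has a boundary sum small against its area. *)
Lemma box_small_at F z (e : R) : 0 < e -> differentiable F z ->
  exists2 r : R, 0 < r & forall p d, 
    (forall x y : R, 0 <= x <= 1 -> 0 <= y <= 1 ->
       cmod (boxpt p d x y - z) <= 2 * cmod d) ->
    2 * cmod d < r -> box_small F p d e.
Proof.
move=> e0 /diff_caratheodory[q /continuousC_P qc Fq].
have e8 : 0 < e / 8 by rewrite divr_gt0.
have [r r0 hr] := qc _ e8; exists r => // p d pd dr; exists 0%N => n _.
have -> : F = fun w => (q z * w + (F z - q z * z)) + (w - z) * (q w - q z).
  by apply/funext => w; rewrite (Fq w); ring.
rewrite boxsumD boxsum_affine add0r.
have -> : e * cmod d ^+ 2 = 4 * (2 * cmod d * (e / 8)) * cmod d by field.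
apply: cmod_boxsum_le => x y x01 y01.
rewrite cmodM ler_pM ?cmod_ge0 ?pd//; apply/ltW/hr.
by rewrite (le_lt_trans _ dr)// pd.
Qed.

(** A square with large boundary sums has a half-size child that is as bad relative to
    its area; the nested children shrink to a point, where [box_small_at] forbids it. *)
Lemma goursat F p d (e : R) : 0 < e ->
  (forall x y : R, 0 <= x <= 1 -> 0 <= y <= 1 -> differentiable F (boxpt p d x y)) ->
  box_small F p d e.
Proof.
move=> e0 dF; apply: contrapT => notsmall.
pose h j : R := 2^-1 ^+ j.
pose bad j (s : R * R) := ~ box_small F (boxpt p d s.1 s.2) ((h j)%:C%C * d) e.
pose next j (s : R * R) (ab : bool * bool) :=
  (s.1 + ab.1%:R * h j.+1, s.2 + ab.2%:R * h j.+1).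
have [f hf] : exists f, forall js : nat * (R * R),
    bad js.1 js.2 -> bad js.1.+1 (next js.1 js.2 (f js)).
  suff /choice[f hf] : forall js : nat * (R * R), exists ab,
    bad js.1 js.2 -> bad js.1.+1 (next js.1 js.2 ab) by exists f.
  move=> [j s] /=; apply: contrapT => /forallNP nb.
  have badjs : bad j s by apply: contrapT => gs; apply: (nb (false, false)).
  apply: badjs; apply: box_small_children => a b.
  apply: contrapT => bad1; apply: (nb (a, b)) => _.
  rewrite /bad /next /=; move: bad1.
  have -> : (h j)%:C%C * d / 2 = (h j.+1)%:C%C * d.
    by rewrite /h exprS rmorphM fmorphV rmorph_nat; ring.
  by have -> : boxpt p d s.1 s.2 + (a%:R + 'i%C * b%:R) * ((h j.+1)%:C%C * d)
     = boxpt p d (s.1 + a%:R * h j.+1) (s.2 + b%:R * h j.+1) by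
    rewrite /boxpt !rmorphD !rmorphM !rmorph_nat; ring.
pose st := fix st j := if j is j'.+1 then next j' (st j') (f (j', st j'))
  else ((0, 0) : R * R).
have badst j : bad j (st j).
  elim: j => [|j IH]; last exact: (hf (j, st j)).
  rewrite /bad /=; have -> : boxpt p d 0 0 = p.
    by rewrite /boxpt !rmorph0; ring.
  by rewrite /h expr0 rmorph1 mul1r.
have hS j : h j.+1 = h j / 2 by rewrite /h exprSr.
have h_ge0 j : 0 <= h j by rewrite exprn_ge0// invr_ge0.
have step (a : bool) : 0 <= (a%:R : R) <= 1 by case: a; rewrite ?lexx ?ler01.
have [X hX] : exists X, forall j, (st j).1 <= X <= (st j).1 + h j.
  apply: nested_dyadic => j; rewrite -!/(h _) hS /= hS.
  have := step (f (j, st j)).1; have := h_ge0 j; nra.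
have [Y hY] : exists Y, forall j, (st j).2 <= Y <= (st j).2 + h j.
  apply: nested_dyadic => j; rewrite -!/(h _) hS /= hS.
  have := step (f (j, st j)).2; have := h_ge0 j; nra.
have hX0 := hX 0%N; have hY0 := hY 0%N.
have X01 : 0 <= X <= 1 by move: hX0; rewrite /h expr0 /=; lra.
have Y01 : 0 <= Y <= 1 by move: hY0; rewrite /h expr0 /=; lra.
have [r r0 hr] := box_small_at e0 (dF X Y X01 Y01).
have [|N /(_ _ (leqnn N)) hN] := @geom_small (2 * cmod d) 2^-1 r _ r0; first by lra.
apply: (badst N); apply: hr => [x y x01 y01|]; last first.
  rewrite cmodM cmod_real ger0_norm//.
  by have -> : 2 * (h N * cmod d) = 2 * cmod d * 2^-1 ^+ N by rewrite /h; ring.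
rewrite boxpt_sub boxptB cmodM.
have := h_ge0 N; have := hX N; have := hY N => hYN hXN hN0.
rewrite [X in _ <= 2 * X]cmodM cmod_real ger0_norm// mulrA -cmodM.
apply: cmod_boxpt; rewrite ler_norml; nra.
Qed.

(** Where [F] is merely bounded at one corner, three of the four children are harmless
    and the fourth is a square with the same corner; its perimeter tends to zero. *)
Lemma goursat_corner F p d (B e : R) : 0 < e ->
  (forall x y : R, 0 <= x <= 1 -> 0 <= y <= 1 -> (x, y) != (0, 0) ->
     differentiable F (boxpt p d x y)) ->
  (forall x y : R, 0 <= x <= 1 -> 0 <= y <= 1 -> cmod (F (boxpt p d x y)) <= B) ->
  exists N : nat, forall n, (N <= n)%N -> cmod (boxsum F n p d) <= e.
Proof.
move=> e0 dF FB.
suff H j : forall d (e1 : R), 0 < e1 ->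
  (forall x y : R, 0 <= x <= 1 -> 0 <= y <= 1 -> (x, y) != (0, 0) ->
     differentiable F (boxpt p d x y)) ->
  (forall x y : R, 0 <= x <= 1 -> 0 <= y <= 1 -> cmod (F (boxpt p d x y)) <= B) ->
    exists N : nat, forall n, (N <= n)%N ->
    cmod (boxsum F n p d) <= e1 + 4 * B * cmod d * 2^-1 ^+ j.
  have e2 : 0 < e / 2 by rewrite divr_gt0.
  have [|j /(_ _ (leqnn j)) hj] := @geom_small (4 * B * cmod d) 2^-1 (e / 2) _ e2.
    lra.
  have [N hN] := H j d _ e2 dF FB; exists N => n /hN; lra.
elim: j => [|j IH] {e e0 dF FB} {}d e e0 dF FB.
  exists 0%N => n _; rewrite expr0 mulr1.
  by have := cmod_boxsum_le n FB; lra.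
have half x : 0 <= x <= 1 -> 0 <= x / 2 <= (1 : R) by lra.
have half1 x : 0 <= x <= 1 -> 0 <= (1 + x) / 2 <= (1 : R) by lra.
have nz1 (a b : R) : 0 < a -> (a, b) != (0, 0).
  by move=> a0; apply: contraTneq a0 => -[-> _]; rewrite ltxx.
have nz2 (a b : R) : 0 < b -> (a, b) != (0, 0).
  by move=> b0; apply: contraTneq b0 => -[_ ->]; rewrite ltxx.
have E0 x y : boxpt p (d / 2) x y = boxpt p d (x / 2) (y / 2).
  by rewrite /boxpt !rmorphM fmorphV rmorph_nat; ring.
have e2 : 0 < e / 2 by rewrite divr_gt0.
have [||N0 h0] := IH (d / 2) _ e2.
- move=> x y x01 y01 xy; rewrite E0; apply: dF; rewrite ?half//.
  by apply: contraNneq xy => -[] /eqP + /eqP; rewrite !mulf_eq0 !invr_eq0 !pnatr_eq0 !orbF => /eqP-> /eqP->.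
- by move=> x y x01 y01; rewrite E0; apply: FB; rewrite half.
pose m : R := cmod (d / 2) ^+ 2.
have m0 : 0 <= m by rewrite exprn_ge0// cmod_ge0.
have em : 0 < e / 2 / (3 * (m + 1)) by rewrite !divr_gt0//; lra.
have D x y : 0 <= x <= 1 -> 0 <= y <= 1 -> differentiable F (boxpt (p + d / 2) (d / 2) x y).
  move=> x01 y01.
  have -> : boxpt (p + d / 2) (d / 2) x y = boxpt p d ((1 + x) / 2) (y / 2).
    by rewrite /boxpt !rmorphM fmorphV rmorph_nat rmorphD rmorph1; field.
  by apply: dF; [exact: half1|exact: half|apply: nz1; lra].
have D1 x y : 0 <= x <= 1 -> 0 <= y <= 1 ->
    differentiable F (boxpt (p + 'i%C * d / 2) (d / 2) x y).
  move=> x01 y01.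
  have -> : boxpt (p + 'i%C * d / 2) (d / 2) x y = boxpt p d (x / 2) ((1 + y) / 2).
    by rewrite /boxpt !rmorphM fmorphV rmorph_nat rmorphD rmorph1; field.
  by apply: dF; [exact: half|exact: half1|apply: nz2; lra].
have D2 x y : 0 <= x <= 1 -> 0 <= y <= 1 ->
    differentiable F (boxpt (p + d / 2 + 'i%C * d / 2) (d / 2) x y).
  move=> x01 y01.
  have -> : boxpt (p + d / 2 + 'i%C * d / 2) (d / 2) x y =
      boxpt p d ((1 + x) / 2) ((1 + y) / 2).
    by rewrite /boxpt !rmorphM fmorphV rmorph_nat !rmorphD rmorph1; field.
  by apply: dF; rewrite ?half1//; apply: contraTneq y01 => -[]; lra.
have [N1 h1] := goursat em D; have [N2 h2] := goursat em D1.
have [N3 h3] := goursat em D2.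
exists (maxn (maxn N0 N1) (maxn N2 N3)).+1 => -[//|n] hn.
have /h0 {}h0 : (N0 <= n)%N by move: hn; rewrite !gtn_max; lia.
have /h1 {}h1 : (N1 <= n)%N by move: hn; rewrite !gtn_max; lia.
have /h2 {}h2 : (N2 <= n)%N by move: hn; rewrite !gtn_max; lia.
have /h3 {}h3 : (N3 <= n)%N by move: hn; rewrite !gtn_max; lia.
have em3 : 3 * (e / 2 / (3 * (m + 1)) * m) <= e / 2.
  have -> : 3 * (e / 2 / (3 * (m + 1)) * m) = e / 2 * (m / (m + 1)).
    by field; rewrite !lt0r_neq0//; lra.
  by rewrite ler_piMr ?(ltW e2)// ler_pdivrMr; lra.
move: h0 h1 h2 h3; rewrite boxsumS -/m exprS [cmod (d / 2)]cmod_half.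
move: (boxsum F n p (d / 2)) (boxsum F n (p + d / 2) (d / 2)).
move: (boxsum F n (p + 'i%C * d / 2) (d / 2)).
move: (boxsum F n (p + d / 2 + 'i%C * d / 2) (d / 2)) => v u s t h0 h1 h2 h3.
have := cmodD (s + t) (u + v); have := cmodD s t; have := cmodD u v.
move: h0 h1 h2 h3 em3; move: (e / 2 / _ * m) (2^-1 ^+ j) (cmod d) => X Y Z; lra.
Qed.

End GoursatTheorem.

(** * Cauchy estimate at the centre of a square *)

Section LocalBound.
Variable R : realType.
Local Notation C := R[i].
Implicit Types (f h : C -> C) (z w : C).

Lemma continuous_real_complex : continuous (fun x : R => x%:C%C : C).
Proof.
move=> x; apply/(@cvgC_P R R (nbhs x) _ (fun x => x%:C%C) x%:C%C) => e e0.
have /cvgrPdist_lt/(_ e e0) : id y @[y --> x] --> x by exact: cvg_id.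
by apply: filterS => y; rewrite -rmorphB cmod_real distrC.
Qed.

Lemma continuous_cmod : continuous (@cmod R).
Proof.
move=> z; apply/(@cvgrPdist_lt _ _ _ (nbhs z) _ (@cmod R) (cmod z)) => e e0.
apply/nbhsC_P; exists e => // w.
apply: le_lt_trans; rewrite ler_norml; apply/andP; split.
  by have := cmodD z (w - z); rewrite addrC subrK; lra.
by have := cmodD w (z - w); rewrite addrC subrK cmodB_sym; lra.
Qed.

Lemma compact_cdisc (z : C) (r : R) : compact [set w | cmod (w - z) <= r].
Proof.
pose sq : set (R * R) := `[-r, r] `*` `[-r, r].
pose em (p : R * R) : C := z + (p.1%:C%C + 'i%C * p.2%:C%C).
have csq : compact (em @` sq).
  apply: continuous_compact.
    apply: continuous_subspaceT => p.
    have c1 : {for p, continuous (fun p : R * R => p.1%:C%C : C)}.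
      by apply: continuous_comp; [exact: cvg_fst|exact: continuous_real_complex].
    have c2 : {for p, continuous (fun p : R * R => p.2%:C%C : C)}.
      by apply: continuous_comp; [exact: cvg_snd|exact: continuous_real_complex].
    have c3 : {for p, continuous (fun p : R * R => 'i%C * p.2%:C%C : C)}.
      exact: (continuousM (@cst_continuous _ _ _ _) c2).
    exact: (continuousD (@cst_continuous _ _ _ _) (continuousD c1 c3)).
  by apply: compact_setX; exact: segment_compact.
apply: (subclosed_compact _ csq).
  have -> : [set w | cmod (w - z) <= r] = (fun w => cmod (w - z)) @^-1` [set x | x <= r].
    by [].
  apply: closed_comp; last exact: closed_le.
  move=> w _; apply: (@cvg_comp _ _ _ (fun w => w - z) (@cmod R)); last exact: continuous_cmod.
  exact: (continuousB (@cvg_id _ _) (@cst_continuous _ _ _ _)).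
move=> w /= wr; exists (complex.Re (w - z), complex.Im (w - z)).
  by split; rewrite /= in_itv /= -ler_norml (le_trans _ wr)// ?normr_Re_le ?normr_Im_le.
by rewrite /em /= -complexE addrC subrK.
Qed.

Lemma cdisc_EVT (f : C -> R) z (r : R) : 0 <= r ->
  (forall w, cmod (w - z) <= r -> {for w, continuous f}) ->
  exists2 c, cmod (c - z) <= r & forall w, cmod (w - z) <= r -> f w <= f c.
Proof.
move=> r0 fc.
have [|||c cD cmax] := @compact_EVT_max C R f [set w | cmod (w - z) <= r].
- by exists z; rewrite /= subrr cmod0.
- exact: compact_cdisc.
- by apply: continuous_in_subspaceT => w; rewrite inE => /fc.
by exists c; [move: cD; rewrite inE|move=> w wD; apply: cmax; rewrite inE].
Qed.

Lemma differentiable_idC (V : normedModType C) (z : V) : differentiable (fun w : V => w) z.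
Proof. by apply: (@linear_differentiable _ _ _ idfun) => ?. Qed.

Lemma differentiable_quotient f (a : C) z w : z != w ->
  differentiable f w -> differentiable (fun x => (f x - a) / (x - z)) w.
Proof.
move=> zw df; apply: differentiableM; last first.
  apply: differentiableV; last by rewrite subr_eq0 eq_sym.
  by apply: differentiableB; [exact: differentiable_idC|exact: differentiable_cst].
by apply: differentiableB => //; exact: differentiable_cst.
Qed.

Lemma nbhs_neqC z w : z != w -> \forall x \near w, x != z.
Proof.
move=> zw; apply/nbhsC_P; exists (cmod (w - z)).
  by rewrite cmod_gt0 subr_eq0 eq_sym.
move=> x; apply: contraTneq => ->; by rewrite -leNgt cmodB_sym.
Qed.

Lemma differentiable_near (f g : C -> C) z : (\forall x \near z, f x = g x) ->
  differentiable f z -> differentiable g z.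
Proof.
move=> fg /derivable1_diffP df; apply/derivable1_diffP.
by apply: near_eq_derivable df.
Qed.

Lemma caratheodory_diff_off (f q : C -> C) z w :
  (forall w, f w = f z + (w - z) * q w) -> z != w ->
  differentiable f w -> differentiable q w.
Proof.
move=> fq zw /(differentiable_quotient (f z) zw); apply: differentiable_near.
have := nbhs_neqC zw; apply: filterS => x xz.
by rewrite (fq x) [f z + _]addrC addrK mulrC mulKf// subr_eq0.
Qed.

Lemma diff_contC f z : differentiable f z -> {for z, continuous f}.
Proof. exact: differentiable_continuous. Qed.

(** Sides of the four squares with common corner [z] that tile a square centred at [z]:
    in each of them the centre is the corner that [goursat_corner] allows. *)
Definition quadrant (k : nat) (r : R) : C := 'i%C ^+ k * r%:C%C.

Lemma cmod_quadrant k r : cmod (quadrant k r) = `|r|.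
Proof. by rewrite /quadrant cmodM cmodX cmodi expr1n mul1r cmod_real. Qed.

Lemma quadrantS k r : 'i%C * quadrant k r = quadrant k.+1 r.
Proof. by rewrite /quadrant exprS mulrA. Qed.

Lemma quadrant4 r : quadrant 4 r = quadrant 0 r.
Proof. by rewrite /quadrant (exprM _ 2 2) sqr_i sqrrN expr1n expr0. Qed.

(** The two sides of a square that avoid the corner [z]; over the four squares the
    other sides cancel. *)
Definition outsum (F : C -> C) n z (d : C) : C :=
  midsum F n (z + d) ('i%C * d) - midsum F n (z + 'i%C * d) d.

Lemma sum_boxsum_quadrants F n z r :
  \sum_(k < 4) boxsum F n z (quadrant k r) = \sum_(k < 4) outsum F n z (quadrant k r).
Proof.
rewrite !big_ord_recr !big_ord0 /= /boxsum /outsum !quadrantS quadrant4; ring.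
Qed.

End LocalBound.

Section CauchyEstimate.
Variable R : realType.
Local Notation C := R[i].
Implicit Types (f h : C -> C) (z w : C).

Lemma ImD z w : complex.Im (z + w) = complex.Im z + complex.Im w.
Proof. by case: z w => ? ? []. Qed.

Lemma real_imag_eq0 (x y : R) : x%:C%C + 'i%C * y%:C%C = 0 :> C -> x = 0 /\ y = 0.
Proof. by have <- := complexE (x +i* y)%C => -[-> ->]. Qed.

Lemma cmod_1ti (t : R) : -1 <= t <= 1 -> 1 <= cmod (1 + t%:C%C * 'i%C : C) <= 2.
Proof.
move=> t01; apply/andP; split.
  have := normr_Re_le (1 + t%:C%C * 'i%C : C); apply: le_trans.
  by rewrite /= mulr0 mul0r subr0 addr0 normr1.
have := cmodD (1 : C) (t%:C%C * 'i%C).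
have : `|t| <= 1 by rewrite ler_norml.
by rewrite cmod1 cmodM cmodi cmod_real mulr1; lra.
Qed.

Lemma kernel_Im (t : R) : -1 <= t <= 1 ->
  2^-1 <= complex.Im ((1 + t%:C%C * 'i%C)^-1 * 'i%C : C).
Proof.
move=> t01; have t2 : 0 <= t ^+ 2 <= 1 by nra.
have ii : 'i%C * 'i%C = -1 :> C by rewrite -expr2 sqr_i.
have E : (1 + t%:C%C * 'i%C)^-1 * 'i%C = ((1 + t ^+ 2)^-1)%:C%C * ('i%C + t%:C%C) :> C.
  have nz : 1 + t%:C%C * 'i%C != 0 :> C.
    by move/cmod_1ti: t01 => /andP[h _]; rewrite -cmod_gt0; lra.
  apply: (mulfI nz); rewrite mulVKf//.
  have -> : (1 + t%:C%C * 'i%C) * (((1 + t ^+ 2)^-1)%:C%C * ('i%C + t%:C%C)) =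
    ((1 + t ^+ 2)^-1)%:C%C * (('i%C + t%:C%C) + t%:C%C * ('i%C * 'i%C) + t%:C%C ^+ 2 * 'i%C) by ring.
  rewrite ii; have -> : 'i%C + t%:C%C + t%:C%C * -1 + t%:C%C ^+ 2 * 'i%C = (1 + t ^+ 2)%:C%C * 'i%C :> C.
    by rewrite rmorphD rmorph1 rmorphXn; ring.
  by rewrite mulrA -rmorphM mulVf ?rmorph1 ?mul1r// lt0r_neq0//; lra.
rewrite E /= addr0 mul0r addr0 mulr1.
by rewrite lef_pV2 ?posrE; lra.
Qed.

(** The role of [2 * pi * 'i] is played by the crude bound that each of the eight
    sides contributes at least [1 / 2] to the imaginary part of the kernel sum. *)
Lemma outsum_kernel_Im n z d : d != 0 ->
  1 <= complex.Im (outsum (fun w => (w - z)^-1) n z d).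
Proof.
move=> d0; rewrite /outsum.
have ii : 'i%C * 'i%C = -1 :> C by rewrite -expr2 sqr_i.
have i0 : 'i%C != 0 :> C by rewrite -cmod_eq0 cmodi oner_eq0.
have iV : 'i%C ^-1 = - 'i%C :> C by apply: (mulfI i0); rewrite mulfV// mulrN ii opprK.
rewrite -[- midsum _ _ _ _]mulN1r -midsumZ ImD [X in X <= _](_ : 1 = 2^-1 + 2^-1); last by field.
apply: lerD; apply: Im_midsum_ge => t t01.
  have -> : z + d + t%:C%C * ('i%C * d) - z = (1 + t%:C%C * 'i%C) * d by ring.
  rewrite invfM -!mulrA [d^-1 * _]mulrCA mulVf// mulr1.
  by apply: kernel_Im; lra.
have -> : z + 'i%C * d + t%:C%C * d - z = (1 + (- t)%:C%C * 'i%C) * ('i%C * d).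
  by rewrite rmorphN mulrDl mul1r -mulrA [_ * (_ * d)]mulrA ii; ring.
rewrite invfM [(_ * d)^-1]invfM iV.
have -> : forall x : C, -1 * (x * (- 'i%C * d^-1)) * d = x * 'i%C * (d^-1 * d).
  by move=> x; ring.
by rewrite mulVf// mulr1; apply: kernel_Im; lra.
Qed.

Lemma cmod_outsum_le F n z d (m : R) : 0 < cmod d ->
  (forall w, cmod d <= cmod (w - z) <= 2 * cmod d -> cmod (F w) <= m) ->
  cmod (outsum F n z d) <= 2 * m * cmod d.
Proof.
move=> d0 Fm; have ii : 'i%C * 'i%C = -1 :> C by rewrite -expr2 sqr_i.
have di : cmod ('i%C * d) = cmod d by rewrite cmodM cmodi mul1r.
have h1 : cmod (midsum F n (z + d) ('i%C * d)) <= m * cmod d.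
  rewrite -di; apply: cmod_midsum_le => t t01; apply: Fm.
  have -> : z + d + t%:C%C * ('i%C * d) - z = (1 + t%:C%C * 'i%C) * d by ring.
  rewrite cmodM; have : -1 <= t <= 1 by lra.
  by move/cmod_1ti; move: d0; nra.
have h2 : cmod (midsum F n (z + 'i%C * d) d) <= m * cmod d.
  apply: cmod_midsum_le => t t01; apply: Fm.
  have -> : z + 'i%C * d + t%:C%C * d - z = (1 + (- t)%:C%C * 'i%C) * ('i%C * d).
    by rewrite rmorphN mulrDl mul1r -mulrA [_ * (_ * d)]mulrA ii; ring.
  rewrite cmodM di; have : -1 <= - t <= 1 by lra.
  by move/cmod_1ti; move: d0; nra.
rewrite (le_trans (cmodB _ _))//; lra.
Qed.

Lemma eq_outsum F G n z d : 0 < cmod d ->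
  (forall w, cmod d <= cmod (w - z) <= 2 * cmod d -> F w = G w) ->
  outsum F n z d = outsum G n z d.
Proof.
move=> d0 FG; have ii : 'i%C * 'i%C = -1 :> C by rewrite -expr2 sqr_i.
have di : cmod ('i%C * d) = cmod d by rewrite cmodM cmodi mul1r.
rewrite /outsum; congr (_ - _); apply: eq_midsum => t t01; apply: FG.
  have -> : z + d + t%:C%C * ('i%C * d) - z = (1 + t%:C%C * 'i%C) * d by ring.
  rewrite cmodM; have : -1 <= t <= 1 by lra.
  by move/cmod_1ti; move: d0; nra.
have -> : z + 'i%C * d + t%:C%C * d - z = (1 + (- t)%:C%C * 'i%C) * ('i%C * d).
  by rewrite rmorphN mulrDl mul1r -mulrA [_ * (_ * d)]mulrA ii; ring.
rewrite cmodM di; have : -1 <= - t <= 1 by lra.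
by move/cmod_1ti; move: d0; nra.
Qed.

Lemma outsumB F G c n z d :
  outsum (fun w => F w + c * G w) n z d = outsum F n z d + c * outsum G n z d.
Proof. by rewrite /outsum !midsumD !midsumZ; ring. Qed.

(** Goursat's theorem, applied to the difference quotient of [h] at [z], identifies in
    the limit the boundary sums of [h w / (w - z)] and of [h z / (w - z)]; the first is
    at most [8 * m], and the second at least [4 * |h z|]. *)
Lemma local_bound2 h z (r m : R) : 0 < r ->
  (forall w, cmod (w - z) <= 2 * r -> differentiable h w) ->
  (forall w, r <= cmod (w - z) <= 2 * r -> cmod (h w) <= m) ->
  cmod (h z) <= 2 * m.
Proof.
move=> r0 dh hm.
have [|q qz hq] := diff_caratheodory (dh z _).
  by rewrite subrr cmod0; lra.
have dq w : z != w -> cmod (w - z) <= 2 * r -> differentiable q w.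
  by move=> zw wr; apply: (caratheodory_diff_off hq zw); exact: dh.
have [|w wr|c _ qB] := @cdisc_EVT R (fun w => cmod (q w)) z (2 * r).
- lra.
- apply: (@continuous_comp _ _ _ q (@cmod R)); last exact: continuous_cmod.
  by have [<-//|zw] := eqVneq z w; apply: diff_contC; exact: dq.
apply/ler_addgt0Pr => e e0.
have dr k : cmod (quadrant k r) = r by rewrite cmod_quadrant gtr0_norm.
have d0 k : quadrant k r != 0 by rewrite -cmod_gt0 dr.
have inbox k x y : 0 <= x <= 1 -> 0 <= y <= 1 ->
    cmod (boxpt z (quadrant k r) x y - z) <= 2 * r.
  move=> x01 y01; rewrite /boxpt addrAC subrr add0r -{2}(dr k) -[2]mulr1.
  by apply: cmod_boxpt; rewrite ler_norml; lra.
have gk (k : nat) : exists N : nat, forall n, (N <= n)%N ->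
    cmod (boxsum q n z (quadrant k r)) <= e.
  apply: (@goursat_corner R q z (quadrant k r) (cmod (q c)) e e0).
    move=> x y x01 y01 xy; apply: dq; last exact: inbox.
    rewrite eq_sym -subr_eq0 /boxpt addrAC subrr add0r mulf_neq0//.
    by apply: contraNneq xy => /real_imag_eq0[-> ->].
  by move=> x y x01 y01; apply: qB; exact: inbox.
have [N0 h0] := gk 0%N; have [N1 h1] := gk 1%N; have [N2 h2] := gk 2%N.
have [N3 h3] := gk 3%N.
pose n := maxn (maxn N0 N1) (maxn N2 N3).
have {}h0 := h0 n ltac:(rewrite /n; lia); have {}h1 := h1 n ltac:(rewrite /n; lia).
have {}h2 := h2 n ltac:(rewrite /n; lia); have {}h3 := h3 n ltac:(rewrite /n; lia).
have := sum_boxsum_quadrants q n z r.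
pose K k := outsum (fun w => (w - z)^-1) n z (quadrant k r).
pose H k := outsum (fun w => h w * (w - z)^-1) n z (quadrant k r).
have E k : outsum q n z (quadrant k r) = H k + (- h z) * K k.
  rewrite -outsumB; apply: eq_outsum; rewrite dr// => w wr.
  rewrite (hq w) -mulrDl [h z + _]addrC addrK mulrC mulKf//.
  by rewrite -cmod_gt0; lra.
have HB k : cmod (H k) <= 2 * m.
  have -> : 2 * m = 2 * (m / r) * cmod (quadrant k r).
    by rewrite dr; field; rewrite lt0r_neq0.
  apply: cmod_outsum_le; rewrite dr// => w wr.
  rewrite cmodM cmodV ler_pM ?cmod_ge0 ?invr_ge0 ?cmod_ge0 ?hm//.
  by rewrite lef_pV2 ?posrE//; lra.
have KI k : 1 <= complex.Im (K k) by exact: outsum_kernel_Im.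
clearbody K H.
rewrite !big_ord_recr !big_ord0 /= !add0r !E => S.
have {S} : h z * (K 0%N + K 1%N + K 2%N + K 3%N) = H 0%N + H 1%N + H 2%N + H 3%N -
  (boxsum q n z (quadrant 0 r) + boxsum q n z (quadrant 1 r) +
   boxsum q n z (quadrant 2 r) + boxsum q n z (quadrant 3 r)).
  rewrite S; ring.
move=> /(congr1 (@cmod R)); rewrite cmodM.
have K4 : 4 <= cmod (K 0%N + K 1%N + K 2%N + K 3%N).
  rewrite (le_trans _ (normr_Im_le _))// (le_trans _ (ler_norm _))// !ImD.
  have := KI 0%N; have := KI 1%N; have := KI 2%N; have := KI 3%N; lra.
have := cmodB (H 0%N + H 1%N + H 2%N + H 3%N) (boxsum q n z (quadrant 0 r) +
  boxsum q n z (quadrant 1 r) + boxsum q n z (quadrant 2 r) +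
  boxsum q n z (quadrant 3 r)).
have cmodD4 a b x y : cmod (a + b + x + y : C) <= cmod a + cmod b + cmod x + cmod y.
  by have := cmodD (a + b + x) y; have := cmodD (a + b) x; have := cmodD a b; lra.
have := cmodD4 (H 0%N) (H 1%N) (H 2%N) (H 3%N).
have := cmodD4 (boxsum q n z (quadrant 0 r)) (boxsum q n z (quadrant 1 r))
  (boxsum q n z (quadrant 2 r)) (boxsum q n z (quadrant 3 r)).
have := HB 0%N; have := HB 1%N; have := HB 2%N; have := HB 3%N.
have := ler_wpM2l (cmod_ge0 (h z)) K4; lra.
Qed.

Lemma differentiable_powC (f : C -> C) n z :
  differentiable f z -> differentiable (fun w => f w ^+ n) z.
Proof.
move=> df; elim: n => [|n IH].
  by under eq_fun do rewrite expr0; exact: differentiable_cst.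
by under eq_fun do rewrite exprS; exact: differentiableM.
Qed.

(** A constant factor is lost in [local_bound2], but the bound holds for all powers
    of [h] too, so the factor is in fact one. *)
Lemma local_bound h z (r m : R) : 0 < r ->
  (forall w, cmod (w - z) <= 2 * r -> differentiable h w) ->
  (forall w, r <= cmod (w - z) <= 2 * r -> cmod (h w) <= m) ->
  cmod (h z) <= m.
Proof.
move=> r0 dh hm; have m0 : 0 <= m.
  apply: (le_trans (cmod_ge0 (h (z + r%:C%C)))); apply: hm.
  by rewrite addrAC subrr add0r cmod_real gtr0_norm//; lra.
rewrite leNgt; apply/negP => mh.
have hz0 : 0 < cmod (h z) by lra.
have [||N /(_ _ (leqnn N))] := @geom_small R 2 (m / cmod (h z)) 1.
- by rewrite divr_ge0 ?cmod_ge0//= ltr_pdivrMr// mul1r.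
- by [].
rewrite expr_div_n mulrA ltr_pdivrMr ?exprn_gt0// mul1r ltNge => /negP; apply.
rewrite -cmodX; apply: (@local_bound2 (fun w => h w ^+ N) z r) => // w wr.
  exact/differentiable_powC/dh.
by rewrite cmodX lerXn2r ?nnegrE ?cmod_ge0 ?hm.
Qed.

End CauchyEstimate.

(** * The maximum principle *)

Section Disc.
Variable R : realType.
Local Notation C := R[i].
Implicit Types (f h : C -> C) (z w : C).

Lemma cmod_kernel_sqr (K : R) z w :
  cmod (K%:C%C + z^*%C * w) ^+ 2 =
  (K + cmod w ^+ 2) * (K + cmod z ^+ 2) - K * cmod (w - z) ^+ 2.
Proof. by case: z => a b; case: w => x y; rewrite !cmod_sqr /=; ring. Qed.

Lemma differentiable_affineC (a b : C) w : differentiable (fun x => a + b * x) w.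
Proof.
apply: differentiableD; first exact: differentiable_cst.
by apply: differentiableM; [exact: differentiable_cst|exact: differentiable_idC].
Qed.

(** Weighting [|f|] by [K + |z|^2] moves a hypothetical interior maximum to a point
    [z1] at which [f * (K + z1^* w)] has a strict one, against [local_bound]. *)
Lemma max_principle f (rho m : R) : 0 < rho ->
  (forall w, cmod w <= rho -> differentiable f w) ->
  (forall w, cmod w = rho -> cmod (f w) <= m) ->
  forall z, cmod z <= rho -> cmod (f z) <= m.
Proof.
move=> rho0 df fm z0 z0r; rewrite leNgt; apply/negP => mf.
have m0 : 0 <= m.
  apply: le_trans (cmod_ge0 (f rho%:C%C)) (fm _ _).
  by rewrite cmod_real gtr0_norm.
(* For large [K] the weight is so flat that [Phi z0] exceeds [Phi] on the circle. *)
have fm2 : 0 < cmod (f z0) ^+ 2 - m ^+ 2 by nra.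
pose K := (m ^+ 2 * rho ^+ 2 + 1) / (cmod (f z0) ^+ 2 - m ^+ 2).
have K0 : 0 < K by rewrite divr_gt0//; nra.
have KE : K * (cmod (f z0) ^+ 2 - m ^+ 2) = m ^+ 2 * rho ^+ 2 + 1.
  by rewrite divfK// lt0r_neq0.
pose Phi w := cmod (f w) ^+ 2 * (K + cmod w ^+ 2).
have cc w g : {for w, continuous g} -> {for w, continuous (fun x => cmod (g x : C))}.
  by move=> gc; apply: (@continuous_comp _ _ _ g (@cmod R)) gc _; exact: continuous_cmod.
have [|w wr|z1] := @cdisc_EVT R Phi 0 rho; rewrite ?subr0; first exact: ltW.
  have c1 := cc w f (diff_contC (df w _)); have c2 := cc w id (@cvg_id _ _).
  rewrite subr0 in wr; have {}c1 := c1 wr.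
  exact: (continuousM (continuousM c1 c1)
    (continuousD (@cst_continuous _ _ _ _) (continuousM c2 c2))).
move=> z1r Pmax; have z0P : Phi z0 <= Phi z1 by apply: Pmax; rewrite subr0.
have {}z1r : cmod z1 < rho.
  rewrite lt_neqAle z1r andbT; apply/eqP => z1E.
  move: z0P; rewrite /Phi z1E leNgt => /negP; apply.
  have := fm z1 z1E; have := cmod_ge0 (f z1); have := cmod_ge0 z0 => a b c.
  have : cmod (f z1) ^+ 2 * (K + rho ^+ 2) <= m ^+ 2 * (K + rho ^+ 2).
    by rewrite ler_wpM2r//; nra.
  have : cmod (f z0) ^+ 2 * K <= cmod (f z0) ^+ 2 * (K + cmod z0 ^+ 2).
    by rewrite ler_wpM2l ?sqr_ge0//; nra.
  move: KE; lra.
pose r := (rho - cmod z1) / 2.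
have r0 : 0 < r by rewrite /r; lra.
pose h w := f w * (K%:C%C + z1^*%C * w).
have inr w : cmod (w - z1) <= 2 * r -> cmod w <= rho.
  by rewrite /r => wz; have := cmodD (w - z1) z1; rewrite subrK; lra.
have hE w : cmod (h w) ^+ 2 = cmod (f w) ^+ 2 *
    ((K + cmod w ^+ 2) * (K + cmod z1 ^+ 2) - K * cmod (w - z1) ^+ 2).
  by rewrite /h cmodM exprMn cmod_kernel_sqr.
pose s := K + cmod z1 ^+ 2; have s0 : 0 < s by rewrite /s; have := sqr_ge0 (cmod z1); lra.
pose t := K + rho ^+ 2; have t0 : 0 < t by rewrite /t; have := sqr_ge0 rho; lra.
have hz1 : cmod (h z1) ^+ 2 = Phi z1 * s.
  by rewrite hE subrr cmod0 /Phi -/s; ring.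
have Phi0 : 0 < Phi z1.
  by apply: lt_le_trans z0P; rewrite mulr_gt0//; have := sqr_ge0 (cmod z0); nra.
have := @local_bound R (fun w => h w ^+ 2) z1 r (Phi z1 * (s - K * r ^+ 2 / t)) r0.
rewrite cmodX hz1 => H.
have : Phi z1 * s <= Phi z1 * (s - K * r ^+ 2 / t).
  apply: H => [w /inr wr|w wr].
    apply: differentiable_powC; apply: differentiableM; first exact: df.
    exact: differentiable_affineC.
  rewrite cmodX hE -/s; set u := K + cmod w ^+ 2.
  have wrho : cmod w <= rho by apply: inr; lra.
  have u0 : 0 < u by rewrite /u; have := sqr_ge0 (cmod w); lra.
  have ut : u <= t by rewrite /u /t lerD2l lerXn2r ?nnegrE ?cmod_ge0 ?(ltW rho0).
  have PhiE : cmod (f w) ^+ 2 * u = Phi w by [].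
  have -> : cmod (f w) ^+ 2 * (u * s - K * cmod (w - z1) ^+ 2) =
     Phi w * (s - K * cmod (w - z1) ^+ 2 / u).
    by rewrite -PhiE; field; rewrite lt0r_neq0.
  have B0 : 0 <= s - K * cmod (w - z1) ^+ 2 / u.
    rewrite subr_ge0 ler_pdivrMr// [s * u]mulrC -subr_ge0.
    by rewrite -[_ - _](cmod_kernel_sqr K z1 w) sqr_ge0.
  have Pw : Phi w <= Phi z1 by apply: Pmax; rewrite subr0.
  apply: ler_pM => //; first exact: mulr_ge0 (sqr_ge0 _) (ltW u0).
  rewrite lerD2l lerN2 ler_pM//.
  - exact: mulr_ge0 (ltW K0) (sqr_ge0 _).
  - by rewrite invr_ge0 ltW.
  - by rewrite ler_wpM2l ?(ltW K0)// lerXn2r ?nnegrE ?cmod_ge0 ?(ltW r0)//; lra.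
  - by rewrite lef_pV2.
rewrite ler_pM2l// leNgt => /negP; apply.
by rewrite ltrBlDr ltrDl divr_gt0// mulr_gt0// exprn_gt0.
Qed.

Lemma cont_mul_diff (q g : C -> C) x : {for x, continuous q} -> g x = 0 ->
  differentiable g x -> differentiable (fun w => q w * g w) x.
Proof.
move=> qc gx /diff_caratheodory[k kc gk].
apply: (@caratheodory_diff R _ (fun w => q w * k w)).
  exact: (continuousM qc kc).
by move=> w; rewrite (gk w) gx; ring.
Qed.

Lemma differentiable_prodC (X : seq C) w :
  differentiable (fun z : C => \prod_(x <- X) (z - x)) w.
Proof.
elim: X => [|x X IH].
  by under eq_fun do rewrite big_nil; exact: differentiable_cst.
under eq_fun do rewrite big_cons; apply: differentiableM; last exact: IH.
by apply: differentiableB; [exact: differentiable_idC|exact: differentiable_cst].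
Qed.

Lemma continuous_powC f n w :
  {for w, continuous f} -> {for w, continuous (fun x => f x ^+ n)}.
Proof.
move=> cf; elim: n => [|n IH].
  rewrite (_ : (fun x => f x ^+ 0) = cst 1); first exact: cst_continuous.
  by apply/funext => x; rewrite expr0.
rewrite (_ : (fun x => f x ^+ n.+1) = f * (fun x => f x ^+ n)).
  exact: (continuousM cf IH).
by apply/funext => x; rewrite exprS.
Qed.

(** Finitely many points of mere continuity do no harm: [f ^ N * \prod (z - x)] is
    differentiable there, and the product is negligible as [N] grows. *)
Lemma max_principle_off f (X : seq C) (rho m : R) : 0 < rho ->
  (forall w, cmod w <= rho -> {for w, continuous f}) ->
  (forall w, cmod w <= rho -> w \notin X -> differentiable f w) ->
  (forall w, cmod w = rho -> cmod (f w) <= m) ->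
  forall z, cmod z <= rho -> z \notin X -> cmod (f z) <= m.
Proof.
move=> rho0 cf df fm z zr zX; rewrite leNgt; apply/negP => mf.
have m0 : 0 <= m.
  apply: le_trans (cmod_ge0 (f rho%:C%C)) (fm _ _).
  by rewrite cmod_real gtr0_norm.
pose P w := \prod_(x <- X) (w - x).
have Pz : 0 < cmod (P z).
  rewrite cmod_gt0 prodf_seq_neq0; apply/allP => x xX /=; rewrite subr_eq0.
  by apply: contraNneq zX => ->.
have [|w wr|c _ cmax] := @cdisc_EVT R (fun w => cmod (P w)) 0 rho; first exact: ltW.
  apply: (@continuous_comp _ _ _ P (@cmod R)); last exact: continuous_cmod.
  exact/diff_contC/differentiable_prodC.
have fz0 : 0 < cmod (f z) by exact: le_lt_trans mf.
have [|N hN] := @geom_small R (cmod (P c)) (m / cmod (f z)) (cmod (P z)) _ Pz.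
  by rewrite divr_ge0 ?cmod_ge0//= ltr_pdivrMr// mul1r.
have {hN} := hN N.+1 (leqnSn _); rewrite expr_div_n mulrA ltr_pdivrMr ?exprn_gt0//.
rewrite -cmodX -cmodM ltNge => /negP; apply.
apply: (@max_principle (fun w => P w * f w ^+ N.+1) rho) => // w wr; last first.
  rewrite cmodM cmodX ler_pM ?cmod_ge0 ?exprn_ge0 ?cmod_ge0//.
    by apply: cmax; rewrite subr0 wr.
  by rewrite lerXn2r ?nnegrE ?cmod_ge0 ?fm.
have [wX|wX] := boolP (w \in X); last first.
  apply: differentiableM; first exact: differentiable_prodC.
  exact/differentiable_powC/df.
under eq_fun do rewrite mulrC; apply: cont_mul_diff.
- exact/continuous_powC/cf.
- by apply/eqP; rewrite prodf_seq_eq0; apply/hasP; exists w => //=; rewrite subrr.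
- exact: differentiable_prodC.
Qed.

End Disc.

(** * Removable singularities and Schwarz's lemma *)

Section Holomorphic.
Variable R : realType.
Local Notation C := R[i].
Implicit Types (f g h q : C -> C) (z w : C).

Lemma nbhs_notin (X : seq C) z :
  exists2 d : R, 0 < d & forall w, cmod (w - z) < d -> w != z -> w \notin X.
Proof.
elim: X => [|x X [d d0 IH]]; first by exists 1.
have [->|xz] := eqVneq x z.
  by exists d => // w wd wz; rewrite inE negb_or wz IH.
have xz0 : 0 < cmod (x - z) by rewrite cmod_gt0 subr_eq0.
exists (Num.min d (cmod (x - z))); first by rewrite lt_min d0.
move=> w; rewrite lt_min => /andP[wd wx] wz; rewrite inE negb_or IH// andbT.
by apply: contraTneq wx => ->; rewrite ltxx.
Qed.

Lemma max_principle_cont f (X : seq C) (rho m : R) : 0 < rho ->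
  (forall w, cmod w <= rho -> {for w, continuous f}) ->
  (forall w, cmod w <= rho -> w \notin X -> differentiable f w) ->
  (forall w, cmod w = rho -> cmod (f w) <= m) ->
  forall z, cmod z <= rho -> cmod (f z) <= m.
Proof.
move=> rho0 cf df fm z; rewrite le_eqVlt => /predU1P[/fm//|zr].
apply/ler_addgt0Pr => e e0.
have /continuousC_P/(_ e e0)[d1 d10 h1] := cf z (ltW zr).
have [d2 d20 h2] := nbhs_notin X z.
pose d := Num.min (Num.min d1 d2) (rho - cmod z) / 2.
have d0 : 0 < Num.min (Num.min d1 d2) (rho - cmod z).
  by rewrite !lt_min d10 d20 subr_gt0.
have dd : d < Num.min (Num.min d1 d2) (rho - cmod z) by rewrite /d; lra.
have {}d0 : 0 < d by rewrite divr_gt0.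
move: dd; rewrite !lt_min => /andP[/andP[dd1 dd2] dd3].
pose w := z + d%:C%C; have wz : cmod (w - z) = d.
  by rewrite /w addrAC subrr add0r cmod_real gtr0_norm.
have fw : cmod (f w) <= m.
  apply: (max_principle_off rho0 cf df fm).
    by have := cmodD z d%:C%C; rewrite cmod_real gtr0_norm// -/w; lra.
  by apply: h2; rewrite ?wz// -subr_eq0 -cmod_gt0 wz.
have := h1 w; rewrite wz => /(_ dd1) fwz.
by have := cmodD (f w) (f z - f w); rewrite addrC subrK cmodB_sym; lra.
Qed.

(** The limit at [0] is the supremum of the lower bounds [u z - M * |z|]. *)
Lemma lipschitz_limit0 (u : C -> R) (M r : R) : 0 < r -> 0 <= M ->
  (forall z w, z != 0 -> w != 0 -> cmod z <= r -> cmod w <= r ->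
     `|u z - u w| <= M * cmod (z - w)) ->
  exists l, forall z, z != 0 -> cmod z <= r -> `|u z - l| <= M * cmod z.
Proof.
move=> r0 M0 uM.
pose A := [set x | exists z, [/\ z != 0, cmod z <= r & x = u z - M * cmod z]].
have rC : r%:C%C != 0 :> C by rewrite -cmod_gt0 cmod_real gtr0_norm.
have rr : cmod (r%:C%C : C) <= r by rewrite cmod_real gtr0_norm.
have ub w : w != 0 -> cmod w <= r -> ubound A (u w + M * cmod w).
  move=> w0 wr _ [z [z0 zr ->]]; have h1 := le_trans (ler_norm _) (uM z w z0 w0 zr wr).
  by have := ler_wpM2l M0 (cmodB z w); rewrite mulrDr; lra.
have hs : has_sup A.
  split; first by exists (u r%:C%C - M * cmod r%:C%C), r%:C%C.
  by exists (u r%:C%C + M * cmod r%:C%C); exact: ub.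
exists (sup A) => z z0 zr; rewrite ler_norml.
have : sup A <= u z + M * cmod z.
  by apply: ge_sup; [case: hs|exact: ub].
have : u z - M * cmod z <= sup A by apply: sup_upper_bound => //; exists z.
lra.
Qed.

Lemma continuous_quotient f (a : C) z w : z != w -> {for w, continuous f} ->
  {for w, continuous (fun x => (f x - a) / (x - z))}.
Proof.
move=> zw cf.
have c1 : {for w, continuous (fun x => f x - a)}.
  exact: (continuousB cf (@cst_continuous _ _ _ _)).
have c2 : {for w, continuous (fun x => (x - z)^-1)}.
  apply: diff_contC; apply: differentiableV; last by rewrite subr_eq0 eq_sym.
  by apply: differentiableB; [exact: differentiable_idC|exact: differentiable_cst].
exact: (continuousM c1 c2).
Qed.

Lemma continuous_nearC f g z : (\forall x \near z, f x = g x) ->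
  {for z, continuous f} -> {for z, continuous g}.
Proof.
move=> /nbhsC_P[d d0 fg] /continuousC_P cf; apply/continuousC_P => e e0.
have [d1 d10 h] := cf e e0; exists (Num.min d d1); first by rewrite lt_min d0.
move=> w; rewrite lt_min => /andP[wd wd1].
by rewrite -(fg w wd) -(fg z) ?subrr ?cmod0// h.
Qed.

Lemma caratheodory_cont_off f q z w :
  (forall w, f w = f z + (w - z) * q w) -> z != w ->
  {for w, continuous f} -> {for w, continuous q}.
Proof.
move=> fq zw cf; have := @continuous_quotient f (f z) z w zw cf.
apply: continuous_nearC.
have := nbhs_neqC zw; apply: filterS => x xz.
by rewrite (fq x) [f z + _]addrC addrK mulrC mulKf// subr_eq0.
Qed.

(** The divided difference of [f] at [w, z, z'] is bounded for [w] on the circle,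
    uniformly in small [z] and [z'], hence by the maximum principle also for [w = 0]:
    the difference quotient of [f] at [0] is Lipschitz, and so it converges. *)
Lemma removable f (rho : R) : 0 < rho ->
  (forall w, cmod w <= rho -> {for w, continuous f}) ->
  (forall w, cmod w <= rho -> w != 0 -> differentiable f w) ->
  differentiable f 0.
Proof.
move=> rho0 cf df; pose hr := rho / 2; have hr0 : 0 < hr by rewrite divr_gt0.
have [|w wr|c cr cmax] := @cdisc_EVT R (fun w => cmod (f w)) 0 rho; first exact: ltW.
  by apply: (@continuous_comp _ _ _ f (@cmod R)); [apply: cf; rewrite -[w]subr0|exact: continuous_cmod].
pose M := cmod (f c).
have fM w : cmod w <= rho -> cmod (f w) <= M by move=> wr; apply: cmax; rewrite subr0.
have far z w : cmod z <= hr -> cmod w = rho -> hr <= cmod (w - z).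
  by move=> zr wr; have := cmodD (w - z) z; rewrite subrK wr /hr; rewrite /hr in zr; lra.
have neq z w : cmod z <= hr -> cmod w = rho -> z != w.
  by move=> zr wr; apply: contraTneq zr => ->; rewrite wr /hr -ltNge; lra.
pose M1 := (M + M) / hr; pose M2 := (M1 + M1) / hr.
have M_ge0 : 0 <= M by exact: cmod_ge0.
have M1_ge0 : 0 <= M1 by rewrite divr_ge0 ?addr_ge0 ?(ltW hr0).
have M2_ge0 : 0 <= M2 by rewrite divr_ge0 ?addr_ge0 ?(ltW hr0).
have bd g k z K : (forall w, g w = g z + (w - z) * k w) -> cmod z <= hr ->
    (forall w, cmod w <= rho -> cmod (g w) <= K) ->
    forall w, cmod w = rho -> cmod (k w) <= (K + K) / hr.
  move=> gk zr gK w wr; have h := far z w zr wr.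
  rewrite ler_pdivlMr//; apply: (@le_trans _ _ (cmod (k w) * cmod (w - z))).
    by rewrite ler_wpM2l ?cmod_ge0.
  rewrite -cmodM mulrC; have -> : (w - z) * k w = g w - g z.
    by rewrite (gk w) [g z + _]addrC addrK.
  by rewrite (le_trans (cmodB _ _))// lerD// gK// ?wr//; rewrite /hr in zr; lra.
pose Q z := (f z - f 0) / z.
have QM z z' : z != 0 -> z' != 0 -> cmod z <= hr -> cmod z' <= hr ->
    cmod (Q z - Q z') <= M2 * cmod (z - z').
  move=> z0 z0' zr zr'; have [->|zz'] := eqVneq z z'.
    by rewrite !subrr cmod0 mulr0.
  have zr1 : cmod z <= rho by move: zr; rewrite /hr; lra.
  have zr1' : cmod z' <= rho by move: zr'; rewrite /hr; lra.
  have [g cg fg] := diff_caratheodory (df z zr1 z0).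
  have cg' w : cmod w <= rho -> {for w, continuous g}.
    move=> wr; have [<-//|zw] := eqVneq z w.
    exact: (caratheodory_cont_off fg zw (cf w wr)).
  have dg w : cmod w <= rho -> w \notin [:: 0; z] -> differentiable g w.
    rewrite !inE negb_or => wr /andP[w0 wz].
    by apply: (caratheodory_diff_off fg); [rewrite eq_sym|exact: df].
  have gM w : cmod w <= rho -> cmod (g w) <= M1.
    by apply: (max_principle_cont rho0 cg' dg); exact: (bd f g z).
  have [|G cG gG] := diff_caratheodory (dg z' zr1' _).
    by rewrite !inE negb_or z0' eq_sym.
  have cG' w : cmod w <= rho -> {for w, continuous G}.
    move=> wr; have [<-//|zw] := eqVneq z' w.
    exact: (caratheodory_cont_off gG zw (cg' w wr)).
  have dG w : cmod w <= rho -> w \notin [:: 0; z; z'] -> differentiable G w.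
    rewrite !inE !negb_or => wr /and3P[w0 wz wz'].
    apply: (caratheodory_diff_off gG); [by rewrite eq_sym|apply: dg => //].
    by rewrite !inE negb_or w0.
  have GM : cmod (G 0) <= M2.
    apply: (max_principle_cont rho0 cG' dG); last by rewrite cmod0 ltW.
    exact: (bd g G z').
  have -> : Q z - Q z' = G 0 * (z - z').
    have z0z' : z' - z != 0 by rewrite subr_eq0 eq_sym.
    have g0 : g 0 = Q z by rewrite /Q (fg 0); field.
    have gz' : g z' = (f z' - f z) / (z' - z) by rewrite (fg z'); field.
    have G0 : G 0 = (g z' - g 0) / z' by rewrite (gG 0); field.
    rewrite G0 gz' g0 /Q; field.
    by rewrite z0 z0'.
  by rewrite cmodM ler_wpM2r ?cmod_ge0.
have [|a ha] := @lipschitz_limit0 (fun z => complex.Re (Q z)) M2 hr hr0 M2_ge0.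
  move=> z w z0 w0 zr wr; apply: le_trans (QM z w z0 w0 zr wr).
  by apply: le_trans (normr_Re_le _); case: (Q z) (Q w) => ? ? [].
have [|b hb] := @lipschitz_limit0 (fun z => complex.Im (Q z)) M2 hr hr0 M2_ge0.
  move=> z w z0 w0 zr wr; apply: le_trans (QM z w z0 w0 zr wr).
  by apply: le_trans (normr_Im_le _); case: (Q z) (Q w) => ? ? [].
pose l := (a +i* b)%C.
have Ql z : z != 0 -> cmod z <= hr -> cmod (Q z - l) <= 2 * M2 * cmod z.
  move=> z0 zr; rewrite [Q z - l]complexE.
  apply: le_trans (cmodD _ _) _; rewrite cmodM cmodi !cmod_real.
  have := ha z z0 zr; have := hb z z0 zr; rewrite /l; case: (Q z) => x y /=; lra.
apply: (@caratheodory_diff R f (fun z => if z == 0 then l else Q z)); last first.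
  move=> w; rewrite subr0; case: eqVneq => [->|w0]; first by rewrite mul0r addr0.
  by rewrite /Q mulrC divfK// addrC subrK.
apply/continuousC_P => e e0; exists (Num.min hr (e / (2 * M2 + 1))).
  by rewrite lt_min hr0 divr_gt0//; lra.
move=> w; rewrite eqxx subr0 lt_min => /andP[whr we].
case: eqVneq => [_|w0]; first by rewrite subrr cmod0.
apply: le_lt_trans (Ql w w0 (ltW whr)) _.
move: we; rewrite ltr_pdivlMr; last lra.
have := cmod_ge0 w; lra.
Qed.

Definition holD (r : R) f := forall w, cmod w < r -> differentiable f w.

Lemma holD_factor f (r : R) : 0 < r -> holD r f ->
  exists2 q, holD r q & forall w, f w = f 0 + w * q w.
Proof.
move=> r0 df; have [|q cq fq] := diff_caratheodory (df 0 _); first by rewrite cmod0.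
have dq w : cmod w < r -> w != 0 -> differentiable q w.
  move=> wr w0; apply: (caratheodory_diff_off fq); first by rewrite eq_sym.
  exact: df.
exists q => [w wr|w]; last by rewrite (fq w) subr0.
have [->|w0] := eqVneq w 0; last exact: dq.
apply: (@removable q (r / 2)); first by rewrite divr_gt0.
  move=> x xr; have [->//|x0] := eqVneq x 0.
  by apply: diff_contC; apply: dq => //; lra.
by move=> x xr x0; apply: dq => //; lra.
Qed.

Lemma schwarz f : holD 1 f -> f 0 = 0 ->
  (forall w, cmod w < 1 -> cmod (f w) <= 1) ->
  forall w, cmod w < 1 -> cmod (f w) <= cmod w.
Proof.
move=> df f0 f1 w w1; have [q dq fq] := holD_factor ltr01 df.
rewrite fq f0 add0r cmodM ler_piMr ?cmod_ge0// leNgt; apply/negP => q1.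
pose rho := Num.max (cmod w) ((1 + (cmod (q w))^-1) / 2).
have qV : (cmod (q w))^-1 < 1 by rewrite invf_lt1//; lra.
have qV0 : 0 < (cmod (q w))^-1 by rewrite invr_gt0; lra.
have rho1 : rho < 1 by rewrite gt_max w1 /=; lra.
have rhow : cmod w <= rho by rewrite le_max lexx.
have rhoq : (cmod (q w))^-1 < rho by rewrite lt_max; apply/orP; right; lra.
have rho0 : 0 < rho by lra.
have : cmod (q w) <= rho^-1.
  apply: (max_principle rho0) rhow => x xr; first by apply: dq; lra.
  have := f1 x; rewrite fq f0 add0r cmodM xr => /(_ rho1).
  by rewrite mulrC -ler_pdivlMr// mul1r.
by rewrite leNgt invf_plt ?posrE ?rhoq//; lra.
Qed.

(** A real line through [0] is squeezed into discs of every size by the Cayley maps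
    [y / (y + i c)], and Schwarz's lemma does not see [c]. *)
Lemma schwarz_real f : holD 1 f -> f 0 = 0 ->
  (forall w, cmod w < 1 -> complex.Im (f w) = 0) ->
  forall w, cmod w < 1 -> f w = 0.
Proof.
move=> df f0 fR w w1; apply/eqP; apply: contrapT => /negP fw0.
have fE x : cmod x < 1 -> f x = (complex.Re (f x))%:C%C.
  by move=> /fR; case: (f x) => a b /= ->.
have nz (c : R) x : 0 < c -> cmod x < 1 -> f x + c%:C%C * 'i%C != 0.
  move=> c0 /fE ->; rewrite -cmod_gt0; apply: lt_le_trans (normr_Im_le _).
  by rewrite normr_gt0 /= mulr1 mul0r addr0 add0r lt0r_neq0.
have sq (c : R) x : 0 < c -> cmod x < 1 ->
    cmod (f x + c%:C%C * 'i%C) ^+ 2 = complex.Re (f x) ^+ 2 + c ^+ 2.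
  by move=> c0 /fE ->; rewrite cmod_sqr /=; ring.
have fsq x : cmod x < 1 -> cmod (f x) ^+ 2 = complex.Re (f x) ^+ 2.
  by move=> /fE {1}->; rewrite cmod_real real_normK ?num_real.
have key (c : R) : 0 < c -> cmod (f w / (f w + c%:C%C * 'i%C)) <= cmod w.
  move=> c0; apply: (@schwarz (fun x => f x / (f x + c%:C%C * 'i%C))) => //.
  - move=> x x1; apply: differentiableM; first exact: df.
    apply: differentiableV; last exact: nz.
    by apply: differentiableD; [exact: df|exact: differentiable_cst].
  - by rewrite f0 mul0r.
  move=> x x1; rewrite cmodM cmodV ler_pdivrMr ?cmod_gt0 ?nz// mul1r.
  by rewrite -(@ler_pXn2r _ 2)// ?nnegrE ?cmod_ge0// sq// fsq// lerDl sqr_ge0.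
have a0 : 0 < cmod (f w) by rewrite cmod_gt0.
pose a := cmod (f w) ^+ 2; pose b := cmod w ^+ 2.
have a_gt0 : 0 < a by rewrite exprn_gt0.
have b01 : 0 <= b < 1 by rewrite /b sqr_ge0 exprn_ilt1 ?cmod_ge0.
have {}key (c : R) : 0 < c -> a <= b * (a + c ^+ 2).
  move=> c0; have := key c c0.
  rewrite cmodM cmodV ler_pdivrMr ?cmod_gt0 ?nz//.
  rewrite -(@ler_pXn2r _ 2)// ?nnegrE ?mulr_ge0 ?cmod_ge0//.
  by rewrite exprMn sq// -fsq.
have ab0 : 0 < a * (1 - b) / 2 by rewrite divr_gt0// mulr_gt0//; lra.
have c0 : 0 < Num.sqrt (a * (1 - b) / 2) by rewrite sqrtr_gt0.
have := key _ c0; rewrite sqr_sqrtr ?(ltW ab0)// leNgt => /negP; apply.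
rewrite -subr_gt0; have -> : a - b * (a + a * (1 - b) / 2) =
  a * (1 - b) / 2 * (2 - b) by field.
by rewrite mulr_gt0//; lra.
Qed.

End Holomorphic.

(** * Radially real functions and entire functions of polynomial growth *)

Section Homogeneity.
Variable R : realType.
Local Notation C := R[i].
Implicit Types (f g h q : C -> C) (z w : C).

(** If every power of [w] could be divided out, the maximum principle on a circle of
    radius [rho] would give [|u w| <= M * (|w| / rho) ^+ N] for all [N]. *)
Lemma holD_order (I : finType) (u : I -> C -> C) (r : R) : 0 < r ->
  (forall j, holD r (u j)) ->
  (forall j w, cmod w < r -> u j w = 0) \/
  exists (m : nat) (v : I -> C -> C), [/\ forall j, holD r (v j),
    exists j, v j 0 != 0 & forall j w, u j w = w ^+ m * v j w].
Proof.
move=> r0 du; apply: contrapT => /not_orP[nz nv].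
have fact (k : nat) : exists v : I -> C -> C, (forall j, holD r (v j)) /\
    forall j w, u j w = w ^+ k * v j w.
  elim: k => [|k [v [dv uv]]].
    by exists u; split => // j w; rewrite expr0 mul1r.
  have v0 j : v j 0 = 0.
    apply/eqP; apply: contrapT => /negP vj0; apply: nv; exists k, v; split => //.
    by exists j.
  have /choice[q hq] : forall j, exists q, holD r q /\ forall w, v j w = w * q w.
    move=> j; have [q dq vq] := holD_factor r0 (dv j); exists q; split => // w.
    by rewrite vq v0 add0r.
  exists q; split => [j|j w]; first by case: (hq j).
  by rewrite uv exprSr -mulrA; case: (hq j) => _ <-.
apply: nz => j w wr.
pose rho := (cmod w + r) / 2.
have rho0 : 0 < rho by have := cmod_ge0 w; rewrite /rho; lra.
have wrho : cmod w < rho by rewrite /rho; lra.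
have rhor : rho < r by rewrite /rho; lra.
have [|x xr|c _ cmax] := @cdisc_EVT R (fun x => cmod (u j x)) 0 rho; first exact: ltW.
  apply: (@continuous_comp _ _ _ (u j) (@cmod R)); last exact: continuous_cmod.
  by apply: diff_contC; apply: du; rewrite -[x]subr0; lra.
apply/eqP; rewrite -cmod_eq0 eq_le cmod_ge0 andbT; apply/ler_addgt0Pr => e e0.
rewrite add0r.
have [|N /(_ N (leqnn N)) hN] := @geom_small R (cmod (u j c)) (cmod w / rho) e _ e0.
  by rewrite divr_ge0 ?cmod_ge0 ?(ltW rho0)//= ltr_pdivrMr// mul1r.
have [v [dv uv]] := fact N; apply: le_trans (ltW hN).
rewrite uv cmodM cmodX expr_div_n mulrCA ler_wpM2l ?exprn_ge0 ?cmod_ge0//.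
apply: (max_principle rho0) (ltW wrho) => x xr; first by apply: dv; lra.
rewrite ler_pdivlMr ?exprn_gt0// mulrC -{1}xr -cmodX -cmodM -uv.
by apply: cmax; rewrite subr0 xr.
Qed.

Lemma approach0 (F : C -> C) w (e : R) : 0 < e -> {for 0, continuous F} ->
  exists2 t : R, 0 < t < 1 & cmod (F (t%:C%C * w) - F 0) < e.
Proof.
move=> e0 /continuousC_P/(_ e e0)[d d0 h].
pose K := 2 * (1 + d + cmod w); have w0 := cmod_ge0 w.
have K0 : 0 < K by rewrite /K; lra.
have t0 : 0 < d / K by rewrite divr_gt0.
exists (d / K).
  by rewrite t0 ltr_pdivrMr// mul1r /K; lra.
apply: h; rewrite subr0 cmodM cmod_real gtr0_norm//.
by rewrite mulrAC ltr_pdivrMr// ltr_pM2l// /K; lra.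
Qed.

Lemma Im_limit0 (F : C -> C) w : {for 0, continuous F} ->
  (forall t : R, 0 < t < 1 -> complex.Im (F (t%:C%C * w)) = 0) ->
  complex.Im (F 0) = 0.
Proof.
move=> cF F0; apply/eqP; rewrite -normr_eq0 eq_le normr_ge0 andbT.
apply/ler_addgt0Pr => e e0; rewrite add0r.
have [t t01 ht] := approach0 w e0 cF.
apply: le_trans (ltW ht); apply: le_trans (normr_Im_le _).
by have := F0 t t01; case: (F _) (F 0) => a b [x y] /= ->; rewrite sub0r normrN.
Qed.

Lemma eq_limit0 (F : C -> C) w : {for 0, continuous F} ->
  (forall t : R, 0 < t < 1 -> F (t%:C%C * w) = 0) -> F 0 = 0.
Proof.
move=> cF F0; apply/eqP; rewrite -cmod_eq0 eq_le cmod_ge0 andbT.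
apply/ler_addgt0Pr => e e0; rewrite add0r.
have [t t01 ht] := approach0 w e0 cF.
by apply: le_trans (ltW ht); rewrite F0// sub0r cmodN.
Qed.

(** After division by the lowest power, the value at [0] is nonzero and spans the
    real line of every radius; so the quotient takes values in one real line. *)
Lemma radially_real_monomial (I : finType) (u : I -> C -> C) :
  (forall j, holD 1 (u j)) ->
  (forall w, cmod w < 1 -> exists e : I -> C, forall t : R, 0 < t <= 1 ->
     exists s : R, forall j, u j (t%:C%C * w) = s%:C%C * e j) ->
  (forall j w, cmod w < 1 -> u j w = 0) \/
  exists (m : nat) (c : I -> C), (exists j, c j != 0) /\
    forall j w, cmod w < 1 -> u j w = w ^+ m * c j.
Proof.
move=> du ue; have [|[m [v [dv [k vk0] uv]]]] := holD_order ltr01 du; first by left.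
right; exists m, (fun j => v j 0); split; first by exists k.
have z1 : cmod (0 : C) < 1 by rewrite cmod0.
have cv j : {for 0, continuous (v j)} by exact/diff_contC/dv.
have key w : cmod w < 1 -> w != 0 ->
    complex.Im (v k 0 * (v k w)^*%C) = 0 /\ forall j, v j 0 * v k w = v j w * v k 0.
  move=> w1 w0; have wm0 : w ^+ m != 0 by rewrite expf_neq0.
  have [e he] := ue w w1.
  have [|s1 h1] := he 1; first by rewrite ltr01 lexx.
  rewrite rmorph1 mul1r in h1.
  have [s10|s10] := eqVneq s1 0.
    have vw j : v j w = 0.
      by apply: (mulfI wm0); rewrite mulr0 -uv h1 s10 rmorph0 mul0r.
    by split => [|j]; rewrite !vw ?mulr0 ?mul0r ?conjc0 ?mulr0.
  have tw (t : R) : 0 < t < 1 -> exists s : R, forall j, v j (t%:C%C * w) = s%:C%C * v j w.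
    move=> /andP[t0 t1]; have [|s hs] := he t; first by rewrite t0 ltW.
    exists (s / (s1 * t ^+ m)) => j; have tm : t%:C%C ^+ m != 0 :> C.
      by rewrite expf_neq0// -cmod_gt0 cmod_real normr_gt0 lt0r_neq0.
    have s1C : s1%:C%C != 0 :> C by rewrite -cmod_gt0 cmod_real normr_gt0.
    have := hs j; have := h1 j; rewrite !uv exprMn => a b.
    have E : s1%:C%C * (t%:C%C ^+ m * w ^+ m * v j (t%:C%C * w)) =
        s%:C%C * (w ^+ m * v j w) by rewrite b a; ring.
    apply: (mulfI wm0); apply: (mulfI tm); apply: (mulfI s1C).
    transitivity (s1%:C%C * (t%:C%C ^+ m * w ^+ m * v j (t%:C%C * w))); first by ring.
    by rewrite E rmorphM fmorphV rmorphM rmorphXn; field; rewrite s1C tm.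
  split=> [|j].
    pose F x := v k x * (v k w)^*%C.
    have cF : {for 0, continuous F}.
      exact: (continuousM (cv k) (@cst_continuous _ _ _ _)).
    apply: (@Im_limit0 F w) => // t /tw[s hs]; rewrite /F hs -mulrA mul_conj_cmod.
    by rewrite -rmorphM.
  pose F x := v j x * v k w - v j w * v k x.
  have cF : {for 0, continuous F}.
    exact: (continuousB (continuousM (cv j) (@cst_continuous _ _ _ _))
      (continuousM (@cst_continuous _ _ _ _) (cv k))).
  apply/eqP; rewrite -subr_eq0; apply/eqP.
  apply: (@eq_limit0 F w) => // t /tw[s hs]; rewrite /F !hs; ring.
have vk w : cmod w < 1 -> v k w = v k 0.
  move=> w1; suff : v k w / v k 0 - 1 = 0.
    by move/eqP; rewrite subr_eq0 => /eqP h; rewrite -[LHS](divfK vk0) h mul1r.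
  apply: (@schwarz_real R (fun x => v k x / v k 0 - 1)); last exact: w1.
  - move=> x x1; apply: differentiableB; last exact: differentiable_cst.
    by apply: differentiableM; [exact: dv|exact: differentiable_cst].
  - by rewrite divff// subrr.
  move=> x x1; have [->|x0] := eqVneq x 0; first by rewrite divff// subrr.
  have [h _] := key x x1 x0.
  have -> : v k x / v k 0 = (v k 0 * (v k x)^*%C)^*%C * ((cmod (v k 0) ^+ 2)^-1)%:C%C.
    have -> : ((cmod (v k 0) ^+ 2)^-1)%:C%C = (v k 0 * (v k 0)^*%C)^-1.
      by rewrite mul_conj_cmod fmorphV.
    rewrite rmorphM /= conjcK; field.
    by rewrite vk0 conjc_eq0 vk0.
  move: h; move: (v k 0 * _) => [a b] /= ->; ring.
move=> j w w1; rewrite uv; congr (_ * _).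
have [->//|w0] := eqVneq w 0.
by have [_ /(_ j)] := key w w1 w0; rewrite vk// => /(mulIf vk0).
Qed.

Lemma entire_factor (E : C -> C) x : (forall w, differentiable E w) ->
  exists2 q, (forall w, differentiable q w) & forall w, E w = E x + (w - x) * q w.
Proof.
move=> dE; have [q cq Eq] := diff_caratheodory (dE x).
have dq w : x != w -> differentiable q w.
  by move=> xw; exact: (caratheodory_diff_off Eq xw).
have shift (f : C -> C) (a w : C) : differentiable f (w + a) ->
    differentiable (fun v => f (v + a)) w.
  move=> df; have ds : differentiable (fun v : C => v + a) w.
    by apply: differentiableD; [exact: differentiable_idC|exact: differentiable_cst].
  exact: (differentiable_comp ds df).
exists q; last exact: Eq.
move=> w; have [->|wx] := eqVneq w x; last by apply: dq; rewrite eq_sym.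
have : differentiable (fun v => q (v + x)) 0.
  apply: (@removable R _ 1 ltr01) => [v _|v _ v0]; last first.
    by apply: shift; apply: dq; rewrite -subr_eq0 opprD addrCA subrr addr0 oppr_eq0.
  have [->|v0] := eqVneq v 0; last first.
    apply: diff_contC; apply: shift; apply: dq.
    by rewrite -subr_eq0 opprD addrCA subrr addr0 oppr_eq0.
  apply: (@continuous_comp _ _ _ (fun v => v + x) q); last by rewrite add0r.
  exact: (continuousD (@cvg_id _ _) (@cst_continuous _ _ _ _)).
rewrite -[X in differentiable _ X -> _](subrr x) => /shift.
by under [X in differentiable X x]eq_fun do rewrite subrK.
Qed.

(** Each zero lowers the growth by one degree, down to a function that tends to [0]
    at infinity. *)
Lemma liouville_zeros (s : seq C) (E : C -> C) (B : R) : uniq s ->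
  (forall w, differentiable E w) ->
  (forall w, cmod (E w) * (1 + cmod w) <= B * (1 + cmod w) ^+ size s) ->
  (forall x, x \in s -> E x = 0) -> forall w, E w = 0.
Proof.
elim: s E B => [|x s IH] E B /= us dE EB E0 w.
  apply/eqP; rewrite -cmod_eq0 eq_le cmod_ge0 andbT; apply/ler_addgt0Pr => e e0.
  rewrite add0r; pose rho := 1 + cmod w + `|B| / e.
  have w0 := cmod_ge0 w; have Be : 0 <= `|B| / e by rewrite divr_ge0 ?(ltW e0).
  have rho0 : 0 < rho by rewrite /rho; lra.
  apply: (@max_principle R E rho _ rho0); [by move=> v _; exact: dE| |by rewrite /rho; lra].
  move=> y yr; have := EB y; rewrite expr0 mulr1 yr -ler_pdivlMr; last by lra.
  move=> /le_trans; apply; rewrite ler_pdivrMr; last by lra.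
  apply: le_trans (ler_norm B) _; rewrite mulrC -ler_pdivrMr// /rho; lra.
have [q dq Eq] := entire_factor x dE.
have Ex : E x = 0 by apply: E0; rewrite mem_head.
have {}Eq y : E y = (y - x) * q y by rewrite Eq Ex add0r.
have /andP[xs us'] := us.
pose rho := 2 * cmod x + 1; have x0 := cmod_ge0 x.
have rho0 : 0 < rho by rewrite /rho; lra.
have [|y yr|c _ cmax] := @cdisc_EVT R (fun y => cmod (q y)) 0 rho; first exact: ltW.
  apply: (@continuous_comp _ _ _ q (@cmod R)); last exact: continuous_cmod.
  exact/diff_contC/dq.
suff q0 y : q y = 0 by rewrite Eq q0 mulr0.
pose B1 := cmod (q c) * (1 + rho).
apply: (IH q (4 * `|B| + B1) us' dq) => {w}y; last first.
  move=> ys; have yx : y - x != 0.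
    by rewrite subr_eq0; apply: contraNneq xs => <-.
  by apply: (mulfI yx); rewrite mulr0 -Eq E0// inE ys orbT.
have y0 := cmod_ge0 y; have q0 := cmod_ge0 (q y); have c0 := cmod_ge0 (q c).
have pow_ge1 : 1 <= (1 + cmod y) ^+ size s by rewrite exprn_ege1//; lra.
have B10 : 0 <= B1 by rewrite mulr_ge0//; lra.
rewrite mulrDl; have [yrho|yrho] := lerP (cmod y) rho.
  apply: (@le_trans _ _ (B1 * (1 + cmod y) ^+ size s)); last first.
    by rewrite lerDr mulr_ge0// ?mulr_ge0//; lra.
  apply: (@le_trans _ _ B1); last by rewrite ler_peMr.
  rewrite /B1 ler_pM//; [lra|by apply: cmax; rewrite subr0|lra].
apply: (@le_trans _ _ (4 * `|B| * (1 + cmod y) ^+ size s)); last first.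
  by rewrite lerDl mulr_ge0//; lra.
have yx : (1 + cmod y) / 4 <= cmod (y - x).
  by have := cmodD (y - x) x; rewrite subrK; rewrite /rho in yrho; lra.
have := EB y; rewrite Eq cmodM exprS.
have : (1 + cmod y) / 4 * cmod (q y) <= cmod (y - x) * cmod (q y).
  by rewrite ler_wpM2r.
set P := _ ^+ size s => h1 h2; have p0 : 0 < 1 + cmod y by lra.
have h3 : B * P <= `|B| * P by rewrite ler_wpM2r ?ler_norm//; rewrite /P; lra.
rewrite -(ler_pM2l p0) -subr_ge0.
have := ler_wpM2r (ltW p0) h1; have := ler_wpM2l (ltW p0) h3; lra.
Qed.

End Homogeneity.

(** * Harnack's inequality on the disc *)

Section SchwarzPick.
Variable R : realType.
Local Notation C := R[i].
Implicit Types (f : C -> C) (z w a b u v : C).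

Lemma moebius_sqr a b : cmod (1 - a^*%C * b) ^+ 2 - cmod (b - a) ^+ 2 =
  (1 - cmod a ^+ 2) * (1 - cmod b ^+ 2).
Proof. by case: a => a1 a2; case: b => b1 b2; rewrite !cmod_sqr /=; ring. Qed.

Lemma moebius_neq0 a b : cmod a < 1 -> cmod b < 1 -> 1 - a^*%C * b != 0.
Proof.
move=> a1 b1; rewrite subr_eq0; apply/negP => /eqP /(congr1 (@cmod R)).
rewrite cmod1 cmodM cmod_conj; have := cmod_ge0 a; have := cmod_ge0 b; nra.
Qed.

Lemma moebius_le1 a b : cmod a < 1 -> cmod b < 1 ->
  cmod ((b - a) / (1 - a^*%C * b)) < 1.
Proof.
move=> a1 b1; rewrite cmodM cmodV ltr_pdivrMr ?cmod_gt0 ?moebius_neq0// mul1r.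
rewrite -(@ltr_pXn2r _ 2)// ?nnegrE ?cmod_ge0// -subr_gt0 moebius_sqr.
have := cmod_ge0 a; have := cmod_ge0 b => ? ?.
by rewrite mulr_gt0// subr_gt0 exprn_ilt1.
Qed.

Lemma differentiable_moebius a b : 1 - a^*%C * b != 0 ->
  differentiable (fun x => (x - a) / (1 - a^*%C * x)) b.
Proof.
move=> ab; apply: differentiableM.
  by apply: differentiableB; [exact: differentiable_idC|exact: differentiable_cst].
apply: differentiableV; last exact: ab.
apply: differentiableB; first exact: differentiable_cst.
by apply: differentiableM; [exact: differentiable_cst|exact: differentiable_idC].
Qed.

Lemma schwarz_pick f z w : holD 1 f -> (forall x, cmod x < 1 -> cmod (f x) < 1) ->
  cmod z < 1 -> cmod w < 1 ->
  cmod ((f w - f z) / (1 - (f z)^*%C * f w)) <= cmod ((w - z) / (1 - z^*%C * w)).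
Proof.
move=> df f1 z1 w1.
have Nz1 : cmod (- z) < 1 by rewrite cmodN.
pose m x := (x - - z) / (1 - (- z)^*%C * x).
have m1 x : cmod x < 1 -> cmod (m x) < 1 by move=> x1; exact: moebius_le1.
have dm x : cmod x < 1 -> differentiable m x.
  by move=> x1; apply: differentiable_moebius; exact: moebius_neq0.
pose l := (w - z) / (1 - z^*%C * w).
have zw := moebius_neq0 z1 w1; have zz := moebius_neq0 z1 z1.
have ml : m l = w.
  have E : 1 - (- z)^*%C * l = (1 - z^*%C * z) / (1 - z^*%C * w).
    by rewrite rmorphN /l; field.
  rewrite /m E opprK /l; field.
  by rewrite zw zz.
pose g x := (f (m x) - f z) / (1 - (f z)^*%C * f (m x)).
have := @schwarz R g _ _ _ l; rewrite /g ml; apply.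
- move=> x x1.
  have dfm : differentiable (f \o m) x.
    by apply: differentiable_comp; [exact: dm|apply: df; exact: m1].
  have dM : differentiable (fun y => (y - f z) / (1 - (f z)^*%C * y)) ((f \o m) x).
    by apply: differentiable_moebius; apply: moebius_neq0; apply: f1 => //; exact: m1.
  exact: (differentiable_comp dfm dM).
- by rewrite /m sub0r opprK mulr0 subr0 divr1 subrr mul0r.
- by move=> x x1; apply/ltW/moebius_le1; apply: f1 => //; exact: m1.
- exact: moebius_le1.
Qed.

Definition cayley u : C := (1 + u) / (1 - u).

Lemma cayley_real (r : R) : cayley r%:C%C = ((1 + r) / (1 - r))%:C%C.
Proof. by rewrite /cayley rmorphM fmorphV rmorphD rmorphB rmorph1. Qed.

Lemma Re_cayley_gt0 u : cmod u < 1 -> 0 < complex.Re (cayley u).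
Proof.
move=> u1; have nu : 1 - u != 0.
  by rewrite subr_eq0; apply: contraTneq u1 => <-; rewrite cmod1 ltxx.
have E : cayley u = ((cmod (1 - u) ^+ 2)^-1)%:C%C * ((1 + u) * (1 - u)^*%C).
  have -> : ((cmod (1 - u) ^+ 2)^-1)%:C%C = ((1 - u) * (1 - u)^*%C)^-1.
    by rewrite mul_conj_cmod fmorphV.
  have ncu : 1 - u^*%C != 0 by rewrite -conjc_eq0 rmorphB rmorph1 /= conjcK.
  by rewrite /cayley; field; rewrite nu ncu.
have -> : complex.Re (cayley u) = (cmod (1 - u) ^+ 2)^-1 * (1 - cmod u ^+ 2).
  by rewrite E [cmod u ^+ 2]cmod_sqr; move: (_^-1); case: u {u1 nu E} => x y k /=; ring.
rewrite mulr_gt0 ?invr_gt0 ?exprn_gt0 ?cmod_gt0// subr_gt0.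
by rewrite exprn_ilt1 ?cmod_ge0.
Qed.

(** The hypothesis reads [|W' - W| <= d * |W' + W^*|] for the Cayley images. Passing to
    the real parts removes the same square of an imaginary part on both sides, which
    only helps because [d <= 1]. *)
Lemma cayley_diff_le u v (d : R) : cmod u < 1 -> cmod v < 1 -> 0 <= d <= 1 ->
  cmod ((v - u) / (1 - u^*%C * v)) <= d ->
  complex.Re (cayley v) - complex.Re (cayley u) <=
  d * (complex.Re (cayley v) + complex.Re (cayley u)).
Proof.
move=> u1 v1 d01 h.
have nz (x : C) : cmod x < 1 -> 1 - x != 0.
  by move=> x1; rewrite subr_eq0; apply: contraTneq x1 => <-; rewrite cmod1 ltxx.
have nu := nz u u1; have nv := nz v v1; have nuv := moebius_neq0 u1 v1.
have ncu : 1 - u^*%C != 0 by apply: nz; rewrite cmod_conj.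
have e1 : cayley v - cayley u = 2 * (v - u) / ((1 - v) * (1 - u)).
  by rewrite /cayley; field; rewrite nv nu.
have e2 : cayley v + (cayley u)^*%C = 2 * (1 - u^*%C * v) / ((1 - v) * (1 - u^*%C)).
  rewrite /cayley rmorphM fmorphV rmorphB rmorphD rmorph1; field.
  by rewrite nv ncu.
have e3 : cmod (1 - u^*%C) = cmod (1 - u) by rewrite -cmod_conj rmorphB rmorph1 /= conjcK.
have : cmod (cayley v - cayley u) <= d * cmod (cayley v + (cayley u)^*%C).
  have {}h : cmod (v - u) <= d * cmod (1 - u^*%C * v).
    by move: h; rewrite cmodM cmodV ler_pdivrMr ?cmod_gt0.
  have E (t y k : R) : d * (t * y / k) = t * (d * y) / k by ring.
  rewrite e1 e2 !cmodM !cmodV !cmodM e3 E ler_wpM2r ?invr_ge0 ?mulr_ge0 ?cmod_ge0//.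
  by rewrite ler_wpM2l ?cmod_ge0.
have := Re_cayley_gt0 u1; have := Re_cayley_gt0 v1.
move: (cayley u) (cayley v) => [a b] [x y] x0 a0 h1.
have /andP[d0 d1] := d01.
have := h1; rewrite -(@ler_pXn2r _ 2) ?nnegrE ?mulr_ge0 ?cmod_ge0//.
rewrite exprMn !cmod_sqr /= => H; move: x0 a0 => /= x0 a0.
rewrite leNgt; apply/negP => H1.
have dpos : 0 <= d * (x + a) by rewrite mulr_ge0//; lra.
have H2 : (d * (x + a)) ^+ 2 < (x - a) ^+ 2 by rewrite ltrXn2r//; rewrite ?nnegrE//; lra.
have d2 : d ^+ 2 <= 1 by rewrite exprn_ile1.
have H3 : d ^+ 2 * (y - b) ^+ 2 <= (y - b) ^+ 2 by rewrite ler_piMl ?sqr_ge0.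
by move: H H2; rewrite exprMn mulrDr; lra.
Qed.

(** Up to sign the Busemann function of the disc at the boundary point [1]; on the real
    diameter it is the signed Poincare distance to [0]. *)
Definition caylog u : R := ln (complex.Re (cayley u)) / 2.

Lemma caylog_real (r : R) : caylog r%:C%C = artanh r.
Proof. by rewrite /caylog cayley_real. Qed.

Lemma poincareE z w : poincare z w = artanh (cmod ((z - w) / (1 - w^*%C * z))).
Proof. by []. Qed.

(** This is [cayley_diff_le] with the pseudohyperbolic distance of [z] and [w] as [d],
    which [f] does not increase. *)
Lemma harnack f z w : holD 1 f -> (forall x, cmod x < 1 -> cmod (f x) < 1) ->
  cmod z < 1 -> cmod w < 1 -> caylog (f w) - caylog (f z) <= poincare z w.
Proof.
move=> df f1 z1 w1; rewrite poincareE.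
have sym : cmod ((z - w) / (1 - w^*%C * z)) = cmod ((w - z) / (1 - z^*%C * w)).
  have -> : 1 - w^*%C * z = (1 - z^*%C * w)^*%C.
    by rewrite rmorphB rmorph1 rmorphM /= conjcK mulrC.
  by rewrite !cmodM !cmodV cmod_conj cmodB_sym.
rewrite sym; set d := cmod _.
have d1 : d < 1 by exact: moebius_le1.
have d0 : 0 <= d by exact: cmod_ge0.
have := @cayley_diff_le (f z) (f w) d (f1 z z1) (f1 w w1).
rewrite d0 (ltW d1) => /(_ isT (schwarz_pick df f1 z1 w1)).
rewrite /caylog /artanh -mulrBl ler_pM2r ?invr_gt0//.
have := Re_cayley_gt0 (f1 z z1); have := Re_cayley_gt0 (f1 w w1).
move: (complex.Re (cayley (f w))) (complex.Re (cayley (f z))) => x y x0 y0 h.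
rewrite -ln_div ?posrE// ler_ln ?posrE ?divr_gt0//; [|lra..].
rewrite ler_pdivrMr// mulrAC ler_pdivlMr; last lra.
lra.
Qed.

End SchwarzPick.

(** * Hermitian geometry of the ball *)

Section Conj.
Variable R : realType.
Implicit Types x y : R[i].

Lemma conjcD x y : (x + y)^*%C = x^*%C + y^*%C. Proof. exact: rmorphD. Qed.
Lemma conjcB x y : (x - y)^*%C = x^*%C - y^*%C. Proof. exact: rmorphB. Qed.
Lemma conjcM x y : (x * y)^*%C = x^*%C * y^*%C. Proof. exact: rmorphM. Qed.
Lemma conjcN x : (- x)^*%C = - x^*%C. Proof. exact: rmorphN. Qed.

End Conj.

Section Ball.
Variables (R : realType) (n : nat).
Local Notation C := R[i].
Local Notation V := 'rV[C]_n.
Implicit Types (z w a p q : V) (c : C).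

Definition herm z w : C := \sum_(j < n) z 0 j * (w 0 j)^*%C.

Lemma hermDl p z w : herm (p + z) w = herm p w + herm z w.
Proof. by rewrite -big_split; apply: eq_bigr => j _; rewrite mxE mulrDl. Qed.

Lemma hermZl c z w : herm (c *: z) w = c * herm z w.
Proof. by rewrite mulr_sumr; apply: eq_bigr => j _; rewrite mxE mulrA. Qed.

Lemma herm_conj z w : (herm z w)^*%C = herm w z.
Proof.
rewrite rmorph_sum; apply: eq_bigr => j _.
by rewrite rmorphM /= conjcK mulrC.
Qed.

Lemma hermDr z p w : herm z (p + w) = herm z p + herm z w.
Proof. by rewrite -!(herm_conj _ z) -rmorphD -hermDl. Qed.

Lemma hermZr c z w : herm z (c *: w) = c^*%C * herm z w.
Proof. by rewrite -!(herm_conj _ z) -rmorphM -hermZl. Qed.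

Lemma hermNl z w : herm (- z) w = - herm z w.
Proof. by rewrite -scaleN1r hermZl mulN1r. Qed.

Lemma hermNr z w : herm z (- w) = - herm z w.
Proof. by rewrite -!(herm_conj _ z) hermNl conjcN. Qed.

Lemma herm0l w : herm 0 w = 0.
Proof. by rewrite -(scale0r 0) hermZl mul0r. Qed.

Lemma herm0r w : herm w 0 = 0.
Proof. by rewrite -herm_conj herm0l conjc0. Qed.

Definition nrm z : R := Num.sqrt (\sum_(j < n) cmod (z 0 j) ^+ 2).

Lemma nrm_ge0 z : 0 <= nrm z. Proof. exact: sqrtr_ge0. Qed.

Lemma nrm_sqr z : nrm z ^+ 2 = \sum_(j < n) cmod (z 0 j) ^+ 2.
Proof. by rewrite sqr_sqrtr// sumr_ge0// => j _; rewrite sqr_ge0. Qed.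

Lemma herm_nrm z : herm z z = (nrm z ^+ 2)%:C%C.
Proof.
rewrite nrm_sqr rmorph_sum; apply: eq_bigr => j _.
by rewrite mul_conj_cmod.
Qed.

Lemma unit_ballE z : unit_ball R n z <-> nrm z < 1.
Proof.
have -> : unit_ball R n z <-> nrm z ^+ 2 < 1.
  rewrite /unit_ball /= nrm_sqr.
  have -> : \sum_(j < n) `|z 0 j| ^+ 2 = (\sum_(j < n) cmod (z 0 j) ^+ 2)%:C%C.
    by rewrite rmorph_sum; apply: eq_bigr => j _; rewrite normE rmorphXn.
  by rewrite (ltcR _ 1).
by rewrite expr_lt1// nrm_ge0.
Qed.

Lemma nrm0 : nrm 0 = 0.
Proof.
by rewrite /nrm big1 ?sqrtr0// => j _; rewrite mxE cmod0 expr0n.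
Qed.

Lemma nrm_eq0 z : nrm z = 0 -> z = 0.
Proof.
move=> z0; have := nrm_sqr z; rewrite z0 expr0n /= => /esym /eqP.
rewrite psumr_eq0; last by move=> j _; rewrite sqr_ge0.
move=> /allP h; apply/rowP => j; rewrite mxE; apply/eqP.
by rewrite -cmod_eq0 -sqrf_eq0; apply: h; rewrite mem_index_enum.
Qed.

Lemma nrmZ c z : nrm (c *: z) = cmod c * nrm z.
Proof.
rewrite /nrm; under eq_bigr do rewrite mxE cmodM exprMn.
by rewrite -mulr_sumr sqrtrM ?sqr_ge0// sqrtr_sqr ger0_norm ?cmod_ge0.
Qed.

Lemma coord_le_nrm z j : cmod (z 0 j) <= nrm z.
Proof.
rewrite -(@ler_pXn2r _ 2) ?nnegrE ?nrm_ge0 ?cmod_ge0// nrm_sqr (bigD1 j)//= lerDl.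
by rewrite sumr_ge0// => k _; rewrite sqr_ge0.
Qed.

Lemma cauchy_schwarz z w : cmod (herm z w) <= nrm z * nrm w.
Proof.
have [/nrm_eq0->|w0] := eqVneq (nrm w) 0.
  by rewrite herm0r cmod0 nrm0 mulr0.
have w0' : 0 < nrm w by rewrite lt0r w0 nrm_ge0.
pose v := (nrm w ^+ 2)%:C%C *: z - herm z w *: w.
have : 0 <= nrm v ^+ 2 by exact: sqr_ge0.
have -> : nrm v ^+ 2 = nrm w ^+ 2 * (nrm w ^+ 2 * nrm z ^+ 2 - cmod (herm z w) ^+ 2).
  apply: (@complexI R); rewrite [RHS]rmorphM [in RHS]rmorphB [in RHS]rmorphM /=.
  rewrite -herm_nrm /v -mul_conj_cmod !hermDl !hermNl !hermZl !hermDr !hermNr !hermZr.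
  by rewrite !herm_nrm -(herm_conj z w) conjc_real; ring.
rewrite pmulr_rge0 ?exprn_gt0// subr_ge0 -exprMn mulrC.
by rewrite ler_pXn2r// ?nnegrE ?mulr_ge0 ?nrm_ge0 ?cmod_ge0.
Qed.

(** The equality case of the Cauchy-Schwarz inequality with negative sign. *)
Lemma opposite_rays p q : herm p q = - (nrm p * nrm q)%:C%C ->
  (nrm p)%:C%C *: q = - ((nrm q)%:C%C *: p).
Proof.
move=> h; apply/eqP; rewrite -subr_eq0 opprK; apply/eqP/nrm_eq0/eqP.
rewrite -sqrf_eq0; apply/eqP/(@complexI R); rewrite -herm_nrm.
rewrite !hermDl !hermZl !hermDr !hermZr !herm_nrm -(herm_conj p q) h.
have -> : (- (nrm p * nrm q)%:C%C)^*%C = - (nrm p * nrm q)%:C%C :> C.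
  by rewrite -rmorphN conjc_real.
by rewrite !conjc_real !rmorphXn !rmorphM /=; ring.
Qed.

Lemma herm_lt1 z w : nrm z <= 1 -> nrm w < 1 -> cmod (herm z w) < 1.
Proof.
move=> z1 w1; apply: le_lt_trans (cauchy_schwarz z w) _.
by have := nrm_ge0 z; have := nrm_ge0 w; nra.
Qed.

Lemma sub1_herm_neq0 z w : nrm z <= 1 -> nrm w < 1 -> 1 - herm z w != 0.
Proof.
move=> z1 w1; rewrite subr_eq0; apply: contraTneq (herm_lt1 z1 w1) => <-.
by rewrite cmod1 ltxx.
Qed.

Definition ball_s a : R := Num.sqrt (1 - nrm a ^+ 2).

(** The involutive automorphism of the ball that exchanges [0] and [a]. The projection
    to the line of [a], usually written with [1 / |a| ^+ 2], appears through
    [(1 - s) / |a| ^+ 2 = 1 / (1 + s)], so that [a = 0] needs no special treatment. *)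
Definition ball_swap a z : V := (1 - herm z a)^-1 *:
  ((1 - herm z a / (1 + (ball_s a)%:C%C)) *: a - (ball_s a)%:C%C *: z).

Section BallSwap.
Variable a : V.
Hypothesis a1 : nrm a < 1.
Let s := ball_s a.

Lemma ball_s_gt0 : 0 < s.
Proof.
rewrite /s /ball_s sqrtr_gt0 subr_gt0 exprn_ilt1// nrm_ge0//.
Qed.

Lemma herm_ball_s : herm a a = 1 - s%:C%C ^+ 2.
Proof.
have E : s ^+ 2 = 1 - nrm a ^+ 2.
  rewrite /s /ball_s sqr_sqrtr//.
  by rewrite subr_ge0 exprn_ile1 ?nrm_ge0 ?ltW.
rewrite herm_nrm -rmorphXn E rmorphB rmorph1 /=; ring.
Qed.

Let sC0 : s%:C%C != 0 :> C.
Proof. by rewrite -cmod_gt0 cmod_real normr_gt0 lt0r_neq0// ball_s_gt0. Qed.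

Let sC1 : 1 + s%:C%C != 0 :> C.
Proof.
rewrite -[1](rmorph1 (real_complex R)) -rmorphD -cmod_gt0 cmod_real normr_gt0.
by rewrite lt0r_neq0//; have := ball_s_gt0; lra.
Qed.

Lemma ball_swap_herm z w : nrm z <= 1 -> nrm w <= 1 ->
  1 - herm (ball_swap a z) (ball_swap a w) =
  s%:C%C ^+ 2 * (1 - herm z w) / ((1 - herm z a) * (1 - herm a w)).
Proof.
move=> z1 w1; have hz := sub1_herm_neq0 z1 a1; have hw := sub1_herm_neq0 w1 a1.
have hw' : 1 - herm a w != 0 by rewrite -conjc_eq0 rmorphB rmorph1 /= herm_conj.
have swc : (1 - herm w a / (1 + s%:C%C))^*%C = 1 - herm a w / (1 + s%:C%C).
  by rewrite conjcB conjcM conjc_inv conjcD conjc1 conjc_real herm_conj.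
rewrite /ball_swap -/s hermZl hermZr conjc_inv conjcB conjc1 herm_conj.
rewrite hermDl hermNl !hermZl !hermDr !hermNr !hermZr conjc_real swc.
rewrite herm_ball_s; field.
by rewrite hz hw' sC1.
Qed.

Lemma ball_swap_nrm z : nrm z <= 1 ->
  (1 - nrm (ball_swap a z) ^+ 2) * cmod (1 - herm z a) ^+ 2 = (1 - nrm a ^+ 2) * (1 - nrm z ^+ 2).
Proof.
move=> z1; have hz := sub1_herm_neq0 z1 a1.
have hz' : 1 - herm a z != 0 by rewrite -conjc_eq0 rmorphB rmorph1 /= herm_conj.
apply: (@complexI R); rewrite [LHS]rmorphM [RHS]rmorphM /= !rmorphB rmorph1 /=.
rewrite -mul_conj_cmod -!herm_nrm ball_swap_herm// conjcB conjc1 herm_conj herm_ball_s; field.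
by rewrite hz hz'.
Qed.

Lemma ball_swap_ball z : nrm z < 1 -> nrm (ball_swap a z) < 1.
Proof.
move=> z1; have := ball_swap_nrm (ltW z1).
have : 0 < (1 - nrm a ^+ 2) * (1 - nrm z ^+ 2).
  by rewrite mulr_gt0// subr_gt0 exprn_ilt1// nrm_ge0.
move=> + h; rewrite -h pmulr_lgt0 ?subr_gt0; last first.
  by rewrite exprn_gt0// cmod_gt0 sub1_herm_neq0// ltW.
by rewrite expr_lt1// nrm_ge0.
Qed.

Lemma ball_swap_sphere z : nrm z = 1 -> nrm (ball_swap a z) = 1.
Proof.
move=> z1; have z1' : nrm z <= 1 by rewrite z1.
have := ball_swap_nrm z1'; rewrite z1 expr1n subrr mulr0.
move=> /eqP; rewrite mulf_eq0 sqrf_eq0 cmod_eq0.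
rewrite (negPf (sub1_herm_neq0 z1' a1)) orbF subr_eq0 => /eqP/esym/eqP.
by rewrite sqrf_eq1 => /orP[/eqP//|/eqP h]; have := nrm_ge0 (ball_swap a z); rewrite h; lra.
Qed.

Lemma ball_swap0 : ball_swap a 0 = a.
Proof. by rewrite /ball_swap herm0l mul0r subr0 invr1 !scale1r scaler0 subr0. Qed.

Lemma ball_swapK z : nrm z <= 1 -> ball_swap a (ball_swap a z) = z.
Proof.
move=> z1; have hz := sub1_herm_neq0 z1 a1.
have hw : herm (ball_swap a z) a = (1 - s%:C%C ^+ 2 - herm z a) / (1 - herm z a).
  rewrite /ball_swap -/s hermZl hermDl hermNl !hermZl herm_ball_s; field.
  by rewrite hz sC1.
rewrite [in LHS]/ball_swap hw -/s; apply/rowP => j; rewrite /ball_swap -/s !mxE; field.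
rewrite sC1 hz /=.
have -> : 1 - herm z a - (1 - s%:C%C ^+ 2 - herm z a) = s%:C%C ^+ 2 by ring.
by rewrite expf_neq0.
Qed.

End BallSwap.
End Ball.

(** * Topology of the ball *)

Section BallTopology.
Variables (R : realType) (n : nat).
Local Notation C := R[i].
Local Notation V := 'rV[C]_n.
Implicit Types (z w a p q : V) (c : C).

Lemma differentiable_row (U : normedModType C) (f : U -> V) x :
  (forall j, differentiable (fun y => f y 0 j) x) -> differentiable f x.
Proof.
move=> df; have -> : f = \sum_(j < n) (fun y => f y 0 j *: delta_mx 0 j : V).
  by apply/funext => y; rewrite fct_sumE [LHS]row_sum_delta.
by apply: differentiable_sum => j; apply: differentiableZl; exact: df.
Qed.

Lemma differentiable_sumC (U : normedModType C) (f : 'I_n -> U -> C) x :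
  (forall j, differentiable (f j) x) -> differentiable (fun y => \sum_(j < n) f j y) x.
Proof.
move=> df; have -> : (fun y => \sum_(j < n) f j y) = \sum_(j < n) f j.
  by apply/funext => y; rewrite fct_sumE.
exact: differentiable_sum.
Qed.

Lemma differentiable_entry (U : normedModType C) (f : U -> V) x j :
  differentiable f x -> differentiable (fun y => f y 0 j) x.
Proof.
move=> df; apply: (@differentiable_comp _ _ _ _ f (fun v : V => v 0 j) x df).
exact: differentiable_coord.
Qed.

Lemma differentiable_herm (U : normedModType C) (f : U -> V) x a :
  differentiable f x -> differentiable (fun y => herm (f y) a) x.
Proof.
move=> df; apply: differentiable_sumC => j; apply: differentiableM.
  exact: differentiable_entry.
exact: differentiable_cst.
Qed.

Lemma differentiable_line (v : V) (c : C) : differentiable (fun l : C => l *: v) c.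
Proof.
by apply: differentiableZl; exact: differentiable_idC.
Qed.

Lemma differentiable_ball_swap a z : 1 - herm z a != 0 -> differentiable (ball_swap a) z.
Proof.
move=> h; have dh : differentiable (fun y => herm y a) z.
  by apply: differentiable_herm; exact: differentiable_idC.
apply: differentiable_row => j.
have -> : (fun y => ball_swap a y 0 j) = (fun y => (1 - herm y a)^-1 *
    ((1 - herm y a * (1 + (ball_s a)%:C%C)^-1) * a 0 j - (ball_s a)%:C%C * y 0 j)).
  by apply/funext => y; rewrite /ball_swap !mxE.
apply: differentiableM.
  apply: differentiableV; last exact: h.
  by apply: differentiableB; [exact: differentiable_cst|exact: dh].
apply: differentiableB; apply: differentiableM; try exact: differentiable_cst.
  apply: differentiableB; first exact: differentiable_cst.
  by apply: differentiableM; [exact: dh|exact: differentiable_cst].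
exact: differentiable_coord.
Qed.

Lemma continuous_nrm : continuous (@nrm R n).
Proof.
move=> z; pose f (y : V) : R := \sum_(j < n) cmod (y 0 j : C) ^+ 2.
have cf : {for z, continuous f}.
  have -> : f = \sum_(j < n) (fun y : V => cmod (y 0 j) ^+ 2).
    by apply/funext => y; rewrite fct_sumE.
  apply: (@big_ind _ (fun g : V -> R => {for z, continuous g})).
  - exact: cst_continuous.
  - by move=> g h cg ch; exact: (continuousD cg ch).
  move=> j _; have c1 : {for z, continuous (fun y : V => cmod (y 0 j))}.
    apply: (@continuous_comp _ _ _ (fun y : V => y 0 j) (@cmod R)); last exact: continuous_cmod.
    exact/differentiable_continuous/differentiable_coord.
  exact: (continuousM c1 c1).
exact: (continuous_comp cf (@sqrt_continuous _ _)).
Qed.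

Lemma open_unit_ball : open (unit_ball R n).
Proof.
have -> : unit_ball R n = @nrm R n @^-1` [set x | x < 1].
  by apply/seteqP; split => z /=; [move/unit_ballE|move=> h; apply/unit_ballE].
by apply: open_comp; [move=> z _; exact: continuous_nrm|exact: open_lt].
Qed.

Lemma boundary_sphere p : nrm p = 1 -> boundary (unit_ball R n) p.
Proof.
move=> p1; split; last first.
  by move=> /interior_subset /unit_ballE; rewrite p1 ltxx.
pose g (x : R) : V := x%:C%C *: p.
have cg : {for 1, continuous g}.
  apply: (@continuous_comp _ _ _ (fun x : R => x%:C%C : C) (fun c => c *: p)).
    exact: continuous_real_complex.
  exact/differentiable_continuous/differentiable_line.
move=> U; have -> : p = g 1 by rewrite /g rmorph1 scale1r.
move=> /cg /= /nbhs_ballP[e /= e0 he].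
pose x := 1 - Num.min (e / 2) (1 / 2).
have m0 : 0 < Num.min (e / 2) (1 / 2) by rewrite lt_min !divr_gt0.
have m1 : Num.min (e / 2) (1 / 2) <= 1 / 2 by rewrite ge_min lexx orbT.
have me : Num.min (e / 2) (1 / 2) <= e / 2 by rewrite ge_min lexx.
exists (g x); split; last first.
  apply: he; rewrite -ball_normE /= /x opprB addrC subrK gtr0_norm//; lra.
by apply/unit_ballE; rewrite /g nrmZ p1 mulr1 cmod_real ger0_norm /x; lra.
Qed.

Lemma boundary_not_ball p b : boundary (unit_ball R n) p -> unit_ball R n b -> p <> b.
Proof.
by move=> [_ pB] bB pb; apply: pB; rewrite pb; apply: open_unit_ball.
Qed.

End BallTopology.

(** * Hyperbolic tangent, the arc length parameter of a diameter *)

Section Tanh.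
Variable R : realType.
Implicit Types s t x : R.

Definition tanh t : R := (expR (2 * t) - 1) / (expR (2 * t) + 1).

Lemma tanh_lt1 t : -1 < tanh t < 1.
Proof.
have e0 := expR_gt0 (2 * t); rewrite /tanh ltr_pdivlMr ?ltr_pdivrMr; lra.
Qed.

Lemma artanh_tanh t : artanh (tanh t) = t.
Proof.
have e0 := expR_gt0 (2 * t).
have -> : artanh (tanh t) = ln (expR (2 * t)) / 2.
  rewrite /artanh; congr (ln _ / 2); rewrite /tanh; field.
  by rewrite !lt0r_neq0//; lra.
by rewrite expRK mulrAC divff ?mul1r.
Qed.

Lemma tanhK x : -1 < x < 1 -> tanh (artanh x) = x.
Proof.
move=> x1; rewrite /tanh /artanh mulrCA divff// mulr1 lnK ?posrE ?divr_gt0//; [|lra..].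
by field; rewrite !lt0r_neq0//; lra.
Qed.

Lemma tanh0 : tanh 0 = 0.
Proof. by rewrite /tanh mulr0 expR0 subrr mul0r. Qed.

Lemma tanh_ge0 t : 0 <= t -> 0 <= tanh t.
Proof.
move=> t0; have := expR_ge1Dx (2 * t); rewrite /tanh => h.
by rewrite divr_ge0//; lra.
Qed.

Lemma tanhN t : tanh (- t) = - tanh t.
Proof.
rewrite /tanh mulrN expRN; have e0 := expR_gt0 (2 * t); field.
by rewrite !lt0r_neq0//; lra.
Qed.

Lemma artanh_ge0 x : 0 <= x < 1 -> 0 <= artanh x.
Proof.
move=> x01; rewrite /artanh divr_ge0// ln_ge0// ler_pdivlMr; lra.
Qed.

Lemma artanh_le x y : 0 <= x < 1 -> 0 <= y < 1 -> artanh x <= artanh y -> x <= y.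
Proof.
move=> x01 y01; rewrite /artanh ler_pM2r ?invr_gt0//.
rewrite ler_ln ?posrE ?divr_gt0//; [|lra..].
by rewrite ler_pdivrMr; [rewrite mulrAC ler_pdivlMr; lra|lra].
Qed.

Lemma continuous_tanh : continuous tanh.
Proof.
move=> t; have cE : {for t, continuous (fun t => expR (2 * t) : R)}.
  apply: (@continuous_comp _ _ _ (fun t => 2 * t) (@expR R)); last exact: continuous_expR.
  exact: (continuousM (@cst_continuous _ _ _ _) (@cvg_id _ _)).
have c1 : {for t, continuous (fun t => expR (2 * t) - 1 : R)}.
  exact: (continuousB cE (@cst_continuous _ _ _ _)).
have c2 : {for t, continuous (fun t => (expR (2 * t) + 1 : R)^-1)}.
  apply: continuousV; last exact: (continuousD cE (@cst_continuous _ _ _ _)).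
  by rewrite lt0r_neq0// ltr_wpDr// expR_gt0.
exact: (continuousM c1 c2).
Qed.

Lemma poincare_tanh s t : s <= t -> poincare (tanh s)%:C%C (tanh t)%:C%C = t - s.
Proof.
move=> st; rewrite poincareE conjc_real -rmorphB -rmorphM.
rewrite -[1](rmorph1 (real_complex R)) -rmorphB -fmorphV -rmorphM cmod_real.
have -> : (tanh s - tanh t) / (1 - tanh t * tanh s) = - tanh (t - s).
  rewrite -[RHS]tanhN opprB /tanh mulrBr expRD expRN.
  have x0 := expR_gt0 (2 * s); have y0 := expR_gt0 (2 * t).
  move: (expR (2 * s)) (expR (2 * t)) x0 y0 => x y x0 y0.
  have a : x + 1 != 0 by rewrite lt0r_neq0//; lra.
  have b : y + 1 != 0 by rewrite lt0r_neq0//; lra.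
  have c : x + y != 0 by rewrite lt0r_neq0//; lra.
  have d : (y + 1) * (x + 1) - (y - 1) * (x - 1) != 0.
    by rewrite lt0r_neq0//; nra.
  field.
  by rewrite !lt0r_neq0 //=; nra.
by rewrite normrN ger0_norm ?tanh_ge0 ?subr_ge0// artanh_tanh.
Qed.

End Tanh.

(** * Kobayashi distance and curve length *)

Section Kobayashi.
Variables (R : realType) (n : nat).
Local Notation C := R[i].
Local Notation V := 'rV[C]_n.
Local Notation B := (unit_ball R n).
Implicit Types (p q : V) (Om : set V).

Lemma chain_sum_nil (T : Type) (d : T -> T -> \bar R) x : chain_sum d x [::] = 0%E.
Proof. by rewrite /chain_sum big_nil. Qed.

Lemma chain_sum_cons (T : Type) (d : T -> T -> \bar R) x y s :
  chain_sum d x (y :: s) = (d x y + chain_sum d y s)%E.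
Proof. by rewrite /chain_sum /= big_cons. Qed.

Lemma disc_holD (F : V -> C) Om (phi : C -> V) :
  holomorphic_map (@unit_disc R) Om phi ->
  (forall x, Om x -> differentiable F x) -> holD 1 (F \o phi).
Proof.
move=> [pO dp] dF w w1; have wD : unit_disc w by apply/unit_discE.
by apply: differentiable_comp; [exact: dp|apply: dF; exact: pO].
Qed.

(** A holomorphic function to the disc bounds the Kobayashi distance below; the
    additivity of increments along chains replaces the triangle inequality. *)
Lemma kobayashi_ge Om (F : V -> C) p q :
  (forall x, Om x -> differentiable F x) -> (forall x, Om x -> cmod (F x) < 1) ->
  ((caylog (F q) - caylog (F p))%:E <= kobayashi Om p q)%E.
Proof.
move=> dF F1.
have lemp x y : ((caylog (F y) - caylog (F x))%:E <= lempert Om x y)%E.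
  apply: le_ereal_inf_tmp => _ [phi [z [w [hphi [zD wD] <- <- ->]]]].
  rewrite lee_fin; apply: (@harnack R (F \o phi) z w).
  - exact: (disc_holD hphi).
  - by move=> v v1 /=; apply: F1; case: hphi => + _; apply; apply/unit_discE.
  - exact/unit_discE.
  - exact/unit_discE.
apply: le_ereal_inf_tmp => _ [s /= <- <-].
elim: s p => [|y s IH] p /=; first by rewrite chain_sum_nil subrr.
rewrite chain_sum_cons; apply: le_trans (leeD (lemp p y) (IH y)).
by rewrite -EFinD lee_fin; lra.
Qed.

Lemma kobayashi_le Om (phi : C -> V) z w :
  holomorphic_map (@unit_disc R) Om phi -> cmod z < 1 -> cmod w < 1 ->
  (kobayashi Om (phi z) (phi w) <= (poincare z w)%:E)%E.
Proof.
move=> hphi z1 w1; apply: ge_ereal_inf; exists (chain_sum (lempert Om) (phi z) [:: phi w]).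
  by exists [:: phi w].
rewrite chain_sum_cons chain_sum_nil adde0; apply: ge_ereal_inf.
exists (poincare z w)%:E; last exact: lexx.
by exists phi, z, w; split => //; split; exact/unit_discE.
Qed.

Lemma curve_length_le (T : Type) (d : T -> T -> \bar R) (g : R -> T) s t :
  (forall x y, x <= y -> (d (g x) (g y) <= (y - x)%:E)%E) ->
  (curve_length d g s t <= (t - s)%:E)%E.
Proof.
move=> gd; apply: ge_ereal_sup => _ [l lp <-].
elim: l s lp => [|x l IH] s lp /=.
  by rewrite chain_sum_nil lee_fin (itv_partition_nil lp) subrr.
rewrite chain_sum_cons; have sx : s <= x by case: lp => /= /andP[/ltW].
apply: le_trans (leeD (gd s x sx) (IH x (itv_partition_cons lp))) _.
by rewrite -EFinD lee_fin; lra.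
Qed.

Lemma curve_length_chain (T : Type) (d : T -> T -> \bar R) (g : R -> T) s t l :
  itv_partition s t l -> (chain_sum d (g s) (map g l) <= curve_length d g s t)%E.
Proof. by move=> lp; apply: ereal_sup_ubound; exists l. Qed.

Lemma curve_length_ge (T : Type) (d : T -> T -> \bar R) (H : T -> R) (g : R -> T) s t :
  s <= t -> (forall x y, ((H y - H x)%:E <= d x y)%E) ->
  ((H (g t) - H (g s))%:E <= curve_length d g s t)%E.
Proof.
move=> + Hd; rewrite le_eqVlt => /predU1P[->|st].
  have lp : itv_partition t t [::] by split.
  by apply: le_trans (curve_length_chain d g lp); rewrite chain_sum_nil subrr.
have := curve_length_chain d g (itv_partition1 st); apply: le_trans.
by rewrite /= chain_sum_cons chain_sum_nil adde0.
Qed.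

Lemma curve_length_ge2 (T : Type) (d : T -> T -> \bar R) (H K : T -> R) (g : R -> T) s u t :
  s < u -> u < t ->
  (forall x y, ((H y - H x)%:E <= d x y)%E) ->
  (forall x y, ((K y - K x)%:E <= d x y)%E) ->
  ((H (g u) - H (g s) + (K (g t) - K (g u)))%:E <= curve_length d g s t)%E.
Proof.
move=> su ut Hd Kd; have lp : itv_partition s t [:: u; t].
  by split => //=; rewrite su ut.
apply: le_trans (curve_length_chain d g lp).
by rewrite /= !chain_sum_cons chain_sum_nil adde0 EFinD leeD.
Qed.

Lemma tanh_disc (t : R) : cmod (tanh t)%:C%C < 1.
Proof. by rewrite cmod_real ltr_norml tanh_lt1. Qed.

Lemma continuous_disc_line Om (psi : C -> V) :
  holomorphic_map (@unit_disc R) Om psi ->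
  continuous (fun t : R => psi (tanh t)%:C%C).
Proof.
move=> [_ dpsi] t.
have c1 : {for t, continuous (fun t : R => (tanh t)%:C%C : C)}.
  apply: (@continuous_comp _ _ _ (@tanh R) (fun x : R => x%:C%C : C)).
    exact: continuous_tanh.
  exact: continuous_real_complex.
apply: (@continuous_comp _ _ _ (fun t : R => (tanh t)%:C%C : C) psi t c1).
by apply/differentiable_continuous/dpsi/unit_discE; exact: tanh_disc.
Qed.

Lemma disc_line_in Om (psi : C -> V) (I : interval R) :
  holomorphic_map (@unit_disc R) Om psi -> curve_in Om I (fun t : R => psi (tanh t)%:C%C).
Proof.
move=> hpsi; split; first exact/continuous_subspaceT/(continuous_disc_line hpsi).
by move=> t _; case: hpsi => + _; apply; apply/unit_discE; exact: tanh_disc.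
Qed.

Lemma disc_line_length Om (psi : C -> V) s t :
  holomorphic_map (@unit_disc R) Om psi ->
  (curve_length (kobayashi Om) (fun x : R => psi (tanh x)%:C%C) s t <= (t - s)%:E)%E.
Proof.
move=> hpsi; apply: curve_length_le => x y xy; rewrite -(poincare_tanh xy).
by apply: kobayashi_le => //; exact: tanh_disc.
Qed.

(** The disc [psi] bounds the length of its real diameter above, and its left inverse
    [F] bounds the length of every competitor below by the same number. *)
Lemma disc_line_geodesic Om (psi : C -> V) (F : V -> C) :
  holomorphic_map (@unit_disc R) Om psi ->
  (forall x, Om x -> differentiable F x) -> (forall x, Om x -> cmod (F x) < 1) ->
  (forall l : C, cmod l < 1 -> F (psi l) = l) ->
  geodesic Om `]-oo, +oo[ (fun t : R => psi (tanh t)%:C%C).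
Proof.
move=> hpsi dF F1 Fpsi; split; first exact: disc_line_in.
move=> s t _ _ st u v sigma uv _ su sv.
apply: le_trans (disc_line_length s t hpsi) _.
have := curve_length_ge sigma uv (fun x y => @kobayashi_ge Om F x y dF F1).
apply: le_trans.
by rewrite su sv !Fpsi ?tanh_disc// !caylog_real !artanh_tanh.
Qed.

End Kobayashi.

(** * Geodesics of the ball through a centre *)

Section BallGeodesics.
Variables (R : realType) (n : nat).
Local Notation C := R[i].
Local Notation V := 'rV[C]_n.
Local Notation B := (unit_ball R n).
Local Notation line := `]-oo, +oo[.
Implicit Types (p q z w a b eta zeta : V) (M N : V -> V).

(** A common setting for the given automorphisms and the involutions [ball_swap a]. *)
Definition ball_iso M N := [/\ holomorphic_map B B M, holomorphic_map B B N,
  forall x, B x -> N (M x) = x & forall x, B x -> M (N x) = x].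

Lemma ball0 : B 0. Proof. by apply/unit_ballE; rewrite nrm0. Qed.

Lemma automorphism_iso M : automorphism B M -> ball_iso M (pinv B M).
Proof.
move=> [bM dM dN]; have [fM iM sM] := bM; 
have [fN _ _] : set_bij B B (pinv B M) by exact: bijpinv_bij.
split => // x Bx; first by apply: pinvKV => //; rewrite inE.
by apply: (surjpK _ sM); rewrite inE.
Qed.

Lemma ball_swap_iso a : B a -> ball_iso (ball_swap a) (ball_swap a).
Proof.
move=> /unit_ballE a1.
have fB : holomorphic_map B B (ball_swap a).
  split=> z /unit_ballE z1; first exact/unit_ballE/ball_swap_ball.
  by apply: differentiable_ball_swap; apply: sub1_herm_neq0 => //; exact: ltW.
by split => // x /unit_ballE x1; rewrite ball_swapK// ltW.
Qed.

Definition udir p : V := (nrm p)^-1%:C%C *: p.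

Lemma nrm_udir p : nrm (udir p) <= 1.
Proof.
rewrite nrmZ cmod_real ger0_norm ?invr_ge0 ?nrm_ge0//.
by have [->|p0] := eqVneq (nrm p) 0; rewrite ?mulr0 ?mulVf.
Qed.

Lemma udirK p : (nrm p)%:C%C *: udir p = p.
Proof.
have [h|p0] := eqVneq (nrm p) 0; first by rewrite h (nrm_eq0 h) /udir !scaler0.
by rewrite scalerA -rmorphM mulfV// rmorph1 scale1r.
Qed.

Lemma herm_udir p : herm p (udir p) = (nrm p)%:C%C.
Proof.
rewrite hermZr herm_nrm conjc_real -rmorphM.
have [->|p0] := eqVneq (nrm p) 0; first by rewrite expr0n mulr0.
by rewrite expr2 mulKf.
Qed.

Lemma disc_map M v : holomorphic_map B B M -> nrm v <= 1 ->
  holomorphic_map (@unit_disc R) B (fun l : C => M (l *: v)).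
Proof.
move=> [fM dM] v1.
have lB l : unit_disc l -> B (l *: v).
  move=> /unit_discE l1; apply/unit_ballE; rewrite nrmZ.
  by have := nrm_ge0 v; have := cmod_ge0 l; nra.
split=> [l /lB/fM//|l lD].
by apply: differentiable_comp; [exact: differentiable_line|apply/dM/lB].
Qed.

Lemma holomorphic_map_comp M N : holomorphic_map B B M -> holomorphic_map B B N ->
  holomorphic_map B B (M \o N).
Proof.
move=> [fM dM] [fN dN]; split=> [x /fN/fM//|x xB].
by apply: differentiable_comp; [exact: dN|apply/dM/fN].
Qed.

Section CentredForm.
Variables (M N : V -> V) (v : V).
Hypotheses (MN : ball_iso M N) (v1 : nrm v <= 1).

(** For [v] in the direction of [N x] this maps the ball to the disc and [x] to the
    norm of [N x], so that [kobayashi_ge] gives the distance from [x] to the centre. *)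
Definition centred_form x : C := herm (N x) v.

Lemma centred_form_diff x : B x -> differentiable centred_form x.
Proof.
by case: MN => _ [_ dN] _ _ xB; apply: differentiable_herm; exact: dN.
Qed.

Lemma centred_form_lt1 x : B x -> cmod (centred_form x) < 1.
Proof.
case: MN => _ [fN _] _ _ xB; rewrite /centred_form -herm_conj cmod_conj.
by apply: herm_lt1 => //; apply/unit_ballE; exact: fN.
Qed.

Lemma centred_form_kobayashi x y :
  ((caylog (centred_form y) - caylog (centred_form x))%:E <= kobayashi B x y)%E.
Proof. by apply: kobayashi_ge; [exact: centred_form_diff|exact: centred_form_lt1]. Qed.

End CentredForm.

Lemma caylog0 : caylog (0 : C) = 0.
Proof. by have := caylog_real (tanh (0 : R)); rewrite artanh_tanh tanh0 rmorph0. Qed.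

Lemma iso0 M N : ball_iso M N -> N (M 0) = 0.
Proof. by move=> [_ _ h _]; apply: h; exact: ball0. Qed.

Lemma centred_form0 M N v : ball_iso M N -> centred_form N v (M 0) = 0.
Proof. by move=> MN; rewrite /centred_form (iso0 MN) herm0l. Qed.

Lemma iso_ball M N p : ball_iso M N -> B p -> nrm (N p) < 1.
Proof. by move=> [_ [fN _] _ _] /fN /unit_ballE. Qed.

(** Either norm is the hyperbolic tangent of the Kobayashi distance from [p] to the
    common centre. *)
Lemma nrm_center_le M N M' N' p : ball_iso M N -> ball_iso M' N' -> M 0 = M' 0 ->
  B p -> nrm (N p) <= nrm (N' p).
Proof.
move=> MN MN' M00 Bp.
have r1 := iso_ball MN Bp; have r1' := iso_ball MN' Bp.
apply: artanh_le; rewrite ?nrm_ge0//.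
have [hM' _ _ M'N'] := MN'.
have := centred_form_kobayashi MN (nrm_udir (N p)) (M 0) p.
rewrite (centred_form0 _ MN) caylog0 subr0 {1}/centred_form herm_udir caylog_real.
have E : p = (fun l : C => M' (l *: udir (N' p))) (tanh (artanh (nrm (N' p))))%:C%C.
  rewrite /= tanhK ?udirK ?M'N'//; have := nrm_ge0 (N' p); lra.
have E0 : M 0 = (fun l : C => M' (l *: udir (N' p))) (tanh 0)%:C%C.
  by rewrite /= tanh0 rmorph0 scale0r.
have a0 : 0 <= artanh (nrm (N' p)) by rewrite artanh_ge0// nrm_ge0.
have := kobayashi_le (disc_map hM' (nrm_udir (N' p))) (tanh_disc 0) (tanh_disc (artanh (nrm (N' p)))).
rewrite poincare_tanh// subr0 -E -E0 => h1 h2.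
by have := le_trans h2 h1; rewrite lee_fin.
Qed.

(** Equality in [|1 - h| <= 1 + |h|]. *)
Lemma opposite_scalar (h : C) (x : R) : 0 <= x -> cmod h <= x ->
  1 + x <= cmod (1 - h) -> h = - x%:C%C.
Proof.
move=> x0 hx h1.
have {}h1 : (1 + x) ^+ 2 <= cmod (1 - h) ^+ 2.
  by rewrite ler_pXn2r ?nnegrE ?cmod_ge0//; lra.
have {}hx : cmod h ^+ 2 <= x ^+ 2 by rewrite ler_pXn2r ?nnegrE ?cmod_ge0.
move: h1 hx; rewrite !cmod_sqr; case: h => a b /= h1 hx.
have ax : a <= - x by nra.
have b0 : b ^+ 2 <= 0 by nra.
have -> : b = 0 by apply/eqP; rewrite -sqrf_eq0 eq_le b0 sqr_ge0.
have -> : a = - x by nra.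
by rewrite -rmorphN.
Qed.

Lemma artanhN (x : R) : -1 < x < 1 -> artanh (- x) = - artanh x.
Proof.
move=> x1; rewrite -{1}(tanhK x1) -tanhN artanh_tanh//.
Qed.

(** If the two points were not on opposite rays, the Kobayashi segment between them
    would be shorter than the way through the centre [M 0]. *)
Lemma geodesic_opposite M N (g : R -> V) s u t : ball_iso M N ->
  geodesic B line g -> g u = M 0 -> s <= u <= t ->
  herm (N (g s)) (N (g t)) = - (nrm (N (g s)) * nrm (N (g t)))%:C%C.
Proof.
move=> MN [[_ gB] gmin] gu /andP[].
have gin x : B (g x) by apply: gB.
rewrite le_eqVlt => /predU1P[->|su].
  by rewrite gu (iso0 MN) herm0l nrm0 mul0r rmorph0 oppr0.
rewrite le_eqVlt => /predU1P[<-|ut].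
  by rewrite gu (iso0 MN) herm0r nrm0 mulr0 rmorph0 oppr0.
have [hM hN NM MNK] := MN.
set p := N (g s); set q := N (g t).
have p1 : nrm p < 1 by exact: (iso_ball MN).
have q1 : nrm q < 1 by exact: (iso_ball MN).
have p0 := nrm_ge0 p; have q0 := nrm_ge0 q.
have v1 : nrm (- udir p) <= 1 by rewrite -scaleN1r nrmZ cmodN cmod1 mul1r nrm_udir.
have low := curve_length_ge2 g su ut (centred_form_kobayashi MN v1)
  (centred_form_kobayashi MN (nrm_udir q)).
rewrite gu !(centred_form0 _ MN) caylog0 subr0 sub0r in low.
rewrite {1 2}/centred_form -/p -/q hermNr !herm_udir -rmorphN !caylog_real in low.
rewrite artanhN ?opprK in low; last by lra.
(* The competitor: the image of the radius from [0] to [y] under [M \o ball_swap p]. *)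
pose y := ball_swap p q; have y1 : nrm y < 1 by exact: ball_swap_ball.
have y0 := nrm_ge0 y.
have Bp : B p by exact/unit_ballE.
have [hphi _ phiphi _] := ball_swap_iso Bp.
have hd : holomorphic_map (@unit_disc R) B (fun l : C => M (ball_swap p (l *: udir y))).
  exact: (disc_map (holomorphic_map_comp hM hphi) (nrm_udir y)).
have T0 : 0 <= artanh (nrm y) by rewrite artanh_ge0// y0.
have := gmin s t; rewrite !in_itv /= => /(_ isT isT (ltW (lt_trans su ut))).
move=> /(_ 0 (artanh (nrm y)) _ T0 (disc_line_in `[0, artanh (nrm y)] hd)).
rewrite tanh0 rmorph0 scale0r ball_swap0 MNK// tanhK; last by lra.
rewrite udirK phiphi ?MNK//; last exact/unit_ballE.
move=> /(_ erefl erefl) up.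
have := le_trans low (le_trans up (disc_line_length 0 (artanh (nrm y)) hd)).
rewrite subr0 lee_fin {low up gmin hd hphi} => PQ.
have {PQ} : (nrm p + nrm q) <= nrm y * (1 + nrm p * nrm q).
  move: PQ; rewrite /artanh -mulrDl ler_pM2r ?invr_gt0//.
  move: (nrm p) (nrm q) (nrm y) p1 q1 p0 q0 y0 y1 => P Q r P1 Q1 P0 Q0 r0 r1.
  have fr (x : R) : 0 <= x -> x < 1 -> 0 < (1 + x) / (1 - x) by move=> *; rewrite divr_gt0//; lra.
  have fP := fr P P0 P1; have fQ := fr Q Q0 Q1; have fR := fr r r0 r1.
  rewrite -lnM ?posrE// ler_ln ?posrE//; last exact: mulr_gt0.
  have d0 : 0 < (1 - P) * (1 - Q) by rewrite mulr_gt0//; lra.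
  have r10 : 0 < 1 - r by lra.
  by rewrite mulf_div ler_pdivrMr// mulrAC ler_pdivlMr//; lra.
move=> PQ; have := ball_swap_nrm p1 (ltW q1); rewrite -/y => E.
have CS : cmod (herm p q) <= nrm p * nrm q := cauchy_schwarz p q.
apply: opposite_scalar => //; first by rewrite mulr_ge0.
have -> : cmod (1 - herm p q) = cmod (1 - herm q p).
  by rewrite -[RHS]cmod_conj conjcB conjc1 herm_conj.
have m0 := cmod_ge0 (1 - herm q p).
move: (cmod (1 - herm q p)) m0 E PQ => m m0 E PQ.
move: (nrm p) (nrm q) (nrm y) p1 q1 p0 q0 y0 y1 E PQ CS => P Q r P1 Q1 P0 Q0 r0 r1 E PQ CS.
have PQ2 : (P + Q) ^+ 2 <= r ^+ 2 * (1 + P * Q) ^+ 2.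
  by rewrite -exprMn ler_pXn2r// nnegrE; nra.
have r2 : 0 < 1 - r ^+ 2 by nra.
rewrite -(@ler_pXn2r _ 2)// ?nnegrE; [|nra..].
by rewrite -(ler_pM2l r2) E; lra.
Qed.

End BallGeodesics.

(** * Geodesic lines and diameters *)

Section GeodesicLines.
Variables (R : realType) (n : nat).
Local Notation C := R[i].
Local Notation V := 'rV[C]_n.
Local Notation B := (unit_ball R n).
Local Notation line := `]-oo, +oo[.
Implicit Types (p q z w a b eta zeta : V) (M N : V -> V).

Lemma tanh_cvgy : (tanh t : R) @[t --> +oo] --> (1 : R).
Proof.
apply/cvgrPdist_lt => e e0; exists (e^-1); split; first exact: num_real.
move=> t et; have t0 : 0 < t by apply: lt_trans et; rewrite invr_gt0.
have := expR_ge1Dx (2 * t) => h; have := tanh_lt1 t => t1.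
rewrite gtr0_norm; last by lra.
have -> : 1 - tanh t = 2 / (expR (2 * t) + 1) by rewrite /tanh; field; rewrite lt0r_neq0//; lra.
rewrite ltr_pdivrMr; last lra.
have : 1 < e * t by rewrite mulrC -ltr_pdivrMr// mul1r.
nra.
Qed.

Lemma tanh_gt0 (t : R) : 0 < t -> 0 < tanh t.
Proof.
move=> t0; have := expR_ge1Dx (2 * t) => h; rewrite /tanh divr_gt0//; lra.
Qed.

Lemma squeeze_tanh (rho : R -> R) : (forall t, 0 <= t -> tanh t <= rho t) ->
  (forall t, rho t < 1) -> rho t @[t --> +oo] --> (1 : R).
Proof.
move=> h r1; have /cvgrPdist_lt c := tanh_cvgy.
apply/cvgrPdist_lt => e /c [T [Tr hT]].
exists (Num.max T 0); split; first exact: num_real.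
move=> t; rewrite gt_max => /andP[/hT /= + t0].
have := h t (ltW t0); have := r1 t; have := tanh_lt1 t => ? ? ?.
by rewrite !gtr0_norm; lra.
Qed.

Lemma ball_swap_radial_cvg a eta (F : set_system R) {FF : Filter F} (rho : R -> R) (g : R -> V) :
  nrm a < 1 -> nrm eta = 1 -> rho t @[t --> F] --> (1 : R) ->
  (\forall t \near F, g t = ball_swap a ((rho t)%:C%C *: eta)) ->
  g t @[t --> F] --> ball_swap a eta.
Proof.
move=> a1 eta1 crho geta.
have c1 : {for 1, continuous (fun x : R => ball_swap a (x%:C%C *: eta))}.
  have c0 : {for (1 : R), continuous (fun x : R => x%:C%C *: eta : V)}.
    apply: (@continuous_comp _ _ _ (fun x : R => x%:C%C : C) (fun c => c *: eta)).
      exact: continuous_real_complex.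
    exact/differentiable_continuous/differentiable_line.
  apply: (@continuous_comp _ _ _ (fun x : R => x%:C%C *: eta : V) (ball_swap a) _ c0).
  apply/differentiable_continuous/differentiable_ball_swap.
  by rewrite rmorph1 scale1r sub1_herm_neq0// eta1.
have := cvg_comp _ _ crho c1; rewrite /= rmorph1 scale1r.
by apply: cvg_trans; apply: near_eq_cvg; apply: filterS geta => t ->.
Qed.

(** The diameter through [zeta], transported by an automorphism, ends on the sphere:
    seen from its midpoint through the explicit involution [ball_swap], it is again a
    diameter, and [ball_swap] extends continuously to the closed ball. *)
Lemma diameter_limits M N a (g : R -> V) : ball_iso M N -> M 0 = a -> B a ->
  geodesic B line g -> g 0 = a -> (forall t, nrm (N (g t)) = `|tanh t|) ->
  exists p q, [/\ boundary B p, boundary B q,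
    g t @[t --> -oo] --> p & g t @[t --> +oo] --> q].
Proof.
move=> MN M0 Ba geo g0 hN; have a1 : nrm a < 1 by exact/unit_ballE.
have gB t : B (g t) by case: geo => -[_ h] _; apply: h.
have iphi := ball_swap_iso Ba; have phi00 : ball_swap a 0 = a := ball_swap0 a.
have [rho Erho] : {rho | forall t, rho t = nrm (ball_swap a (g t))} by eexists.
have rhoN t : `|tanh t| <= rho t.
  by rewrite Erho -hN; apply: (nrm_center_le MN iphi) => //; rewrite M0.
have rho1 t : rho t < 1 by rewrite Erho; exact: (iso_ball iphi).
have gphi t : g t = ball_swap a (ball_swap a (g t)).
  by rewrite ball_swapK//; have /unit_ballE := gB t; exact: ltW.
have opp s t : s <= 0 -> 0 <= t ->
    (rho s)%:C%C *: ball_swap a (g t) = - ((rho t)%:C%C *: ball_swap a (g s)).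
  move=> s0 t0; rewrite !Erho; apply: opposite_rays; apply: (geodesic_opposite (u := 0) iphi geo).
    by rewrite g0 phi00.
  by rewrite s0.
have th1 : 0 < tanh (1 : R) by apply: tanh_gt0.
have rhoN1 : 0 < rho (-1).
  by apply: lt_le_trans (rhoN (-1)); rewrite tanhN normrN gtr0_norm.
have rho11 : 0 < rho 1.
  by apply: lt_le_trans (rhoN 1); rewrite gtr0_norm.
have C0 (x : R) : 0 < x -> x%:C%C != 0 :> C.
  by move=> x0; rewrite -cmod_gt0 cmod_real gtr0_norm.
have [y Ey] : {y | forall t, ball_swap a (g t) = y t} by exists (ball_swap a \o g).
have [eta Eeta] : {eta : V | eta = - ((rho (-1))^-1%:C%C *: y (-1))} by eexists.
have rhoE t : rho t = nrm (y t) by rewrite Erho Ey.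
have eta1 : nrm eta = 1.
  rewrite Eeta -scaleN1r !nrmZ cmodN cmod1 mul1r cmod_real.
  by rewrite -rhoE ger0_norm ?invr_ge0 ?(ltW rhoN1)// mulVf ?lt0r_neq0.
have opp' s t : s <= 0 -> 0 <= t -> (rho s)%:C%C *: y t = - ((rho t)%:C%C *: y s).
  by rewrite -!Ey; exact: opp.
have neta1 : nrm (- eta) = 1 by rewrite -scaleN1r nrmZ cmodN cmod1 mul1r.
have pos t : 0 <= t -> g t = ball_swap a ((rho t)%:C%C *: eta).
  move=> t0; rewrite {1}gphi Ey; congr (ball_swap a _).
  have N10 : (-1 : R) <= 0 by rewrite oppr_le0.
  apply: (scalerI (C0 _ rhoN1)); rewrite (opp' (-1) t N10 t0) Eeta !scalerN.
  congr (- _); rewrite !scalerA; congr (_ *: _).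
  by rewrite mulrAC fmorphV mulfV ?mul1r ?C0.
have neg t : t <= 0 -> g t = ball_swap a ((rho t)%:C%C *: - eta).
  move=> t0; rewrite {1}gphi Ey; congr (ball_swap a _).
  have g1 : y 1 = (rho 1)%:C%C *: eta.
    have /(congr1 (ball_swap a)) := pos 1 ler01; rewrite Ey ball_swapK// nrmZ eta1 mulr1 cmod_real.
    by rewrite ger0_norm ?nrm_ge0// ltW.
  apply: (scalerI (C0 _ rho11)); rewrite -[LHS]opprK -(opp' t 1 t0 ler01) g1.
  rewrite !scalerN; congr (- _); rewrite !scalerA; congr (_ *: _); exact: mulrC.
have rho_ge t : 0 <= t -> tanh t <= rho t.
  by move=> t0; apply: le_trans (rhoN t); exact: ler_norm.
have rho_geN t : 0 <= t -> tanh t <= rho (- t).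
  by move=> t0; apply: le_trans (rhoN (- t)); rewrite tanhN normrN; exact: ler_norm.
exists (ball_swap a (- eta)), (ball_swap a eta); split.
- exact/boundary_sphere/ball_swap_sphere.
- exact/boundary_sphere/ball_swap_sphere.
- have c1 := squeeze_tanh rho_geN (fun t => rho1 (- t)).
  have c2 : rho t @[t --> -oo] --> (1 : R).
    move: c1 => /cvgrPdist_lt c1; apply/cvgrPdist_lt => e /c1[T [Tr hT]].
    exists (- T); split; first by rewrite realN.
    by move=> t tT; have := hT (- t); rewrite /= opprK; apply; rewrite ltrNr.
  apply: (ball_swap_radial_cvg (rho := rho)) => //.
  by exists 0; split; [exact: real0|move=> t t0; exact: neg (ltW t0)].
apply: (ball_swap_radial_cvg (rho := rho)) => //; first exact: squeeze_tanh.
by exists 0; split; [exact: real0|move=> t t0; exact: pos (ltW t0)].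
Qed.

Lemma diameter_geodesic_line M N a zeta : ball_iso M N -> M 0 = a -> B a -> nrm zeta = 1 ->
  geodesics_through B a (range (fun t : R => M ((tanh t)%:C%C *: zeta))).
Proof.
move=> MN M0 Ba z1; have [hM [fN dN] NM _] := MN.
have z1' : nrm zeta <= 1 by rewrite z1.
pose g t := M ((tanh t)%:C%C *: zeta).
have lB (l : C) : cmod l < 1 -> B (l *: zeta).
  by move=> l1; apply/unit_ballE; rewrite nrmZ z1 mulr1.
have g0 : g 0 = a by rewrite /g tanh0 rmorph0 scale0r.
have geo : geodesic B line g.
  apply: (disc_line_geodesic (psi := fun l => M (l *: zeta)) (F := centred_form N zeta)).
  - exact: disc_map.
  - by move=> x Bx; exact: centred_form_diff MN x Bx.
  - by move=> x Bx; exact: centred_form_lt1 MN z1' x Bx.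
  - by move=> l l1; rewrite /centred_form /= NM; [rewrite hermZl herm_nrm z1 expr1n rmorph1 mulr1|exact: lB].
exists g => //; split; last by apply: subset_closure; exists 0.
split => //; apply: (diameter_limits MN M0 Ba geo g0) => t.
by rewrite /g NM; [rewrite nrmZ z1 mulr1 cmod_real|apply: lB; exact: tanh_disc].
Qed.

(** Near its ends the curve stays away from [b], and the rest of it is compact. *)
Lemma closure_range_limits (T : topologicalType) (g : R -> T) (b p q : T) :
  hausdorff_space T -> continuous g -> p <> b -> q <> b ->
  g t @[t --> -oo] --> p -> g t @[t --> +oo] --> q ->
  closure (range g) b -> exists t, g t = b.
Proof.
move=> hT cg pb qb gp gq clb; apply: contrapT => nb.
have sep (x : T) : x <> b -> exists U W, [/\ nbhs x U, nbhs b W & U `&` W = set0].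
  move=> xb; apply: contrapT => h; apply: xb; apply: hT => U W Ux Wb.
  apply/set0P/negP => /eqP UW; apply: h; exists U, W; split => //.
have [U1 [W1 [Up Wb1 UW1]]] := sep p pb; have [U2 [W2 [Uq Wb2 UW2]]] := sep q qb.
have [T1 [_ h1]] := gp _ Up; have [T2 [_ h2]] := gq _ Uq.
have cK : closed (g @` `[T1, T2]).
  apply: compact_closed => //; apply: continuous_compact; last exact: segment_compact.
  exact: continuous_subspaceT.
have nK : nbhs b (~` (g @` `[T1, T2])).
  apply: open_nbhs_nbhs; split; first exact: closed_openC.
  by move=> [t _ gt]; apply: nb; exists t.
have [_ [[t _ <-] [[Wt1 Wt2] nKt]]] := clb _ (filterI (filterI Wb1 Wb2) nK).
have [tT1|tT1] := ltP t T1.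
  have : (U1 `&` W1) (g t) by split => //; exact: h1.
  by rewrite UW1.
have [tT2|tT2] := ltP T2 t.
  have : (U2 `&` W2) (g t) by split => //; exact: h2.
  by rewrite UW2.
by apply: nKt; exists t => //=; rewrite in_itv /= tT1.
Qed.

(** [geodesic_opposite] compares every point of the line with one of two fixed points,
    one on each side of [b]. *)
Lemma geodesic_line_real M N b (G : set V) : ball_iso M N -> M 0 = b -> B b ->
  geodesics_through B b G -> exists v : V, forall x, G x -> exists r : R, N x = r%:C%C *: v.
Proof.
move=> MN M0 Bb [g [[geo [p [q [bp bq gp gq]]]] clb] <-].
have [hM [fN dN] NM MNK] := MN.
have gB t : B (g t) by case: geo => -[_ h] _; apply: h.
have cg : continuous g.
  have [[cgl _] _] := geo; rewrite set_itvNyy in cgl.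
  have [_ h] := @continuous_subspace_setT _ _ g; exact: h cgl.
have [u gu] : exists t, g t = b.
  apply: (closure_range_limits _ cg _ _ gp gq clb).
  - exact: norm_hausdorff.
  - exact: boundary_not_ball bp Bb.
  - exact: boundary_not_ball bq Bb.
have opp s t : s <= u -> u <= t ->
    (nrm (N (g s)))%:C%C *: N (g t) = - ((nrm (N (g t)))%:C%C *: N (g s)).
  move=> su ut; apply: opposite_rays; apply: (geodesic_opposite (u := u) MN geo).
    by rewrite gu M0.
  by rewrite su.
have gb t : N (g t) = 0 -> g t = b by move=> h; rewrite -(MNK (g t) (gB t)) h M0.
(* On each side of [u] the curve leaves [b], since it has a limit on the boundary. *)
have [s su s0] : exists2 s, s <= u & nrm (N (g s)) != 0.
  apply: contrapT => h; apply: (boundary_not_ball bp Bb).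
  suff gcst : g t @[t --> -oo] --> b by exact: (cvg_unique _ gp gcst).
  apply: cvg_near_cst; exists u; split; first exact: num_real.
  move=> t /ltW tu; apply/gb/nrm_eq0/eqP; apply: contrapT => /negP t0.
  by apply: h; exists t.
have [t ut t0] : exists2 t, u <= t & nrm (N (g t)) != 0.
  apply: contrapT => h; apply: (boundary_not_ball bq Bb).
  suff gcst : g t @[t --> +oo] --> b by exact: (cvg_unique _ gq gcst).
  apply: cvg_near_cst; exists u; split; first exact: num_real.
  move=> t /ltW tu; apply/gb/nrm_eq0/eqP; apply: contrapT => /negP t0.
  by apply: h; exists t.
have C0 (x : R) : x != 0 -> x%:C%C != 0 :> C.
  by move=> x0; rewrite -cmod_gt0 cmod_real normr_gt0.
have solve (x r : R) (v w : V) : x != 0 -> x%:C%C *: v = - (r%:C%C *: w) ->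
    v = (- (r / x))%:C%C *: w.
  move=> x0 h; apply: (scalerI (C0 x x0)); rewrite h scalerA -rmorphM.
  have -> : x * - (r / x) = - r by field.
  by rewrite rmorphN scaleNr.
exists (N (g s)) => _ [x _ <-]; have [ux|xu] := leP u x.
  by eexists; apply: solve s0 (opp s x su ux).
have h1 := opp x t (ltW xu) ut; have h2 := solve _ _ _ _ s0 (opp s t su ut).
have h3 : (nrm (N (g t)))%:C%C *: N (g x) = - ((nrm (N (g x)))%:C%C *: N (g t)).
  by rewrite h1 opprK.
by rewrite (solve _ _ _ _ t0 h3) h2 scalerA -rmorphM; eexists.
Qed.

End GeodesicLines.

(** * Radially real maps of the ball are homogeneous *)

Section RadialMaps.
Variables (R : realType) (n : nat).
Local Notation C := R[i].
Local Notation V := 'rV[C]_n.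
Local Notation B := (unit_ball R n).
Implicit Types (z w v : V).

Lemma nrmD z w : nrm (z + w) <= nrm z + nrm w.
Proof.
rewrite -(@ler_pXn2r _ 2) ?nnegrE ?addr_ge0 ?nrm_ge0//.
have E : nrm (z + w) ^+ 2 = nrm z ^+ 2 + nrm w ^+ 2 + 2 * complex.Re (herm z w).
  apply: (@complexI R); rewrite -herm_nrm hermDl !hermDr !herm_nrm -(herm_conj z w).
  have -> : forall a b c : R, (a + b + 2 * c)%:C%C = a%:C%C + b%:C%C + 2 * c%:C%C :> C.
    by move=> a b c; rewrite !rmorphD rmorphM rmorph_nat.
  by rewrite -addcJ; ring.
rewrite E; have := le_trans (ler_norm _) (le_trans (normr_Re_le _) (cauchy_schwarz z w)).
lra.
Qed.

Variable g : V -> V.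
Hypothesis dg : forall z, B z -> differentiable g z.
Hypothesis radial : forall zeta, nrm zeta = 1 -> exists v, forall t : R, -1 < t < 1 ->
  exists r : R, g (t%:C%C *: zeta) = r%:C%C *: v.

Lemma ball_scale (l : C) z : cmod l <= 1 -> B z -> B (l *: z).
Proof.
move=> l1 /unit_ballE z1; apply/unit_ballE; rewrite nrmZ.
by apply: le_lt_trans z1; rewrite ler_piMl ?nrm_ge0.
Qed.

(** The disc spanned by [z / s], with [s < 1], contains the closed disc spanned by [z];
    on it [radially_real_monomial] applies. *)
Lemma slice_homogeneous z : B z ->
  exists m : nat, forall l : C, cmod l <= 1 -> g (l *: z) = l ^+ m *: g z.
Proof.
move=> /unit_ballE z1; have z0 := nrm_ge0 z.
pose s : R := (1 + nrm z) / 2.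
have s01 : 0 < s < 1 by rewrite /s; lra.
have zs : nrm z < s by rewrite /s; lra.
have sC : s%:C%C != 0 :> C by rewrite -cmod_gt0 cmod_real normr_gt0; lra.
have [z' Ez'] : {z' : V | z' = (s%:C%C)^-1 *: z} by eexists.
have zE : z = s%:C%C *: z' by rewrite Ez' scalerA mulfV// scale1r.
have z'1 : nrm z' < 1.
  rewrite Ez' nrmZ cmodV cmod_real gtr0_norm; last by lra.
  by rewrite mulrC ltr_pdivrMr; lra.
have Bz' : B z' by exact/unit_ballE.
have Bl (l : C) : cmod l < 1 -> B (l *: z') by move=> l1; apply: ball_scale (ltW l1) Bz'.
pose u (j : 'I_n) (l : C) := g (l *: z') 0 j.
have du j : holD 1 (u j).
  move=> l l1; apply: differentiable_entry.
  exact: (differentiable_comp (differentiable_line z' l) (dg (Bl l l1))).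
have ue (w : C) : cmod w < 1 -> exists e : 'I_n -> C, forall t : R, 0 < t <= 1 ->
    exists r : R, forall j, u j (t%:C%C * w) = r%:C%C * e j.
  move=> w1; have [x Ex] : {x : V | x = w *: z'} by eexists.
  have x1 : nrm x < 1 by apply/unit_ballE; rewrite Ex; exact: Bl.
  have x0 := nrm_ge0 x; have [x0'|x0'] := eqVneq (nrm x) 0.
    exists (fun j => g 0 0 j) => t _; exists 1 => j.
    by rewrite /u -scalerA -Ex (nrm_eq0 x0') scaler0 rmorph1 mul1r.
  have ud : nrm (udir x) = 1.
    by rewrite /udir nrmZ cmod_real ger0_norm ?invr_ge0// mulVf.
  have [v hv] := radial ud; exists (fun j => v 0 j) => t t01.
  have [|r hr] := hv (t * nrm x).
    have : 0 <= t * nrm x < 1 by nra.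
    lra.
  exists r => j; rewrite /u -scalerA -Ex.
  have -> : t%:C%C *: x = (t * nrm x)%:C%C *: udir x.
    by rewrite rmorphM -scalerA udirK.
  by rewrite hr mxE.
have ls (l : C) : cmod l <= 1 -> cmod (l * s%:C%C) < 1.
  move=> l1; rewrite cmodM cmod_real gtr0_norm; last by lra.
  by have := cmod_ge0 l; nra.
have gE (l : C) j : g (l *: z) 0 j = u j (l * s%:C%C) by rewrite /u -scalerA -zE.
have gz j : g z 0 j = u j s%:C%C by rewrite -[z]scale1r gE mul1r.
have s1 : cmod s%:C%C < 1 by have := ls 1; rewrite cmod1 mul1r; apply.
have [u0|[m [c [_ uc]]]] := radially_real_monomial du ue.
  exists 0%N => l l1; apply/rowP => j.
  by rewrite mxE gE gz !u0 ?mulr0// ls.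
exists m => l l1; apply/rowP => j.
by rewrite mxE gE gz !uc ?ls// exprMn mulrA.
Qed.

(** The values [2^-1 ^+ m] are isolated, so continuity detects the degree [m]. *)
Lemma pow_half_sep (m k : nat) : m != k -> 2^-1 ^+ k.+1 <= `|2^-1 ^+ m - 2^-1 ^+ k : R|.
Proof.
have P i : 0 < (2^-1 : R) ^+ i by rewrite exprn_gt0// invr_gt0.
have half (i j : nat) : (i < j)%N -> (2^-1 : R) ^+ j <= 2^-1 ^+ i.+1.
  by move=> ij; apply: ler_wiXn2l => //; lra.
have := P k; have := P m; rewrite exprSr.
case: (ltngtP m k) => // mk Pm Pk _.
  have := half _ _ mk; rewrite exprSr => h.
  by rewrite ger0_norm; lra.
have := half _ _ mk; rewrite exprSr => h.
by rewrite ler0_norm; lra.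
Qed.

(** On a complex line the degrees near one point agree, since they can be read off the
    values; by uniqueness of analytic continuation they agree all along the line. *)
Lemma degree_unique z1 z2 (m1 m2 : nat) : B z1 -> B z2 -> g z1 != 0 -> g z2 != 0 ->
  (forall l : C, cmod l <= 1 -> g (l *: z1) = l ^+ m1 *: g z1) ->
  (forall l : C, cmod l <= 1 -> g (l *: z2) = l ^+ m2 *: g z2) -> m1 = m2.
Proof.
move=> B1 B2 g1 g2 h1 h2.
(* Shrinking to norm [1 / 8] makes room for a disc of radius [3] on the line. *)
pose c : C := (8^-1 : R)%:C%C; have c0 : c != 0.
  by rewrite -cmod_gt0 cmod_real normr_gt0 invr_eq0.
have c8 : cmod c = 8^-1 by rewrite cmod_real ger0_norm.
have c1 : cmod c <= 1 by rewrite c8; lra.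
(* The degree is read off the ratio [g (x / 2) / g x]. *)
pose hf : C := (2^-1 : R)%:C%C.
have hf1 : cmod hf <= 1 by rewrite cmod_real ger0_norm; lra.
have hf0 : hf != 0 by rewrite -cmod_gt0 cmod_real normr_gt0 invr_eq0.
have [x1 Ex1] : {x1 : V | x1 = c *: z1} by eexists.
have [x2 Ex2] : {x2 : V | x2 = c *: z2} by eexists.
have gh1 : g (hf *: x1) = hf ^+ m1 *: g x1.
  rewrite Ex1 scalerA !h1//; first by rewrite exprMn scalerA.
  by rewrite cmodM; have := cmod_ge0 hf; have := cmod_ge0 c; nra.
have gh2 : g (hf *: x2) = hf ^+ m2 *: g x2.
  rewrite Ex2 scalerA !h2//; first by rewrite exprMn scalerA.
  by rewrite cmodM; have := cmod_ge0 hf; have := cmod_ge0 c; nra.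
have gx1 : g x1 != 0 by rewrite Ex1 h1// scaler_eq0 negb_or expf_neq0.
have gx2 : g x2 != 0 by rewrite Ex2 h2// scaler_eq0 negb_or expf_neq0.
have n1 : nrm x1 <= 8^-1 by rewrite Ex1 nrmZ c8; move/unit_ballE: B1; lra.
have n2 : nrm x2 <= 8^-1 by rewrite Ex2 nrmZ c8; move/unit_ballE: B2; lra.
have [d Ed] : {d : V | d = x2 - x1} by eexists.
have nd : nrm d <= 4^-1.
  rewrite Ed; apply: le_trans (nrmD _ _) _.
  by rewrite -scaleN1r nrmZ cmodN cmod1 mul1r; lra.
pose x (mu : C) : V := x1 + mu *: d.
have Bx mu : cmod mu < 3 -> B (x mu).
  move=> mu3; apply/unit_ballE; apply: le_lt_trans (nrmD _ _) _; rewrite nrmZ.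
  by have := cmod_ge0 mu; have := nrm_ge0 d; nra.
have dx mu : differentiable x mu.
  by apply: differentiableD; [exact: differentiable_cst|exact: differentiable_line].
pose G j mu := g (x mu) 0 j; pose H j mu := g (hf *: x mu) 0 j.
have dG j : holD 3 (G j).
  move=> mu mu3; apply: differentiable_entry.
  exact: (differentiable_comp (dx mu) (dg (Bx mu mu3))).
have dH j : holD 3 (H j).
  move=> mu mu3; apply: differentiable_entry.
  have dhx : differentiable (fun mu => hf *: x mu) mu by apply: differentiableZ; exact: dx.
  exact: (differentiable_comp dhx (dg (ball_scale hf1 (Bx mu mu3)))).
have x0 : x 0 = x1 by rewrite /x scale0r addr0.
have x1E : x 1 = x2 by rewrite /x scale1r Ed addrC subrK.
have [j Gj] : exists j, G j 0 != 0.
  apply: contrapT => /forallNP h; move/negP: gx1; apply; apply/eqP/rowP => j.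
  by rewrite mxE; apply/eqP; apply: contrapT => /negP hj; apply: (h j); rewrite /G x0.
have z3 : cmod (0 : C) < 3 by rewrite cmod0.
have cG : {for 0, continuous (G j)} by exact/diff_contC/dG.
have cH : {for 0, continuous (H j)} by exact/diff_contC/dH.
have cq : {for 0, continuous (fun mu => H j mu / G j mu)}.
  exact: (continuousM cH (continuousV Gj cG)).
have hE mu : cmod mu < 3 -> exists m, forall i, H i mu = hf ^+ m * G i mu.
  move=> mu3; have [m hm] := slice_homogeneous (Bx mu mu3).
  by exists m => i; rewrite /H hm// mxE.
have near0 : exists2 e : R, 0 < e <= 1 & forall mu, cmod mu < e ->
    forall i, H i mu = hf ^+ m1 * G i mu.
  have e0 : 0 < (2^-1 : R) ^+ m1.+1 by rewrite exprn_gt0// invr_gt0.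
  have /continuousC_P/(_ _ e0)[e1 e10 he1] := cq.
  have G0 : 0 < cmod (G j 0) by rewrite cmod_gt0.
  have /continuousC_P/(_ _ G0)[e2 e20 he2] := cG.
  exists (Num.min 1 (Num.min e1 e2)); first by rewrite !lt_min ltr01 e10 e20 ge_min lexx.
  move=> mu; rewrite !lt_min => /and3P[mu1 mue1 mue2] i.
  have l13 : (1 : R) < 3 by lra.
  have [m hm] := hE mu (lt_trans mu1 l13).
  have Gmu : G j mu != 0.
    have := he2 mu; rewrite subr0 => /(_ mue2).
    by apply: contraTneq => ->; rewrite sub0r cmodN ltxx.
  have := he1 mu; rewrite subr0 => /(_ mue1) sep; rewrite hm mulfK// in sep.
  move: sep.
  have -> : H j 0 / G j 0 = hf ^+ m1.
    by rewrite /H /G x0 gh1 mxE mulfK//; move: Gj; rewrite /G x0.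
  move=> sep; rewrite /hf -!rmorphXn -rmorphB cmod_real in sep.
  suff <- : m = m1 by exact: hm.
  apply/eqP; apply: contraTT sep => /pow_half_sep.
  by rewrite leNgt.
have [e /andP[e0 e1] he] := near0.
pose D (i : 'I_n) mu := H i mu - hf ^+ m1 * G i mu.
have dD i : holD 3 (D i).
  move=> mu mu3; apply: differentiableB; first exact: dH.
  by apply: differentiableM; [exact: differentiable_cst|exact: dG].
have [D0|[k [v [dv [i vi] Dv]]]] := holD_order (ltr0Sn _ 2) dD.
  have E : hf ^+ m2 *: g x2 = hf ^+ m1 *: g x2.
    apply/rowP => i; rewrite -gh2 [RHS]mxE; have := D0 i 1.
    have l13 : (1 : R) < 3 by lra.
    by rewrite cmod1 /D /H /G x1E => /(_ l13)/eqP; rewrite subr_eq0 => /eqP.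
  apply/eqP; apply: contrapT => /negP/pow_half_sep; apply/negP; rewrite -ltNge.
  have /eqP := E; rewrite -subr_eq0 -scalerBl scaler_eq0 (negPf gx2) orbF subr_eq0.
  rewrite /hf -!rmorphXn => /eqP/(@complexI R) ->.
  by rewrite subrr normr0 exprn_gt0// invr_gt0.
have cv : {for 0, continuous (v i)} by exact/diff_contC/dv.
move/negP: vi; case; apply/eqP.
apply: (@eq_limit0 R (v i) (e / 2)%:C%C cv) => t /andP[t0 t1].
have mu0 : t%:C%C * (e / 2)%:C%C != 0 :> C.
  by rewrite -rmorphM -cmod_gt0 cmod_real normr_gt0; nra.
apply: (mulfI (expf_neq0 k mu0)); rewrite mulr0 -Dv /D he ?subrr//.
rewrite -rmorphM cmod_real gtr0_norm; nra.
Qed.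

Lemma radial_homogeneous :
  exists m : nat, forall z (l : C), B z -> cmod l <= 1 -> g (l *: z) = l ^+ m *: g z.
Proof.
have [[z1 [B1 g1]]|nz] := pselect (exists z, B z /\ g z != 0); last first.
  have g0 z : B z -> g z = 0.
    move=> Bz; apply/eqP; apply: contrapT => /negP gz; apply: nz; by exists z.
  by exists 0%N => z l Bz l1; rewrite !g0 ?scaler0//; exact: ball_scale.
have [m1 h1] := slice_homogeneous B1; exists m1 => z l Bz l1.
have [m h] := slice_homogeneous Bz; rewrite h//.
have [->|gz] := eqVneq (g z) 0; first by rewrite !scaler0.
by rewrite (degree_unique B1 Bz g1 gz h1 h).
Qed.

End RadialMaps.

(** * From homogeneous maps to polynomials *)

Section Interpolation.
Variable R : realType.
Local Notation C := R[i].

Lemma cmod_prod (I : finType) (P : pred I) (F : I -> C) :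
  cmod (\prod_(i | P i) F i) = \prod_(i | P i) cmod (F i).
Proof. by apply: (big_morph (@cmod R)); [exact: cmodM|exact: cmod1]. Qed.

Lemma cmod_sum (I : finType) (P : pred I) (F : I -> C) :
  cmod (\sum_(i | P i) F i) <= \sum_(i | P i) cmod (F i).
Proof.
apply: (big_ind2 (fun a b => cmod a <= b)); rewrite ?cmod0//.
by move=> x a y b ha hb; apply: le_trans (cmodD x y) (lerD ha hb).
Qed.

Lemma cmod_natr k : cmod (k%:R : C) = k%:R.
Proof. by rewrite -(rmorph_nat (real_complex R)) cmod_real normr_nat. Qed.

Lemma natrC_inj (i k : nat) : (i%:R == k%:R :> C) = (i == k).
Proof. exact: eqr_nat. Qed.

Definition lagrange_basis (m : nat) (i : 'I_m.+1) (l : C) : C :=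
  \prod_(k < m.+1 | k != i) ((l - k%:R) / (i%:R - k%:R)).

Lemma lagrange_node m (i k : 'I_m.+1) : lagrange_basis i k%:R = (i == k)%:R.
Proof.
rewrite /lagrange_basis; have [->|ik] := eqVneq i k.
  rewrite big1 // => j jk; rewrite divff// subr_eq0 natrC_inj.
  by apply: contraNneq jk => h; apply/eqP/val_inj.
apply/eqP; rewrite prodf_seq_eq0; apply/hasP; exists k; rewrite ?mem_index_enum//=.
by rewrite [k == i]eq_sym ik subrr mul0r eqxx.
Qed.

Lemma differentiable_bigprod (I : Type) (r : seq I) (P : pred I) (F : I -> C -> C) l :
  (forall i, differentiable (F i) l) ->
  differentiable (fun x => \prod_(i <- r | P i) F i x) l.
Proof.
move=> dF; elim: r => [|i r IH].
  by under eq_fun do rewrite big_nil; exact: differentiable_cst.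
under eq_fun do rewrite big_cons; case: (P i); last exact: IH.
by apply: differentiableM; [exact: dF|exact: IH].
Qed.

Lemma differentiable_lagrange m (i : 'I_m.+1) l : differentiable (lagrange_basis i) l.
Proof.
apply: differentiable_bigprod => k; apply: differentiableM.
  by apply: differentiableB; [exact: differentiable_idC|exact: differentiable_cst].
exact: differentiable_cst.
Qed.

Lemma lagrange_le m (i : 'I_m.+1) l : cmod (lagrange_basis i l) <= ((m.+1%:R) * (1 + cmod l)) ^+ m.
Proof.
rewrite cmod_prod; have l0 := cmod_ge0 l.
apply: (@le_trans _ _ (\prod_(k < m.+1 | k != i) (m.+1%:R * (1 + cmod l)))).
  apply: ler_prod => k ki; rewrite cmod_ge0 /= cmodM cmodV.
  have ik : 1 <= cmod (i%:R - k%:R : C).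
    have ik : (i : nat) != k by apply: contraNneq ki => h; apply/eqP/val_inj.
    case: (ltngtP i k) ik => // h _.
      by rewrite cmodB_sym -natrB 1?ltnW// cmod_natr (ler_nat _ 1) subn_gt0.
    by rewrite -natrB 1?ltnW// cmod_natr (ler_nat _ 1) subn_gt0.
  rewrite ler_pdivrMr; last by lra.
  have h1 : cmod (l - k%:R) <= m.+1%:R * (1 + cmod l).
    have := cmodB l k%:R; rewrite cmod_natr.
    have : (k%:R : R) <= m%:R by rewrite ler_nat -ltnS.
    have : (0 : R) <= m%:R by [].
    rewrite -(natr1 m); nra.
  by apply: le_trans h1 _; rewrite ler_peMr// mulr_ge0//; lra.
rewrite prodr_const; have -> : #|[pred k | k != i]| = m.
  by have := cardC1 i; rewrite card_ord.
by [].
Qed.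

(** The difference from the interpolation polynomial has more zeros than its growth
    allows. *)
Lemma entire_interpolation m (u : C -> C) (K : R) :
  (forall l, differentiable u l) ->
  (forall l, cmod (u l) <= K * (1 + cmod l) ^+ m) ->
  forall l, u l = \sum_(i < m.+1) u i%:R * lagrange_basis i l.
Proof.
move=> du uK l; apply/eqP; rewrite -subr_eq0; apply/eqP.
pose s : seq C := [seq k%:R | k <- iota 0 m.+1].
pose B := K + \sum_(i < m.+1) cmod (u i%:R) * m.+1%:R ^+ m.
apply: (@liouville_zeros R s (fun l => u l - \sum_(i < m.+1) u i%:R * lagrange_basis i l) B).
- by rewrite map_inj_uniq ?iota_uniq// => a b /eqP; rewrite natrC_inj => /eqP.
- move=> w; apply: differentiableB; first exact: du.
  apply: (@differentiable_sumC R m.+1 _ (fun i l => u i%:R * lagrange_basis i l)) => i.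
  apply: differentiableM; first exact: differentiable_cst.
  exact: differentiable_lagrange.
- move=> w; rewrite size_map size_iota exprSr mulrA ler_wpM2r//.
    by have := cmod_ge0 w; lra.
  rewrite /B mulrDl; apply: le_trans (cmodB _ _) (lerD (uK w) _).
  apply: le_trans (cmod_sum _ _) _; rewrite mulr_suml; apply: ler_sum => i _.
  by rewrite cmodM -mulrA -exprMn ler_wpM2l ?cmod_ge0 ?lagrange_le.
move=> x /mapP[k]; rewrite mem_iota add0n => /= km ->.
rewrite (bigD1 (Ordinal km))//= big1 ?addr0 => [|i ik].
  by rewrite (lagrange_node _ (Ordinal km)) eqxx mulr1 subrr.
by rewrite (lagrange_node _ (Ordinal km)) (negPf ik) mulr0.
Qed.

End Interpolation.

Section PolynomialOnLines.
Variables (R : realType) (n : nat).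
Local Notation C := R[i].
Local Notation V := 'rV[C]_n.
Local Notation MP := (mpoly.mpoly n C).
Local Notation ev z := (mpoly.meval (fun i => z 0 i)).

Definition set_coord (p : V) (i : 'I_n) (l : C) : V := \row_k (if k == i then l else p 0 k).

Definition mpoly_lagrange (m : nat) (i : 'I_m.+1) (X : MP) : MP :=
  \prod_(k < m.+1 | k != i)
    ((X - mpoly.mpolyC n k%:R) * mpoly.mpolyC n (i%:R - k%:R)^-1).

Lemma meval_lagrange m (i : 'I_m.+1) (X : MP) (z : V) :
  ev z (mpoly_lagrange i X) = lagrange_basis i (ev z X).
Proof.
rewrite rmorph_prod /=; apply: eq_bigr => k _.
by rewrite mpoly.mevalM mpoly.mevalB !mpoly.mevalC.
Qed.

(** Interpolate in one coordinate after the other: the values at the nodes depend on one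
    coordinate less. *)
Lemma polynomial_of_lines (H : V -> C) (m : nat) :
  (forall p i l, differentiable (fun l => H (set_coord p i l)) l) ->
  (forall p i, exists K : R, forall l, cmod (H (set_coord p i l)) <= K * (1 + cmod l) ^+ m) ->
  exists P : MP, forall z, H z = ev z P.
Proof.
move=> dH gH.
pose mix k (z p : V) : V := \row_i (if (i < k)%N then z 0 i else p 0 i).
suff main k : (k <= n)%N -> forall p, exists P : MP, forall z, H (mix k z p) = ev z P.
  have [P hP] := main n (leqnn n) 0; exists P => z; rewrite -hP; congr H.
  by apply/rowP => i; rewrite mxE ltn_ord.
elim: k => [_ p|k IH kn p].
  exists (mpoly.mpolyC n (H p)) => z; rewrite mpoly.mevalC; congr H.
  by apply/rowP => i; rewrite mxE.
pose i0 := Ordinal kn.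
have /choice[P hP] : forall c : 'I_m.+1, exists P : MP, forall z,
    H (mix k z (set_coord p i0 c%:R)) = ev z P by move=> c; exact: IH (ltnW kn) _.
exists (\sum_(c < m.+1) P c * mpoly_lagrange c (mpoly.mpolyX C (mpoly.mnm1 i0))) => z.
have mixE l : mix k z (set_coord p i0 l) = set_coord (mix k z p) i0 l.
  apply/rowP => i; rewrite !mxE; have [->|//] := eqVneq i i0.
  by rewrite ltnn.
have [K hK] := gH (mix k z p) i0.
have -> : mix k.+1 z p = set_coord (mix k z p) i0 (z 0 i0).
  apply/rowP => i; rewrite !mxE; have [->|ii0] := eqVneq i i0; first by rewrite leqnn.
  rewrite ltnS leq_eqVlt; suff -> : (val i == k) = false by [].
  by apply: contraNF ii0 => /eqP h; apply/eqP/val_inj.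
rewrite (entire_interpolation (dH (mix k z p) i0) hK) rmorph_sum /=.
apply: eq_bigr => c _; rewrite mpoly.mevalM meval_lagrange mpoly.mevalXU.
by rewrite -hP mixE.
Qed.

Lemma poly_eval0 (p : {poly C}) : (forall l, p.[l] = 0) -> p = 0.
Proof.
move=> p0; apply/eqP; apply: contrapT => /negP pn0.
pose s : seq C := [seq k%:R | k <- iota 0 (size p)].
have : (size s < size p)%N.
  apply: max_poly_roots => //; first by apply/allP => x _; apply/rootP.
  by rewrite map_inj_uniq ?iota_uniq// => a b /eqP; rewrite natrC_inj => /eqP.
by rewrite size_map size_iota ltnn.
Qed.

Lemma meval_homog_scale d (P : MP) (z : V) (l : C) :
  P \is mpoly.ishomog1 d mpoly.mdeg -> ev (l *: z) P = l ^+ d * ev z P.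
Proof.
move=> /mpoly.dhomogP hP; rewrite !mpoly.mevalE mulr_sumr.
apply: eq_big_seq => k /hP <-; rewrite mulrCA; congr (_ * _).
under eq_bigr do rewrite mxE exprMn.
by rewrite big_split /= prodrXr mpoly.mdegE.
Qed.

Lemma homogeneous_component (H : V -> C) (P : MP) (m : nat) :
  (forall z, H z = ev z P) -> (forall z l, H (l *: z) = l ^+ m * H z) ->
  exists2 Q : MP, Q \is mpoly.ishomog1 m mpoly.mdeg & forall z, H z = ev z Q.
Proof.
move=> HP Hh; exists (mpoly.pihomog mpoly.mdeg m P); first exact: mpoly.pihomogP.
move=> z; pose a d := ev z (mpoly.pihomog mpoly.mdeg d P).
pose D := maxn (mpoly.msize P) m.+1.
have PD : P = \sum_(d < D) mpoly.pihomog mpoly.mdeg d P.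
  by apply: mpoly.pihomog_partitionE; rewrite leq_maxl.
have : \sum_(d < D) a d *: 'X^d - H z *: 'X^m = 0 :> {poly C}.
  apply: poly_eval0 => l; rewrite !hornerE horner_sum -[_ * l ^+ m]mulrC -Hh HP {1}PD.
  rewrite rmorph_sum /= -sumrB big1// => d _.
  rewrite (meval_homog_scale _ _ (mpoly.pihomogP _ d P)).
  by rewrite !hornerE mulrC subrr.
have mD : (m < D)%N by rewrite leq_maxr.
move=> /(congr1 (fun p : {poly C} => p`_m)); rewrite coef0 coefB coef_sum coefZ coefXn eqxx mulr1.
rewrite (bigD1 (Ordinal mD))//= big1 ?addr0 => [|d dm].
  by rewrite coefZ coefXn eqxx mulr1 => /eqP; rewrite subr_eq0 => /eqP <-.
rewrite coefZ coefXn; suff -> : (m == d) = false by rewrite mulr0.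
by apply: contraNF dm => /eqP h; apply/eqP/val_inj.
Qed.

End PolynomialOnLines.

(** * Homogeneous extension and conclusion *)

Section HomogeneousMaps.
Variables (R : realType) (n : nat).
Local Notation C := R[i].
Local Notation V := 'rV[C]_n.
Local Notation B := (unit_ball R n).
Implicit Types (p z v : V) (s t : R) (l : C).

Variables (g : V -> V) (m : nat).
Hypothesis dg : forall z, B z -> differentiable g z.
Hypothesis gB : forall z, B z -> B (g z).
Hypothesis ghom : forall z (l : C), B z -> cmod l <= 1 -> g (l *: z) = l ^+ m *: g z.

Definition shrink z : R := (2 * (1 + nrm z))^-1.

Lemma shrink_gt0 z : 0 < shrink z.
Proof. by rewrite invr_gt0 mulr_gt0//; have := nrm_ge0 z; lra. Qed.

Lemma shrink_ball z : B ((shrink z)%:C%C *: z).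
Proof.
apply/unit_ballE; rewrite nrmZ cmod_real gtr0_norm ?shrink_gt0//.
by rewrite mulrC ltr_pdivrMr; have := nrm_ge0 z; lra.
Qed.

Definition homog_ext (j : 'I_n) z : C :=
  ((shrink z)%:C%C ^+ m)^-1 * g ((shrink z)%:C%C *: z) 0 j.

Let C0 s : 0 < s -> s%:C%C != 0 :> C.
Proof. by move=> s0; rewrite -cmod_gt0 cmod_real gtr0_norm. Qed.

(** Homogeneity makes the choice of the shrinking factor irrelevant; a factor that
    stays fixed near a point gives holomorphy there. *)
Lemma homog_extE j z s : 0 < s -> B (s%:C%C *: z) ->
  homog_ext j z = (s%:C%C ^+ m)^-1 * g (s%:C%C *: z) 0 j.
Proof.
suff le s' t : 0 < s' -> s' <= t -> B (t%:C%C *: z) ->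
    (s'%:C%C ^+ m)^-1 * g (s'%:C%C *: z) 0 j = (t%:C%C ^+ m)^-1 * g (t%:C%C *: z) 0 j.
  move=> s0 Bs; rewrite /homog_ext; have [h|/ltW h] := leP s (shrink z).
    by rewrite (le _ _ s0 h (shrink_ball z)).
  by rewrite (le _ _ (shrink_gt0 z) h Bs).
move=> s0 st Bt; have t0 : 0 < t by exact: lt_le_trans st.
have -> : s'%:C%C *: z = (s' / t)%:C%C *: (t%:C%C *: z).
  by rewrite scalerA -rmorphM divfK// lt0r_neq0.
rewrite ghom//; last first.
  by rewrite cmod_real gtr0_norm ?divr_gt0// ler_pdivrMr// mul1r.
rewrite mxE rmorphM fmorphV exprMn exprVn mulrA mulKf// ?expf_neq0 ?C0//.
Qed.

Lemma homog_ext_ball j z : B z -> homog_ext j z = g z 0 j.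
Proof.
move=> Bz; rewrite (@homog_extE j z 1) ?rmorph1 ?scale1r//.
by rewrite expr1n invr1 mul1r.
Qed.

Lemma homog_ext_homogeneous j z l : homog_ext j (l *: z) = l ^+ m * homog_ext j z.
Proof.
have [y Ey] : {y : V | y = (shrink z)%:C%C *: z} by eexists.
have By : B y by rewrite Ey; exact: shrink_ball.
have l0 : 0 < 1 + cmod l by have := cmod_ge0 l; lra.
have k1 : cmod (l * ((1 + cmod l)^-1)%:C%C) <= 1.
  have kk : 0 < (1 + cmod l)^-1 by rewrite invr_gt0.
  by rewrite cmodM cmod_real (gtr0_norm kk) ler_pdivrMr//; lra.
have E : (shrink z / (1 + cmod l))%:C%C *: (l *: z) = (l * ((1 + cmod l)^-1)%:C%C) *: y.
  by rewrite Ey !scalerA rmorphM; congr (_ *: _); ring.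
rewrite (@homog_extE j _ (shrink z / (1 + cmod l))); last first.
- by rewrite E; exact: ball_scale.
- by rewrite divr_gt0// shrink_gt0.
rewrite E ghom// mxE /homog_ext -Ey.
have -> : (shrink z / (1 + cmod l))%:C%C = (shrink z)%:C%C * ((1 + cmod l)^-1)%:C%C :> C.
  by rewrite rmorphM.
rewrite !exprMn.
have a0 := C0 (shrink_gt0 z); have b0 : ((1 + cmod l)^-1)%:C%C != 0 :> C.
  by apply: C0; rewrite invr_gt0.
move: (shrink z)%:C%C (((1 + cmod l)^-1)%:C%C) (g y 0 j) a0 b0 => a b c a0 b0.
have am : a ^+ m != 0 by rewrite expf_neq0.
have bm : b ^+ m != 0 by rewrite expf_neq0.
by field; rewrite am bm.
Qed.

Lemma set_coordE p i l : set_coord p i l = set_coord p i 0 + l *: delta_mx 0 i.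
Proof.
apply/rowP => k; rewrite !mxE eqxx /=.
by case: (k == i); rewrite ?mulr1 ?add0r ?mulr0 ?addr0.
Qed.

Lemma homog_ext_line_diff j p i l : differentiable (fun l => homog_ext j (set_coord p i l)) l.
Proof.
pose s := shrink (set_coord p i l).
have du : differentiable (fun l => s%:C%C *: set_coord p i l) l.
  apply: differentiableZ; rewrite (_ : set_coord p i = fun l => set_coord p i 0 + l *: delta_mx 0 i).
    by apply: differentiableD; [exact: differentiable_cst|exact: differentiable_line].
  by apply/funext => k; exact: set_coordE.
have Bs : B (s%:C%C *: set_coord p i l) by exact: shrink_ball.
have near : \forall l' \near l, (s%:C%C ^+ m)^-1 * g (s%:C%C *: set_coord p i l') 0 j =
    homog_ext j (set_coord p i l').
  have nB : nbhs (s%:C%C *: set_coord p i l) B.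
    by apply: open_nbhs_nbhs; split; [exact: open_unit_ball|exact: Bs].
  have : \forall l' \near l, B (s%:C%C *: set_coord p i l').
    exact: (differentiable_continuous du nB).
  apply: filterS => l' Bl'.
  by rewrite (@homog_extE j (set_coord p i l') s (shrink_gt0 (set_coord p i l)) Bl').
apply: (differentiable_near near).
apply: differentiableM; first exact: differentiable_cst.
apply: differentiable_entry.
exact: (differentiable_comp du (dg Bs)).
Qed.

Lemma homog_ext_growth j p i :
  exists K : R, forall l, cmod (homog_ext j (set_coord p i l)) <= K * (1 + cmod l) ^+ m.
Proof.
pose A := 2 * (1 + nrm (set_coord p i 0) + nrm (delta_mx 0 i : V)).
exists (A ^+ m) => l; rewrite -exprMn /homog_ext cmodM cmodV cmodX.
have l0 := cmod_ge0 l; have p0 := nrm_ge0 (set_coord p i 0).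
have e0 := nrm_ge0 (delta_mx 0 i : V).
apply: (@le_trans _ _ ((2 * (1 + nrm (set_coord p i l))) ^+ m)).
  rewrite cmod_real gtr0_norm ?shrink_gt0// /shrink exprVn invrK.
  rewrite -[X in _ <= X]mulr1 ler_wpM2l//.
    by rewrite exprn_ge0// mulr_ge0//; have := nrm_ge0 (set_coord p i l); lra.
  apply: le_trans (coord_le_nrm _ _) _.
  by apply/ltW/unit_ballE; apply: gB; exact: shrink_ball.
apply: lerXn2r; rewrite ?nnegrE.
- by rewrite mulr_ge0//; have := nrm_ge0 (set_coord p i l); lra.
- by rewrite mulr_ge0 ?mulr_ge0//; lra.
have : nrm (set_coord p i l) <= nrm (set_coord p i 0) + cmod l * nrm (delta_mx 0 i : V).
  by rewrite set_coordE; apply: le_trans (nrmD _ _) _; rewrite nrmZ.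
rewrite /A; nra.
Qed.

Lemma homogeneous_polynomial : exists h : V -> V,
  homogeneous_map m h /\ forall z, B z -> h z = g z.
Proof.
have /choice[P hP] : forall j, exists P : mpoly.mpoly n C,
    P \is mpoly.ishomog1 m mpoly.mdeg /\ forall z, homog_ext j z = mpoly.meval (fun i => z 0 i) P.
  move=> j; have [P0 hP0] := polynomial_of_lines (homog_ext_line_diff j) (homog_ext_growth j).
  have [P Ph hP] := homogeneous_component hP0 (homog_ext_homogeneous j).
  by exists P; split.
exists (fun z => \row_j homog_ext j z); split; last first.
  by move=> z Bz; apply/rowP => j; rewrite mxE homog_ext_ball.
exists P; split => [j|z j]; first by case: (hP j).
by rewrite mxE; case: (hP j) => _ ->.
Qed.

End HomogeneousMaps.

Theorem theorem1 (R : realType) (n : nat) (n_ge1 : (1 <= n)%N)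
    (a b : 'rV[R[i]]_n) (a_in : unit_ball R n a) (b_in : unit_ball R n b)
    (Ma Mb : 'rV[R[i]]_n -> 'rV[R[i]]_n)
    (Ma_aut : automorphism (unit_ball R n) Ma)
    (Mb_aut : automorphism (unit_ball R n) Mb)
    (Ma0 : Ma 0 = a) (Mb0 : Mb 0 = b)
    (f : 'rV[R[i]]_n -> 'rV[R[i]]_n)
    (f_gp : geodesic_preserving (unit_ball R n) (unit_ball R n)
       (geodesics_through (unit_ball R n) a)
       (geodesics_through (unit_ball R n) b) f) :
  exists (m : nat) (g : 'rV[R[i]]_n -> 'rV[R[i]]_n),
    [/\ homogeneous_map m g,
        set_fun (unit_ball R n) (unit_ball R n) g
      & forall z, unit_ball R n z -> f z = Mb (g (pinv (unit_ball R n) Ma z))].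
Proof.
have isoa := automorphism_iso Ma_aut; have isob := automorphism_iso Mb_aut.
set Na := pinv _ Ma in isoa *; set Nb := pinv _ Mb in isob.
have [hMa hNa NMa MNa] := isoa; have [hMb hNb NMb MNb] := isob.
have [hf f_lines] := f_gp.
pose g := Nb \o (f \o Ma).
have hg : holomorphic_map (unit_ball R n) (unit_ball R n) g.
  exact: (holomorphic_map_comp hNb (holomorphic_map_comp hf hMa)).
have [gB dg] := hg.
have radial zeta : nrm zeta = 1 -> exists v, forall t : R, -1 < t < 1 ->
    exists r : R, g (t%:C%C *: zeta) = r%:C%C *: v.
  move=> z1; have L := diameter_geodesic_line isoa Ma0 a_in z1.
  have [G2 L2 fG] := f_lines _ L.
  have [v hv] := geodesic_line_real isob Mb0 b_in L2.
  exists v => t t1; apply: hv; apply: fG; exists (Ma (t%:C%C *: zeta)) => //.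
  by exists (artanh t) => //; rewrite tanhK.
have [m hm] := radial_homogeneous dg radial.
have [h [hh hE]] := homogeneous_polynomial dg gB hm.
exists m, h; split => // z Bz; first by rewrite hE//; exact: gB.
have BNa : unit_ball R n (Na z) by case: hNa => + _; apply.
by rewrite hE// /g /= MNa// MNb//; case: hf => + _; apply.
Qed.
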